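(* Let $\mathcal X,\mathcal Y,\mathcal S,\mathcal J$ be finite sets, let $P_S$ be a probability distribution on $\mathcal S$ with $P_S(s)>0$ for all $s\in\mathcal S$, and let $W_{Y|X,S,J}$ be a channel from $\mathcal X\times\mathcal S\times\mathcal J$ to $\mathcal Y$. The randomized coding capacity of the Gel'fand-Pinsker AVC given by $(P_S,W_{Y|X,S,J})$ under the average probability of error criterion equals its randomized coding capacity under the maximum probability of error criterion; that is, it equals $$\max_{P_{U|S},\,x(\cdot,\cdot)}\ \min_{Q_{J|S}}\ \bigl(I(U;Y)-I(U;S)\bigr),$$ where the maximum is over $P_{U|S}\in\mathcal P(\mathcal U|\mathcal S)$ and $x:\mathcal U\times\mathcal S\to\mathcal X$ with $|\mathcal U|\le|\mathcal X|^{|\mathcal S|}$, the minimum is over $Q_{J|S}\in\mathcal P(\mathcal J|\mathcal S)$, and the mutual informations are evaluated under $P_S(s)P_{U|S}(u|s)Q_{J|S}(j|s)\mathbf 1\{x=x(u,s)\}W_{Y|X,S,J}(y|x,s,j)$. Moreover, the capacity under a state-aware adversary who also knows the message $M$ is the same as the capacity under a state-aware adversary who does not know the message (i.e. one restricted to jamming strategies of the form $Q_{\mathbf J|\mathbf S}$).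
   Context: $\mathcal P(\mathcal A|\mathcal B)$ denotes the set of all conditional distributions on $\mathcal A$ given an element of $\mathcal B$. All logarithms are base 2. Gel'fand-Pinsker AVC (GP-AVC). Over $n$ channel uses the state vector $\mathbf S=(S_1,\dots,S_n)$ is i.i.d. with distribution $P_S$, independent of the message $M$ and of the shared randomness. Given encoder input $\mathbf x\in\mathcal X^n$, state $\mathbf s\in\mathcal S^n$ and jamming vector $\mathbf j\in\mathcal J^n$, the output is $\mathbf y\in\mathcal Y^n$ with probability $\prod_{i=1}^n W_{Y|X,S,J}(y_i|x_i,s_i,j_i)$. An $(n,R)$ deterministic code ($2^{nR}$ an integer) is a pair $(\psi,\phi)$ with encoder $\psi:\{1,\dots,2^{nR}\}\times\mathcal S^n\to\mathcal X^n$ and decoder $\phi:\mathcal Y^n\to\{0,1,\dots,2^{nR}\}$ (output $0$ means an error is declared). An $(n,R)$ randomized code is a random variable $\Theta=(\Psi,\Phi)$ taking values in the set of $(n,R)$ deterministic codes; it is shared by encoder and decoder. The transmitted vector is $\mathbf X=\Psi(M,\mathbf S)$. The adversary knows $M$, $\mathbf S$ and the distribution of $\Theta$, but not the realization of $\Theta$: it chooses $\mathbf J$ according to an arbitrary $Q_{\mathbf J|M,\mathbf S}$, with $\mathbf J$ conditionally independent of $\Theta$ given $(M,\mathbf S)$. Put $P^{(n)}_{e,m}=\max_{Q_{\mathbf J|M=m,\mathbf S}}\mathbb P(\Phi(\mathbf Y)\ne m\mid M=m)$, the probability being over $\mathbf S$, $\mathbf J$, the channel and $\Theta$. The maximum probability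 of error is $\max_m P^{(n)}_{e,m}$ and the average probability of error is $2^{-nR}\sum_{m=1}^{2^{nR}}P^{(n)}_{e,m}$. For an adversary who does not know the message, the jamming distribution $Q_{\mathbf J|\mathbf S}$ must be the same for all $m$, and the error probability is the worst case over such $Q_{\mathbf J|\mathbf S}$. Under a given error criterion, a rate $R$ is achievable if for every $\epsilon>0$ there is an $(n,R)$ randomized code for some $n$ with error probability less than $\epsilon$; the capacity is the supremum of all achievable rates. *)

(* Defs.v *)
From HB Require Import structures.
From mathcomp Require Import all_boot all_order all_algebra.
From mathcomp Require Import all_classical all_reals all_analysis.

Set Implicit Arguments.
Unset Strict Implicit.
Unset Printing Implicit Defensive.

Import Order.TTheory GRing.Theory Num.Theory.

Local Open Scope classical_set_scope.
Local Open Scope ring_scope.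

Definition is_maximum (R : realType) (A : set R) (v : R) : Prop :=
  A v /\ ubound A v.

Definition is_minimum (R : realType) (A : set R) (v : R) : Prop :=
  A v /\ lbound A v.

Definition is_dist (R : realType) (T : finType) (p : T -> R) : Prop :=
  (forall t, 0 <= p t) /\ \sum_t p t = 1.

(* P(A|B); the conditioning variable is the first argument. *)
Definition is_cond_dist (R : realType) (B A : finType) (k : B -> A -> R) :
    Prop :=
  forall b, is_dist (k b).

Definition log2 (R : realType) (x : R) : R := ln x / ln 2.

(* Terms with p a b = 0 vanish, which is the convention 0 log 0 = 0; when
   p a b > 0 both marginals are positive. *)
Definition mutual_info (R : realType) (A B : finType) (p : A -> B -> R) : R :=
  \sum_a \sum_b
    p a b * log2 (p a b / ((\sum_b' p a b') * (\sum_a' p a' b))).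

Section SingleLetter.
Context (R : realType) (X Y S J : finType).
Variables (PS : S -> R) (W : X -> S -> J -> Y -> R).

Definition gp_law (U : finType) (PU : S -> U -> R) (f : U -> S -> X)
    (Q : S -> J -> R) (u : U) (s : S) (j : J) (x : X) (y : Y) : R :=
  PS s * PU s u * Q s j * (x == f u s)%:R * W x s j y.

Definition gp_law_UY (U : finType) (PU : S -> U -> R) (f : U -> S -> X)
    (Q : S -> J -> R) (u : U) (y : Y) : R :=
  \sum_s \sum_j \sum_x gp_law PU f Q u s j x y.

Definition gp_law_US (U : finType) (PU : S -> U -> R) (f : U -> S -> X)
    (Q : S -> J -> R) (u : U) (s : S) : R :=
  \sum_j \sum_x \sum_y gp_law PU f Q u s j x y.

(* I(U;Y) - I(U;S) *)
Definition gp_gain (U : finType) (PU : S -> U -> R) (f : U -> S -> X)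
    (Q : S -> J -> R) : R :=
  mutual_info (gp_law_UY PU f Q) - mutual_info (gp_law_US PU f Q).

Definition is_gp_min (U : finType) (PU : S -> U -> R) (f : U -> S -> X)
    (v : R) : Prop :=
  is_minimum [set gp_gain PU f Q | Q in [set Q | is_cond_dist Q]] v.

(* C = max_{P_{U|S}, x(.,.)} min_{Q_{J|S}} (I(U;Y) - I(U;S)), including that
   every inner minimum and the outer maximum are attained. *)
Definition is_gp_maxmin (C : R) : Prop :=
  (forall (U : finType) (PU : S -> U -> R) (f : U -> S -> X),
     (#|U| <= #|X| ^ #|S|)%N -> is_cond_dist PU ->
     exists v, is_gp_min PU f v) /\
  is_maximum
    [set v | exists (U : finType) (PU : S -> U -> R) (f : U -> S -> X),
       [/\ (#|U| <= #|X| ^ #|S|)%N, is_cond_dist PU & is_gp_min PU f v]] C.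

End SingleLetter.

Notation vec n T := {ffun 'I_n -> T}.

(* Deterministic codes (psi, phi) with N messages, the messages being the
   elements of 'I_N; the decoder output None declares an error. *)
Definition det_code (X Y S : finType) (n N : nat) : finType :=
  ({ffun 'I_N * vec n S -> vec n X} * {ffun vec n Y -> option 'I_N})%type.

(* The set of deterministic codes is finite and Theta is independent of M and
   the state, so a randomized code enters only through the distribution of
   Theta, here its mass function. *)
Section Coding.
Context (R : realType) (X Y S J : finType).
Variables (PS : S -> R) (W : X -> S -> J -> Y -> R).

(* P(Phi(Y) <> m | M = m), with J drawn from Q(.|s), independently of Theta
   given S = s. *)
Definition err_prob (n N : nat) (Theta : det_code X Y S n N -> R)
    (Q : vec n S -> vec n J -> R) (m : 'I_N) : R :=
  \sum_(c : det_code X Y S n N) \sum_(s : vec n S) \sum_(j : vec n J)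
    \sum_(y : vec n Y | c.2 y != Some m)
      Theta c * (\prod_i PS (s i)) * Q s j *
      \prod_i W (c.1 (m, s) i) (s i) (j i) (y i).

(* In each of the four criteria below, sup runs over the values of a continuous
   function on the nonempty compact set of jamming strategies, so it is a
   maximum. *)

(* P_{e,m}^(n) : the jamming strategy may depend on m. *)
Definition worst_err_prob (n N : nat) (Theta : det_code X Y S n N -> R)
    (m : 'I_N) : R :=
  sup [set err_prob Theta Q m | Q in [set Q | is_cond_dist Q]].

Definition max_err (n N : nat) (Theta : det_code X Y S n N -> R) : R :=
  \big[Num.max/0]_(m < N) worst_err_prob Theta m.

Definition avg_err (n N : nat) (Theta : det_code X Y S n N -> R) : R :=
  N%:R^-1 * \sum_(m < N) worst_err_prob Theta m.

Definition max_err_oblivious (n N : nat)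
    (Theta : det_code X Y S n N -> R) : R :=
  sup [set \big[Num.max/0]_(m < N) err_prob Theta Q m
      | Q in [set Q | is_cond_dist Q]].

Definition avg_err_oblivious (n N : nat)
    (Theta : det_code X Y S n N -> R) : R :=
  sup [set N%:R^-1 * \sum_(m < N) err_prob Theta Q m
      | Q in [set Q | is_cond_dist Q]].

End Coding.

(* n = 0 is excluded: with no channel use every r would satisfy 2^(n r) = 1. *)
Definition achievable (R : realType) (X Y S : finType)
    (err : forall n N : nat, (det_code X Y S n N -> R) -> R) (r : R) : Prop :=
  forall eps : R, 0 < eps ->
    exists (n N : nat) (Theta : det_code X Y S n N -> R),
      [/\ (0 < n)%N, N%:R = 2 `^ (n%:R * r), is_dist Theta
        & err n N Theta < eps].

(* Taken in \bar R so that it is a genuine supremum even for an empty or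
   unbounded set of rates. *)
Definition capacity (R : realType) (X Y S : finType)
    (err : forall n N : nat, (det_code X Y S n N -> R) -> R) : \bar R :=
  ereal_sup [set r%:E | r in [set r | achievable err r]].

(* Main.v *)
Require Import Defs.
From HB Require Import structures.
From mathcomp Require Import all_boot all_order all_algebra.
From mathcomp Require Import all_classical all_reals all_analysis.
From mathcomp Require Import ring lra.

(* All informations are computed in nats; in terms of negative entropies h the
   objective is h(U,Y) - h(Y) - h(U,S) + h(S).

   Reduction of the alphabet. An auxiliary variable U may be replaced by the
   Shannon strategy T : S -> X drawn from it, independently of S given U; this
   increases the objective for every jamming Q simultaneously. Hence U = X^S
   with the evaluation map suffices, and the max-min is attained by compactness.

   Converse. The adversary jams with a product of kernels Q_0, ..., Q_(n-1),
   chosen one after the other: the law of U_k = (code, message, Y_(<k), S_(>k))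
   together with (S_k, X_k) depends on Q_0, ..., Q_(k-1) only, so Q_k can be the
   worst response to it. The quantities I(V, S_(>=k); Y_(<k)), with V = (code,
   message), telescope from 0 to I(V; Y^n), and each increment is at most the
   objective at stage k, hence at most the max-min value; no minimax theorem is
   needed. Fano's inequality is replaced by a Donsker-Varadhan bound with a free
   parameter, since the blocklength need not grow.

   Achievability. Encoder and decoder choose codewords at random with
   probabilities proportional to P(u|s)/P(u) and to the likelihood ratio
   v(u,y) = P(u,y)/(P(u)P(y)) under the worst single-letter jamming Q*. Jensen's
   inequality over the codebook bounds the probability of correct decoding, and
   first-order optimality of Q* shows that no jamming, even one depending on the
   state sequence and the message, lowers the mean of log v. The decoder first
   adds a little uniform noise to the output, so that v > 0. *)

Import Order.TTheory GRing.Theory Num.Theory.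
Import numFieldNormedType.Exports.

Set Implicit Arguments.
Unset Strict Implicit.
Unset Printing Implicit Defensive.

Local Open Scope ring_scope.

(** * Entropy *)

(** The obstacle to achievability is that the jammer sees the whole state sequence and the message
    and may correlate its letters. The error bound is therefore arranged so that, for fixed state
    and jamming sequences, it is a sum of two products over the coordinates: after averaging over
    the codebook only t-th moments of likelihood ratios remain, for a small power t. The worst
    jamming for such a bound is a deterministic map from states to symbols, applied letter by
    letter, and its exponent is governed to first order in t by the mean of log v. This use of small
    powers replaces typicality; it needs log v to be bounded, which the added noise ensures at the
    price of the binary entropy of the noise level and of a small fraction of the information. The
    converse is proved for the smallest error criterion (average error, message unknown to the
    jammer) and achievability for the largest (maximum error, message known). All four criteria lie
    between these two, so their capacities agree. *)

Section Gibbs.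
Context (R : realType).
Implicit Types p q x : R.

Lemma ln_le_subr1 x : 0 < x -> ln x <= x - 1.
Proof.
move=> x0; have <- : 1 + (x - 1) = x by lra.
by rewrite (le_trans (le_ln1Dx _)) //; lra.
Qed.

(** The bound ln x <= x - 1 at x = q/p. Summed over two families where [q] has no more mass than
    [p], it gives nonnegativity of the relative entropy. *)
Lemma gibbs p q : 0 <= p -> 0 <= q -> (q = 0 -> p = 0) ->
  p - q <= p * (ln p - ln q).
Proof.
rewrite le_eqVlt => /predU1P[<-|p0].
  by move=> q0 _; rewrite mul0r sub0r oppr_le0.
rewrite le_eqVlt => /predU1P[<-|q0 _]; first by move=> /(_ erefl) ->; lra.
have := ln_le_subr1 (divr_gt0 q0 p0).
rewrite ln_div ?posrE// => /(ler_wpM2l (ltW p0)) H.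
have E : p * (q / p - 1) = q - p by field; rewrite gt_eqF.
by rewrite E in H; lra.
Qed.

End Gibbs.

Section Entropy.
Context (R : realType) (O : finType) (p : O -> R).
Hypothesis p_ge0 : forall w, 0 <= p w.

Definition law (A : eqType) (f : O -> A) (a : A) : R := \sum_(w | f w == a) p w.

(** Minus the Shannon entropy of [f]. Summing over the sample space instead of over [A] makes it
    depend visibly on the partition into fibres only, so regrouping variables needs no bijection
    between their types ([eq_negent]). *)
Definition negent (A : eqType) (f : O -> A) : R :=
  \sum_w p w * ln (law f (f w)).

Lemma law_ge0 (A : eqType) (f : O -> A) a : 0 <= law f a.
Proof. exact: sumr_ge0. Qed.

Lemma le_law (A : eqType) (f : O -> A) w : p w <= law f (f w).
Proof.
by rewrite /law (bigD1 w)//= lerDl sumr_ge0.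
Qed.

Lemma law_mono (A B : eqType) (f : O -> A) (g : O -> B) a b :
  (forall w, f w == a -> g w == b) -> law f a <= law g b.
Proof.
move=> fg; rewrite /law [leLHS]big_mkcond [leRHS]big_mkcond.
apply: ler_sum => w _; case: ifPn => [/fg ->//|_]; by case: ifP.
Qed.

Lemma negent_sum (A : finType) (f : O -> A) :
  negent f = \sum_a law f a * ln (law f a).
Proof.
rewrite /negent (partition_big f predT)//=; apply: eq_bigr => a _.
rewrite {2}/law mulr_suml; apply: eq_bigr => w /eqP <- //.
Qed.

Lemma eq_negent (A B : eqType) (f : O -> A) (g : O -> B) :
  (forall w w', (f w == f w') = (g w == g w')) -> negent f = negent g.
Proof.
move=> fg; apply: eq_bigr => w _; congr (_ * ln _).
by apply: eq_bigl => w'; rewrite fg.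
Qed.

Lemma law_pairl (A B : finType) (f : O -> A) (g : O -> B) a :
  law f a = \sum_b law (fun w => (f w, g w)) (a, b).
Proof.
rewrite /law (partition_big g predT)//=; apply: eq_bigr => b _.
Qed.

Lemma sum_law (A : finType) (f : O -> A) : \sum_a law f a = \sum_w p w.
Proof. by rewrite [RHS](partition_big f predT). Qed.

Lemma sum_law_mul (A : finType) (f : O -> A) (F : A -> R) :
  \sum_w p w * F (f w) = \sum_a law f a * F a.
Proof.
rewrite (partition_big f predT)//=; apply: eq_bigr => a _.
by rewrite /law mulr_suml; apply: eq_bigr => w /eqP ->.
Qed.

(** This is I(f;g|k) >= 0: Gibbs' inequality between the joint law and P(f,k) P(g,k) / P(k), whose
    mass does not exceed that of [p]. *)
Lemma negent_submod (A B C : finType) (f : O -> A) (g : O -> B) (k : O -> C) :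
  negent (fun w => (f w, k w)) + negent (fun w => (g w, k w)) <=
  negent (fun w => (f w, g w, k w)) + negent k.
Proof.
pose fk := fun w => (f w, k w); pose gk := fun w => (g w, k w).
pose fgk := fun w => (f w, g w, k w).
pose q (x : A * B * C) := law fk (x.1.1, x.2) * law gk (x.1.2, x.2) / law k x.2.
have q_ge0 x : 0 <= q x by rewrite !mulr_ge0 ?invr_ge0 ?law_ge0.
have sumq : \sum_x q x <= \sum_w p w.
  rewrite -(sum_law k).
  rewrite -(pair_bigA _ (fun x c => q (x, c)))/= exchange_big/=.
  apply: ler_sum => c _.
  rewrite -(pair_bigA _ (fun a b => q ((a, b), c)))/=.
  under eq_bigr do rewrite /q /= -mulr_suml -mulr_sumr.
  rewrite -!mulr_suml.
  have -> : \sum_(i : A) law fk (i, c) = law k c.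
    rewrite (law_pairl k f); apply: eq_bigr => a _; apply: eq_bigl => w /=.
    by rewrite !xpair_eqE andbC.
  have -> : \sum_(i : B) law gk (i, c) = law k c.
    rewrite (law_pairl k g); apply: eq_bigr => a _; apply: eq_bigl => w /=.
    by rewrite !xpair_eqE andbC.
  have [->|nz] := eqVneq (law k c) 0; first by rewrite !mul0r.
  by rewrite mulfK.
have fgk_pos x : law fgk x != 0 -> 0 < law fgk x.
  by move=> nz; rewrite lt_neqAle law_ge0 eq_sym nz.
have pos x : law fgk x != 0 -> 0 < law k x.2.
  move=> /fgk_pos /lt_le_trans; apply; apply: law_mono => w.
  by case: x => -[a b] c; rewrite !xpair_eqE => /andP[].
have posf x : law fgk x != 0 -> 0 < law fk (x.1.1, x.2).
  move=> /fgk_pos /lt_le_trans; apply; apply: law_mono => w.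
  by case: x => -[a b] c; rewrite !xpair_eqE => /andP[/andP[-> _] ->].
have posg x : law fgk x != 0 -> 0 < law gk (x.1.2, x.2).
  move=> /fgk_pos /lt_le_trans; apply; apply: law_mono => w.
  by case: x => -[a b] c; rewrite !xpair_eqE => /andP[/andP[_ ->] ->].
have E1 : negent fk = \sum_x law fgk x * ln (law fk (x.1.1, x.2)).
  by rewrite -(sum_law_mul fgk (fun x => ln (law fk (x.1.1, x.2)))).
have E2 : negent gk = \sum_x law fgk x * ln (law gk (x.1.2, x.2)).
  by rewrite -(sum_law_mul fgk (fun x => ln (law gk (x.1.2, x.2)))).
have E3 : negent k = \sum_x law fgk x * ln (law k x.2).
  by rewrite -(sum_law_mul fgk (fun x => ln (law k x.2))).
rewrite -/fk -/gk -/fgk E1 E2 E3 negent_sum -!big_split/= -subr_ge0 -sumrB.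
apply: (@le_trans _ _ (\sum_x (law fgk x - q x))).
  by rewrite sumrB sum_law subr_ge0.
apply: ler_sum => x _.
have [->|nz] := eqVneq (law fgk x) 0.
  by rewrite !mul0r !addr0 subr0 sub0r oppr_le0.
have l1 := pos _ nz; have l2 := posf _ nz; have l3 := posg _ nz.
apply: le_trans (gibbs (law_ge0 _ _) (q_ge0 x) _) _.
  by move=> /eqP; rewrite /q !mulf_eq0 invr_eq0 !gt_eqF.
rewrite /q ln_div ?posrE ?mulr_gt0// lnM ?posrE//; lra.
Qed.

Lemma negent_subadd (A B : finType) (f : O -> A) (g : O -> B) :
  \sum_w p w = 1 -> negent f + negent g <= negent (fun w => (f w, g w)).
Proof.
move=> p1; have := negent_submod f g (fun=> tt).
have -> : negent (fun=> tt) = 0.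
  rewrite /negent big1// => w _; rewrite /law.
  under eq_bigl do rewrite eqxx.
  by rewrite p1 ln1 mulr0.
rewrite addr0.
rewrite (@eq_negent _ _ (fun w => (f w, tt)) f); last first.
  by move=> w w'; rewrite xpair_eqE eqxx andbT.
rewrite (@eq_negent _ _ (fun w => (g w, tt)) g); last first.
  by move=> w w'; rewrite xpair_eqE eqxx andbT.
rewrite (@eq_negent _ _ (fun w => (f w, g w, tt)) (fun w => (f w, g w)))//.
by move=> w w'; rewrite xpair_eqE eqxx andbT.
Qed.

Lemma law_fiber (A B : finType) (f : O -> A) (h : A -> B -> O) (k : O -> B) a :
  (forall a b, f (h a b) = a) -> (forall a b, k (h a b) = b) ->
  (forall w, h (f w) (k w) = w) -> law f a = \sum_b p (h a b).
Proof.
move=> fh kh hfk; rewrite /law (reindex_onto (h a) k) => [|w /eqP <-//].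
by apply: eq_bigl => b; rewrite fh kh !eqxx.
Qed.

(** Both differences equal the mean of ln [c]. With [c] a conditional probability this is
    conditional independence in entropy form, H(f|g) = H(h|k). *)
Lemma negent_diff (A B C D : eqType) (f : O -> A) (g : O -> B) (h : O -> C)
    (k : O -> D) (c : O -> R) :
  (forall w, law f (f w) = c w * law g (g w)) ->
  (forall w, law h (h w) = c w * law k (k w)) ->
  negent f - negent g = negent h - negent k.
Proof.
move=> fg hk; rewrite /negent -!sumrB; apply: eq_bigr => w _.
have [->|nz] := eqVneq (p w) 0; first by rewrite !mul0r.
have pw : 0 < p w by rewrite lt_neqAle p_ge0 eq_sym nz.
have pos (E : eqType) (l : O -> E) : 0 < law l (l w) by exact: lt_le_trans
  (le_law _ _).
have c0 : 0 < c w by have := pos _ f; rewrite fg pmulr_lgt0.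
rewrite -!mulrBr; congr (_ * _).
rewrite fg hk !lnM ?posrE//; lra.
Qed.

End Entropy.

(** * The objective and its reduction to Shannon strategies *)

Section Objective.
Context (R : realType).

Definition xlnx (x : R) : R := x * ln x.

Lemma ln2_gt0 : 0 < ln 2 :> R.
Proof. by rewrite ln_gt0// ltr1n. Qed.

Lemma mutual_infoE (A B : finType) (p : A -> B -> R) :
  (forall a b, 0 <= p a b) ->
  ln 2 * mutual_info p = \sum_a \sum_b xlnx (p a b)
    - \sum_a xlnx (\sum_b p a b) - \sum_b xlnx (\sum_a p a b).
Proof.
move=> p0; rewrite /mutual_info mulr_sumr.
have -> : \sum_b xlnx (\sum_a p a b) =
    \sum_a \sum_b p a b * ln (\sum_a' p a' b).
  by rewrite exchange_big/=; apply: eq_bigr => b _; rewrite /xlnx mulr_suml.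
rewrite -!sumrB; apply: eq_bigr => a _.
rewrite /xlnx mulr_suml -!sumrB mulr_sumr; apply: eq_bigr => b _.
have [->|nz] := eqVneq (p a b) 0; first by rewrite !mul0r mulr0 !subr0.
have pab : 0 < p a b by rewrite lt_neqAle p0 eq_sym nz.
have p1 : 0 < \sum_b' p a b'.
  by rewrite (bigD1 b)//= ltr_pwDl// sumr_ge0.
have p2 : 0 < \sum_a' p a' b.
  by rewrite (bigD1 a)//= ltr_pwDl// sumr_ge0.
rewrite /log2 ln_div ?posrE ?mulr_gt0// lnM ?posrE//.
by field; rewrite gt_eqF// ln2_gt0.
Qed.

Context (X Y S : finType).

(* [gp_obj mu V] is I(U;Y) - I(U;S) in nats when (U,S,X) has law [mu] and Y is
   obtained from (X,S) through [V]; the terms H(U) cancel. *)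
Definition gp_obj (U : finType) (mu : U -> S -> X -> R) (V : X -> S -> Y ->
  R) :=
  \sum_u \sum_y xlnx (\sum_s \sum_x mu u s x * V x s y)
  - \sum_y xlnx (\sum_u \sum_s \sum_x mu u s x * V x s y)
  - \sum_u \sum_s xlnx (\sum_x mu u s x)
  + \sum_s xlnx (\sum_u \sum_x mu u s x).

(** The point mass at [x0] keeps this a distribution when all weights vanish. It serves as
    conditional law of X given (U,S), also at null pairs, and later as the random choice of a
    codeword. *)
Definition normalize (A : finType) (x0 : A) (a : A -> R) (x : A) : R :=
  if \sum_x' a x' == 0 then (x == x0)%:R else a x / \sum_x' a x'.

Lemma normalize_dist (A : finType) (x0 : A) (a : A -> R) :
  (forall x, 0 <= a x) -> is_dist (normalize x0 a).
Proof.
move=> a0; rewrite /normalize.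
case: (boolP (\sum_x' a x' == 0)) => H; split.
- by move=> x; rewrite ler0n.
- rewrite (bigD1 x0)//= eqxx big1 => [|x /negbTE -> //].
  by rewrite addr0.
- by move=> x; rewrite divr_ge0// sumr_ge0.
- by rewrite -mulr_suml divff.
Qed.

Lemma normalizeK (A : finType) (x0 : A) (a : A -> R) x :
  (forall x, 0 <= a x) -> (\sum_x' a x') * normalize x0 a x = a x.
Proof.
move=> a0; rewrite /normalize; case: ifPn => [/eqP H|H].
  rewrite H mul0r; apply/esym/eqP.
  have /eqP := H; rewrite psumr_eq0// => /allP/(_ x).
  by rewrite mem_index_enum => /(_ isT).
by rewrite mulrC divfK.
Qed.

Lemma sum_prod_dist (I T : finType) (k : I -> T -> R) :
  (forall i, \sum_t k i t = 1) ->
  \sum_(g : {ffun I -> T}) \prod_i k i (g i) = 1.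
Proof. by move=> k1; rewrite -bigA_distr_bigA big1. Qed.

Lemma sum_prod_dist_at (I T : finType) (k : I -> T -> R) (i : I) (F : T -> R) :
  (forall i, \sum_t k i t = 1) ->
  \sum_(g : {ffun I -> T}) \prod_j k j (g j) * F (g i) = \sum_t k i t * F t.
Proof.
move=> k1.
pose k' j t := k j t * (if j == i then F t else 1).
transitivity (\sum_(g : {ffun I -> T}) \prod_j k' j (g j)).
  apply: eq_bigr => g _; rewrite big_split/=; congr (_ * _).
  by rewrite (bigD1 i)//= eqxx big1 ?mulr1// => j /negbTE ->.
rewrite -bigA_distr_bigA (bigD1 i)//= [X in _ * X]big1 => [|j /negbTE ji].
  by rewrite mulr1; apply: eq_bigr => t _; rewrite /k' eqxx.
by rewrite -[RHS](k1 j); apply: eq_bigr => t _; rewrite /k' ji mulr1.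
Qed.

Section Reduction.
Context (U : finType) (mu : U -> S -> X -> R) (V : X -> S -> Y -> R) (x0 : X).
Hypothesis mu_ge0 : forall u s x, 0 <= mu u s x.
Hypothesis V_dist : forall x s, is_dist (V x s).

Let T := {ffun S -> X}.
(** Given U, the values T(s) are drawn independently over s, each from the law of X given (U, S =
    s). The draw ignores the actual state, yet T(S) has the conditional law of X. *)
Let kap u (t : T) := \prod_s normalize x0 (mu u s) (t s).
Let muS u s := \sum_x mu u s x.

Definition strategy_law (t : {ffun S -> X}) (s : S) : R :=
  \sum_u muS u s * kap u t.

Let O := (U * T * S * Y)%type.
Let p (w : O) := let: (u, t, s, y) := w in muS u s * kap u t * V (t s) s y.
Let u_ (w : O) := w.1.1.1.
Let t_ (w : O) := w.1.1.2.
Let s_ (w : O) := w.1.2.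
Let y_ (w : O) := w.2.

Let kap_ge0 u t : 0 <= kap u t.
Proof. by apply: prodr_ge0 => s _; case: (normalize_dist x0 (mu_ge0 u s)). Qed.

Let kap1 u : \sum_t kap u t = 1.
Proof.
apply: (sum_prod_dist (k := fun s => normalize x0 (mu u s))) => s.
by case: (normalize_dist x0 (mu_ge0 u s)).
Qed.

Let p_ge0 w : 0 <= p w.
Proof.
case: w => [[[u t] s] y] /=; rewrite !mulr_ge0 ?kap_ge0//.
  by rewrite sumr_ge0.
by case: (V_dist (t s) s).
Qed.

Let sumV x s : \sum_y V x s y = 1. Proof. by case: (V_dist x s). Qed.

Let law_uy u y : law p (fun w => (u_ w, y_ w)) (u, y) =
  \sum_s \sum_x mu u s x * V x s y.
Proof.
rewrite (@law_fiber _ _ _ _ (T * S)%type _ (fun a b => (a.1, b.1, b.2, a.2))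
  (fun w => (t_ w, s_ w)))//=; first last.
- by case=> [[[]]].
- by move=> a [].
- by case.
rewrite -(pair_bigA _ (fun t s => muS u s * kap u t * V (t s) s y))/=.
rewrite exchange_big/=; apply: eq_bigr => s _.
under eq_bigr do rewrite -mulrA.
rewrite -mulr_sumr (sum_prod_dist_at (k := fun s => normalize x0 (mu u s)) s
  (fun x => V x s y)) => [|s']; last first.
  by case: (normalize_dist x0 (mu_ge0 u s')).
by rewrite mulr_sumr; apply: eq_bigr => x _; rewrite mulrA normalizeK.
Qed.

Let law_us u s : law p (fun w => (u_ w, s_ w)) (u, s) = muS u s.
Proof.
rewrite (@law_fiber _ _ _ _ (T * Y)%type _ (fun a b => (a.1, b.1, a.2, b.2))
  (fun w => (t_ w, y_ w)))//=; first last.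
- by case=> [[[]]].
- by move=> a [].
- by case.
rewrite -(pair_bigA _ (fun t y => muS u s * kap u t * V (t s) s y))/=.
under eq_bigr do rewrite -mulr_sumr sumV mulr1.
by rewrite -mulr_sumr kap1 mulr1.
Qed.

Let law_ust u s t : law p (fun w => (u_ w, s_ w, t_ w)) (u, s, t) =
  muS u s * kap u t.
Proof.
rewrite (@law_fiber _ _ _ _ Y _ (fun a b => (a.1.1, a.2, a.1.2, b))
  (fun w => y_ w))//=; first last.
- by case=> [[[]]].
- by case=> -[].
by rewrite -mulr_sumr sumV mulr1.
Qed.

Let law_ut u t : law p (fun w => (u_ w, t_ w)) (u, t) =
  (\sum_s muS u s) * kap u t.
Proof.
rewrite (law_pairl _ _ s_) mulr_suml; apply: eq_bigr => s _.
rewrite -law_ust; apply: eq_bigl => w.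
by rewrite !xpair_eqE andbAC.
Qed.

Let law_u u : law p u_ u = \sum_s muS u s.
Proof. by rewrite (law_pairl _ _ s_); apply: eq_bigr => s _;
  rewrite law_us. Qed.

Let law_ts t s : law p (fun w => (t_ w, s_ w)) (t, s) = strategy_law t s.
Proof.
rewrite (law_pairl _ _ u_); apply: eq_bigr => u _.
rewrite -law_ust; apply: eq_bigl => w.
by rewrite !xpair_eqE [in RHS]andbC andbA [in RHS]andbAC.
Qed.

Let law_sty s t y : law p (fun w => (s_ w, t_ w, y_ w)) (s, t, y) =
  strategy_law t s * V (t s) s y.
Proof.
rewrite (@law_fiber _ _ _ _ U _ (fun a b => (b, a.1.2, a.1.1, a.2))
  (fun w => u_ w))//=; first last.
- by case=> [[[]]].
- by case=> -[].
by rewrite mulr_suml.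
Qed.

Let law_ty t y : law p (fun w => (t_ w, y_ w)) (t, y) =
  \sum_s strategy_law t s * V (t s) s y.
Proof.
rewrite (law_pairl _ _ s_); apply: eq_bigr => s _.
rewrite -law_sty; apply: eq_bigl => w.
by rewrite !xpair_eqE; do 3 case: (_ == _).
Qed.

Let law_s s : law p s_ s = \sum_u muS u s.
Proof.
rewrite (law_pairl _ _ u_); apply: eq_bigr => u _.
by rewrite -law_us; apply: eq_bigl => w; rewrite !xpair_eqE andbC.
Qed.

(* Passing from U to the Shannon strategy T, drawn given U independently of S,
   can only increase the objective: H(T|U,S) = H(T|U) >= H(T|U,Y), and
   U - (T,S) - Y is a Markov chain. *)
Lemma gp_obj_strategy :
  gp_obj mu V <=
  gp_obj (fun t s x => strategy_law t s * (x == t s)%:R) V.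
Proof.
have xE (F : X -> R) x1 : \sum_x (x == x1)%:R * F x = F x1.
  rewrite (bigD1 x1)//= eqxx mul1r big1 ?addr0// => x /negbTE ->.
  by rewrite mul0r.
have TE t s y : \sum_x strategy_law t s * (x == t s)%:R * V x s y =
    strategy_law t s * V (t s) s y.
  by under eq_bigr do rewrite -mulrA; rewrite -mulr_sumr xE.
have TS t s : \sum_x strategy_law t s * (x == t s)%:R = strategy_law t s.
  rewrite -[RHS]mulr1 -mulr_sumr; congr (_ * _).
  by under eq_bigr do rewrite -[_%:R]mulr1; rewrite xE.
have Ey y : \sum_u \sum_s \sum_x mu u s x * V x s y = law p y_ y.
  rewrite (law_pairl _ _ u_); apply: eq_bigr => u _.
  by rewrite -law_uy; apply: eq_bigl => w; rewrite !xpair_eqE andbC.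
have Ey' y : \sum_t \sum_s \sum_x strategy_law t s * (x == t s)%:R * V x s y
    = law p y_ y.
  rewrite (law_pairl _ _ t_); apply: eq_bigr => t _.
  under eq_bigr do rewrite TE.
  by rewrite -law_ty; apply: eq_bigl => w; rewrite !xpair_eqE andbC.
have Es s : \sum_u \sum_x mu u s x = law p s_ s by rewrite law_s.
have Es' s : \sum_t \sum_x strategy_law t s * (x == t s)%:R = law p s_ s.
  rewrite (law_pairl _ _ t_); apply: eq_bigr => t _; rewrite TS.
  by rewrite -law_ts; apply: eq_bigl => w; rewrite !xpair_eqE andbC.
rewrite /gp_obj.
under eq_bigr do under eq_bigr do rewrite -law_uy.
under [X in _ - X - _ + _]eq_bigr do rewrite Ey.
under [X in _ - X + _]eq_bigr do under eq_bigr do rewrite -[\sum__ _]law_us.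
under [X in _ + X]eq_bigr do rewrite Es.
under [X in _ <= X - _ - _ + _]eq_bigr do under eq_bigr do
  (under eq_bigr do rewrite TE; rewrite -law_ty).
under [X in _ <= _ - X - _ + _]eq_bigr do rewrite Ey'.
under [X in _ <= _ - X + _]eq_bigr do under eq_bigr do rewrite TS -law_ts.
under [X in _ <= _ + X]eq_bigr do rewrite Es'.
rewrite !pair_bigA/=.
have N2 (A B : finType) (f : O -> A * B) :
    \sum_z xlnx (law p f (z.1, z.2)) = negent p f.
  by rewrite negent_sum; apply: eq_bigr => -[a b].
rewrite !N2.
(* [S1] is I(T;Y|U) >= 0 and [S2] is I(U;S|T,Y) >= 0. The two Markov relations [D1] and [D2] cancel
   every term that contains U together with T. *)
have S1 := negent_submod p_ge0 t_ y_ u_.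
have S2 := negent_submod p_ge0 u_ s_ (fun w => (t_ w, y_ w)).
have D1 : negent p (fun w => (u_ w, s_ w, t_ w)) - negent p (fun w => (u_ w,
  s_ w))
  = negent p (fun w => (u_ w, t_ w)) - negent p u_.
  apply: (negent_diff p_ge0 (c := fun w => kap (u_ w) (t_ w))) => w.
    by rewrite law_ust law_us mulrC.
  by rewrite law_ut law_u mulrC.
have D2 : negent p id - negent p (fun w => (u_ w, s_ w, t_ w))
  = negent p (fun w => (s_ w, t_ w, y_ w)) - negent p (fun w => (t_ w, s_ w)).
  apply: (negent_diff p_ge0 (c := fun w => V (t_ w (s_ w)) (s_ w) (y_ w))) => w.
    rewrite law_ust /law (big_pred1 w) => [|w']; last by rewrite eq_sym eq_sym.
    by case: w => [[[u t] s] y] /=; rewrite mulrC.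
  by rewrite law_sty law_ts mulrC.
have e1 : negent p (fun w => (t_ w, u_ w)) = negent p (fun w => (u_ w, t_ w)).
  by apply: eq_negent => w w'; rewrite !xpair_eqE andbC.
have e2 : negent p (fun w => (y_ w, u_ w)) = negent p (fun w => (u_ w, y_ w)).
  by apply: eq_negent => w w'; rewrite !xpair_eqE andbC.
have e3 : negent p (fun w => (u_ w, (t_ w, y_ w))) =
    negent p (fun w => (t_ w, y_ w, u_ w)).
  by apply: eq_negent => w w'; rewrite !xpair_eqE [in RHS]andbC.
have e4 : negent p (fun w => (s_ w, (t_ w, y_ w))) =
    negent p (fun w => (s_ w, t_ w, y_ w)).
  by apply: eq_negent => w w'; rewrite !xpair_eqE andbA.
have e5 : negent p (fun w => (u_ w, s_ w, (t_ w, y_ w))) = negent p id.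
  apply: eq_negent => -[[[u t] s] y] [[[u' t'] s'] y'].
  rewrite !xpair_eqE/=; do 4 case: (_ == _); by [].
move: S1 S2 D1 D2; rewrite e1 e2 e3 e4 e5; lra.
Qed.

Lemma strategy_law_ge0 t s : 0 <= strategy_law t s.
Proof. by apply: sumr_ge0 => u _; rewrite mulr_ge0 ?kap_ge0// sumr_ge0. Qed.

Lemma sum_strategy_law s : \sum_t strategy_law t s = \sum_u \sum_x mu u s x.
Proof.
rewrite exchange_big/=; apply: eq_bigr => u _.
by rewrite -mulr_sumr kap1 mulr1.
Qed.

End Reduction.

End Objective.

(** * Compactness of the set of conditional distributions *)

Section Attainment.
Context (R : realType).
Local Open Scope classical_set_scope.

(** From ln y <= y - 1 at y = 1 / sqrt x. The right-hand side tends to 0 with x, which yields the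
    continuity of x ln x at 0. *)
Lemma xlnx_le_sqrt (x : R) : 0 <= x <= 1 -> `|xlnx x| <= 2 * Num.sqrt x.
Proof.
move=> /andP[]; rewrite le_eqVlt => /predU1P[<-|x0 x1].
  by rewrite /xlnx mul0r normr0 sqrtr0 mulr0.
have s0 : 0 < Num.sqrt x by rewrite sqrtr_gt0.
have xE : x = Num.sqrt x ^+ 2 by rewrite sqr_sqrtr// ltW.
have lx : ln x <= 0 by rewrite ln_le0.
rewrite /xlnx normrM (gtr0_norm x0) (ler0_norm lx).
have H : ln (Num.sqrt x)^-1 <= (Num.sqrt x)^-1.
  by apply: le_trans (ln_le_subr1 _) _; rewrite ?invr_gt0//; lra.
have lnE : ln x = 2 * ln (Num.sqrt x) by rewrite {1}xE lnXn// mulr_natl.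
rewrite lnV ?posrE// in H.
rewrite lnE; set s := Num.sqrt x in s0 xE H *.
have := ler_wpM2l (ltW (mulr_gt0 s0 s0)) H.
rewrite -[leRHS]mulrA divff ?gt_eqF// mulr1 xE expr2; lra.
Qed.

Lemma continuous_xlnx : continuous (@xlnx R).
Proof.
move=> x; have [x0|x0|->] := ltgtP x 0.
- apply: cvg_near_cst; near=> y.
  have y0 : y < 0 by near: y; exact: lt_nbhsl.
  by rewrite /xlnx !ln0 ?mulr0// ltW.
- apply: continuousM; first exact: cvg_id.
  exact: continuous_ln.
- rewrite /continuous_at {2}/xlnx mul0r; apply/cvgr0Pnorm_lt => e e0.
  have : Num.sqrt `|y| @[y --> (0:R)] --> Num.sqrt `|0 : R|.
    apply: (@continuous_comp _ _ _ (@Num.norm R R) (@Num.sqrt R)).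
      exact: norm_continuous.
    exact: sqrt_continuous.
  rewrite normr0 sqrtr0 => /cvgr0Pnorm_lt /(_ _ (divr_gt0 e0 (ltr0Sn _ 1))).
  move=> H; near=> y.
  have [y0|y0] := leP y 0; first by rewrite /xlnx ln0// mulr0 normr0.
  have y1 : y < 1 by near: y; exact: lt_nbhsl.
  apply: le_lt_trans (xlnx_le_sqrt _) _; first by rewrite !ltW.
  have : `|Num.sqrt `|y| | < e / 2 by near: y.
  rewrite (gtr0_norm y0) ger0_norm ?sqrtr_ge0//; lra.
Unshelve. all: by end_near. Qed.

Lemma continuous_sum_fin (T : topologicalType) (I : finType) (F : I -> T -> R) :
  (forall i, continuous (F i)) -> continuous (fun t => \sum_i F i t).
Proof.
move=> cF; apply: (@continuous_big _ _ _ _ _ (@add_continuous R)) => i _.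
exact: cF.
Qed.

(* If [m] is the pointwise minimum of continuous functions, it is upper
   semicontinuous, so it attains its maximum on a compact set. *)
Lemma compact_max_inf (T : topologicalType) (Q : Type) (D : set Q) (K : set T)
  (f : Q -> T -> R)
    (m : T -> R) : K !=set0 -> compact K -> (forall q, continuous (f q)) ->
  (forall q t, K t -> D q -> m t <= f q t) ->
  (forall t, K t -> exists2 q, D q & f q t = m t) ->
  exists2 c, K c & forall t, K t -> m t <= m c.
Proof.
move=> K0 cK cf mf fm.
have [t0 Kt0] := K0; have [q0 Dq0 _] := fm _ Kt0.
have [b _ Hb] : exists2 c, c \in K & forall t, t \in K -> f q0 t <= f q0 c.
  by apply: compact_EVT_max => //; exact: continuous_subspaceT.
have hs : has_sup [set m t | t in K].
  split; first by exists (m t0), t0.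
  exists (f q0 b) => _ [t Kt <-].
  by rewrite (le_trans (mf q0 _ Kt Dq0))// Hb//; exact/mem_set.
pose s := sup [set m t | t in K].
(* A maximizing sequence for [m]; the maximizer will be a cluster point of it. *)
have /choice[t Ht] (n : nat) : exists t, K t /\ s - n.+1%:R^-1 < m t.
  have n0 : 0 < n.+1%:R^-1 :> R by rewrite invr_gt0.
  have [_ [t Kt <-] H] := sup_adherent n0 hs.
  by exists t.
have [c [Kc clc]] : K `&` cluster (t @ \oo) !=set0.
  by apply: cK; exists 0%N => // n _; exact: (Ht n).1.
exists c => // t' Kt'.
have tls : m t' <= s by apply: sup_upper_bound => //=; exists t'.
apply: (le_trans tls); rewrite leNgt; apply/negP => mcs.
(* The function [f q] attaining the minimum at [c] dominates [m], so by its continuity [m] stays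
   below m c + e near [c], while the sequence comes back near [c] with values approaching [s]. *)
have [q Dq fq] := fm _ Kc.
pose e := (s - m c) / 2; have e0 : 0 < e by rewrite /e; lra.
have /cvgrPdist_lt/(_ _ e0) Hc : f q x @[x --> c] --> f q c by exact: cf.
have [N HN] : exists N : nat, forall n, (N <= n)%N -> n.+1%:R^-1 < e.
  have /cvgrPdist_lt/(_ _ e0) [N _ HN] := @cvg_harmonic R.
  exists N => n /HN /=; rewrite /harmonic/= sub0r normrN ger0_norm//.
have FA : (t @ \oo) (t @` [set n | (N <= n)%N]) by exists N => // n Nn;
  exists n.
have [x [[n /= Nn <-]]] := clc _ _ FA Hc.
rewrite /= fq => H.
have := HN _ Nn; have [Kn Hn] := Ht n; have := mf _ _ Kn Dq.
have eE : e = (s - m c) / 2 by [].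
move: H Hn; rewrite ltr_norml => /andP[]; move: (_^-1) (m (t n)) => d mt.
by move: e eE {Hc e0 HN} => e; lra.
Unshelve. all: by end_near. Qed.

Section Kernels.
Context (B A : finType).

(** Kernels are coded as row vectors indexed by pairs, so that conditional distributions form a
    closed subset of the unit cube. *)
Definition kernel_of (M : 'rV[R]_#|{: B * A}|) (b : B) (a : A) : R :=
  M ord0 (enum_rank (b, a)).

Lemma kernel_of_surj (k : B -> A -> R) : exists M, kernel_of M = k.
Proof.
exists (\row_i k (enum_val i).1 (enum_val i).2).
by apply/funext => b; apply/funext => a; rewrite /kernel_of mxE enum_rankK.
Qed.

Lemma continuous_kernel_of b a : continuous (fun M => kernel_of M b a).
Proof. exact: coord_continuous. Qed.

Lemma compact_cond_dist : compact [set M | is_cond_dist (kernel_of M)].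
Proof.
have : compact [set v : 'rV[R]_#|{: B * A}| | forall i, `[0,
  1]%classic (v ord0 i)].
  exact (@rV_compact R _ (fun=> `[0,
    1]%classic) (fun=> @segment_compact R 0 1)).
move=> cK; apply: (subclosed_compact _ cK).
  have -> : [set M | is_cond_dist (kernel_of M)] =
      (\bigcap_b (\bigcap_a [set M | 0 <= kernel_of M b a])) `&`
      (\bigcap_b [set M | \sum_a kernel_of M b a = 1]).
    apply/seteqP; split=> [M HM|M [H1 H2] b].
      by split=> [b _ a _|b _]; have [H1 H2] := HM b; [exact: H1|exact: H2].
    by split=> [a|]; [exact: H1|exact: H2].
  apply: closedI; apply: closed_bigI => b _.
    apply: closed_bigI => a _.
    apply: (preimage_closed (f := fun M => kernel_of M b a) (D :=
      [set x | 0 <= x])) => //.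
      by move=> M _; exact: continuous_kernel_of.
  apply: (preimage_closed (f := fun M => \sum_a kernel_of M b a) (D :=
    [set x | x = 1])) => //.
    by move=> M _; apply: continuous_sum_fin => a; exact: continuous_kernel_of.
move=> M HM i /=; have := HM (enum_val i).1.
move=> -[M0 M1]; have := M0 (enum_val i).2; rewrite /kernel_of in M0 M1 *.
rewrite -surjective_pairing enum_valK => Mi0.
rewrite in_itv/= Mi0/= -M1 (bigD1 (enum_val i).2)//=.
by rewrite -surjective_pairing enum_valK lerDl sumr_ge0.
Qed.

Definition kernel_continuous (F : (B -> A -> R) -> R) :=
  continuous (fun M => F (kernel_of M)).

Lemma kernel_min (F : (B -> A -> R) -> R) :
  kernel_continuous F -> (exists k : B -> A -> R, is_cond_dist k) ->
  exists2 k, is_cond_dist k & forall k', is_cond_dist k' -> F k <= F k'.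
Proof.
move=> cF [k0 k0d].
have K0 : [set M | is_cond_dist (kernel_of M)] !=set0.
  by have [M ME] := kernel_of_surj k0; exists M; rewrite /= ME.
have [M] := compact_EVT_min K0 compact_cond_dist (continuous_subspaceT cF).
rewrite inE => Md Mmin; exists (kernel_of M) => // k'.
by have [M' <-] := kernel_of_surj k' => M'd; apply: Mmin; rewrite inE.
Qed.

Lemma kernel_max_inf (Q : Type) (D : set Q) (F : Q -> (B -> A -> R) -> R)
    (m : (B -> A -> R) -> R) :
  (exists k : B -> A -> R, is_cond_dist k) ->
  (forall q, kernel_continuous (F q)) ->
  (forall q k, is_cond_dist k -> D q -> m k <= F q k) ->
  (forall k, is_cond_dist k -> exists2 q, D q & F q k = m k) ->
  exists2 k, is_cond_dist k & forall k', is_cond_dist k' -> m k' <= m k.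
Proof.
move=> [k0 k0d] cF mF Fm.
have K0 : [set M | is_cond_dist (kernel_of M)] !=set0.
  by have [M ME] := kernel_of_surj k0; exists M; rewrite /= ME.
have [M Md Mmax] := @compact_max_inf _ Q D _ _ (fun M => m (kernel_of M)) K0
  compact_cond_dist cF (fun q M => mF q _) (fun M => Fm _).
exists (kernel_of M) => // k'.
by have [M' <-] := kernel_of_surj k' => M'd; exact: Mmax.
Qed.


End Kernels.
End Attainment.

(** * The single-letter problem *)

Section SingleLetterCapacity.
Context (R : realType) (X Y S J : finType).
Variables (PS : S -> R) (W : X -> S -> J -> Y -> R).
Hypotheses (hX : (0 < #|X|)%N) (hJ : (0 < #|J|)%N).
Hypotheses (hPS : is_dist PS) (hPS_pos : forall s, 0 < PS s).
Hypothesis hW : forall x s j, is_dist (W x s j).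

Definition chan (Q : S -> J -> R) (x : X) (s : S) (y : Y) : R :=
  \sum_j Q s j * W x s j y.

Lemma chan_dist Q x s : is_cond_dist Q -> is_dist (chan Q x s).
Proof.
move=> hQ; have [Q0 Q1] := hQ s; split=> [y|].
  by apply: sumr_ge0 => j _; rewrite mulr_ge0//; case: (hW x s j).
rewrite exchange_big/= -[RHS]Q1; apply: eq_bigr => j _.
by rewrite -mulr_sumr; case: (hW x s j) => _ ->; rewrite mulr1.
Qed.

Definition gp_mu (U : finType) (PU : S -> U -> R) (f : U -> S -> X)
  (u : U) (s : S) (x : X) : R := PS s * PU s u * (x == f u s)%:R.

Lemma sum_eq_indic (x1 : X) (F : X -> R) : \sum_x (x == x1)%:R * F x = F x1.
Proof.
rewrite (bigD1 x1)//= eqxx mul1r big1 ?addr0// => x /negbTE ->.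
by rewrite mul0r.
Qed.

Lemma sum_gp_mu (U : finType) PU f (u : U) s : \sum_x gp_mu PU f u s x = PS s *
  PU s u.
Proof.
rewrite /gp_mu -mulr_sumr -[RHS]mulr1; congr (_ * _).
by under eq_bigr do rewrite -[_%:R]mulr1; rewrite sum_eq_indic.
Qed.

Lemma gp_mu_ge0 (U : finType) PU f (u : U) s x : is_cond_dist PU ->
  0 <= gp_mu PU f u s x.
Proof.
by move=> hPU; rewrite /gp_mu !mulr_ge0// ?ler0n// ?(ltW (hPS_pos s))//;
  case: (hPU s).
Qed.

Lemma gp_mu_marg (U : finType) PU (f : U -> S -> X) s : is_cond_dist PU ->
  \sum_u \sum_x gp_mu PU f u s x = PS s.
Proof.
move=> hPU; under eq_bigr do rewrite sum_gp_mu.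
by rewrite -mulr_sumr; case: (hPU s) => _ ->; rewrite mulr1.
Qed.

Lemma gp_gainE (U : finType) (PU : S -> U -> R) f Q : is_cond_dist PU ->
  is_cond_dist Q ->
  ln 2 * gp_gain PS W PU f Q = gp_obj (gp_mu PU f) (chan Q).
Proof.
move=> hPU hQ.
have UYE u y : gp_law_UY PS W PU f Q u y =
    \sum_s \sum_x gp_mu PU f u s x * chan Q x s y.
  apply: eq_bigr => s _; rewrite exchange_big/=; apply: eq_bigr => x _.
  rewrite mulr_sumr; apply: eq_bigr => j _.
  by rewrite /gp_law /gp_mu; ring.
have USE u s : gp_law_US PS W PU f Q u s = \sum_x gp_mu PU f u s x.
  rewrite /gp_law_US exchange_big/=; apply: eq_bigr => x _.
  transitivity (\sum_y gp_mu PU f u s x * chan Q x s y).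
    rewrite exchange_big/=; apply: eq_bigr => y _.
    rewrite mulr_sumr; apply: eq_bigr => j _.
    by rewrite /gp_law /gp_mu; ring.
  by rewrite -mulr_sumr; case: (chan_dist x s hQ) => _ ->; rewrite mulr1.
have UY0 u y : 0 <= gp_law_UY PS W PU f Q u y.
  rewrite UYE; apply: sumr_ge0 => s _; apply: sumr_ge0 => x _.
  by rewrite mulr_ge0 ?gp_mu_ge0//; case: (chan_dist x s hQ).
have US0 u s : 0 <= gp_law_US PS W PU f Q u s.
  by rewrite USE; apply: sumr_ge0 => x _; rewrite gp_mu_ge0.
have UE u : \sum_y gp_law_UY PS W PU f Q u y = \sum_s gp_law_US PS W PU f Q u s.
  under eq_bigr do rewrite UYE.
  rewrite exchange_big/=; apply: eq_bigr => s _; rewrite exchange_big USE/=.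
  apply: eq_bigr => x _.
  by rewrite -mulr_sumr; case: (chan_dist x s hQ) => _ ->; rewrite mulr1.
rewrite /gp_gain mulrBr !mutual_infoE// /gp_obj.
under [X in _ - X - _ - _]eq_bigr do rewrite UE.
have -> : gp_law_UY PS W PU f Q = fun u y =>
    \sum_s \sum_x gp_mu PU f u s x * chan Q x s y.
  by apply/funext => u; apply/funext => y.
have -> : gp_law_US PS W PU f Q = fun u s => \sum_x gp_mu PU f u s x.
  by apply/funext => u; apply/funext => s.
by ring.
Qed.

(** The kernel [P] is the conditional law of the strategy given the state; it is built from [mu]
    alone, so one choice beats [mu] against every jamming. Here [mu] may come from any finite
    alphabet and a stochastic choice of X, as happens in the converse. *)
Lemma strategy_reduction (U : finType) (mu : U -> S -> X -> R) :
  (forall u s x, 0 <= mu u s x) ->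
  (forall s, \sum_u \sum_x mu u s x = PS s) ->
  exists2 P : S -> {ffun S -> X} -> R, is_cond_dist P &
  forall Q, is_cond_dist Q -> gp_obj mu (chan Q) <=
    ln 2 * gp_gain PS W P (fun t s => t s) Q.
Proof.
move=> mu0 muS; have /card_gt0P[x0 _] := hX.
have P_dist : is_cond_dist (fun s t => strategy_law mu x0 t s / PS s).
  move=> s; split=> [t|]; first by rewrite divr_ge0 ?strategy_law_ge0// ltW.
  by rewrite -mulr_suml sum_strategy_law// muS divff// gt_eqF.
exists (fun s t => strategy_law mu x0 t s / PS s) => // Q hQ.
rewrite gp_gainE//.
have V_dist x s : is_dist (chan Q x s) by exact: chan_dist.
apply: (le_trans (gp_obj_strategy x0 mu0 V_dist)).
rewrite le_eqVlt; apply/orP; left; apply/eqP; congr (gp_obj _ _).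
apply/funext => t; apply/funext => s; apply/funext => x.
by rewrite /gp_mu [PS s * _]mulrC divfK// gt_eqF.
Qed.

Lemma continuous_gp_obj (T : topologicalType) (U : finType)
    (mu : T -> U -> S -> X -> R) (V : T -> X -> S -> Y -> R) :
  (forall u s x, continuous (fun t => mu t u s x)) ->
  (forall x s y, continuous (fun t => V t x s y)) ->
  continuous (fun t => gp_obj (mu t) (V t)).
Proof.
move=> cmu cV.
have cx (f : T -> R) : continuous f -> continuous (fun t => xlnx (f t)).
  move=> cf t; apply: (@continuous_comp _ _ _ f (@xlnx R)); first exact: cf.
  exact: continuous_xlnx.
have cM (f g : T -> R) : continuous f -> continuous g ->
    continuous (fun t => f t * g t).
  by move=> cf cg t; apply: continuousM; [exact: cf|exact: cg].
have cuy u y : continuous (fun t => \sum_s \sum_x mu t u s x * V t x s y).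
  by apply: continuous_sum_fin => s; apply: continuous_sum_fin => x; exact: cM.
have cus u s : continuous (fun t => \sum_x mu t u s x).
  exact: continuous_sum_fin.
have cD (f g : T -> R) : continuous f -> continuous g ->
    continuous (fun t => f t + g t).
  by move=> cf cg t; apply: cvgD; [exact: cf|exact: cg].
have cB (f g : T -> R) : continuous f -> continuous g ->
    continuous (fun t => f t - g t).
  by move=> cf cg t; apply: cvgB; [exact: cf|exact: cg].
apply: cD; first (apply: (cB); first apply: (cB)).
- apply: continuous_sum_fin => u; apply: continuous_sum_fin => y.
  exact/cx/cuy.
- by apply: continuous_sum_fin => y; apply: cx; apply: continuous_sum_fin => u.
- apply: continuous_sum_fin => u; apply: continuous_sum_fin => s.
  exact/cx/cus.
- apply: continuous_sum_fin => s; apply: cx; apply: continuous_sum_fin => u.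
  exact: cus.
Qed.

Lemma continuousMl_fin (T : topologicalType) (f : T -> R) c :
  continuous f -> continuous (fun t => f t * c).
Proof. by move=> cf t; apply: continuousM;
  [exact: cf|exact: cst_continuous]. Qed.

Lemma continuous_chan (U : finType) (mu : U -> S -> X -> R) :
  kernel_continuous (fun Q : S -> J -> R => gp_obj mu (chan Q)).
Proof.
apply: continuous_gp_obj => [u s x M|x s y]; first exact: cst_continuous.
apply: continuous_sum_fin => j; apply: continuousMl_fin.
exact: continuous_kernel_of.
Qed.

Lemma continuous_gp_mu (U : finType) (f : U -> S -> X) (V : X -> S -> Y -> R) :
  kernel_continuous (fun PU : S -> U -> R => gp_obj (gp_mu PU f) V).
Proof.
apply: continuous_gp_obj => [u s x|x s y M]; last exact: cst_continuous.
apply: continuousMl_fin => M; apply: continuousM; first exact: cst_continuous.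
exact: continuous_kernel_of.
Qed.

Lemma exists_cond_dist (B A : finType) : (0 < #|A|)%N ->
  exists k : B -> A -> R, is_cond_dist k.
Proof.
move=> /card_gt0P[a0 _]; exists (fun _ a => (a == a0)%:R) => b; split=> [a|].
  by rewrite ler0n.
rewrite (bigD1 a0)//= eqxx big1 => [|a /negbTE -> //].
by rewrite addr0.
Qed.

Lemma gp_min_exists (U : finType) (PU : S -> U -> R) f : is_cond_dist PU ->
  exists v, is_gp_min PS W PU f v.
Proof.
move=> hPU.
have [Q hQ Qmin] := kernel_min (@continuous_chan _ (gp_mu PU f))
  (exists_cond_dist S hJ).
exists (gp_gain PS W PU f Q); split; first by exists Q.
move=> _ [Q' hQ' <-].
by rewrite -(ler_pM2l (ln2_gt0 R)) !gp_gainE// Qmin.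
Qed.

(** The second item is what achievability consumes, a strategy law guaranteeing [C] against all
    jammings; the third is what the converse consumes, a bad jamming for every input law. The number
    of strategies is exactly the bound on the size of U. *)
Lemma gp_maxmin_exists : exists C : R,
  [/\ is_gp_maxmin PS W C,
    exists2 P : S -> {ffun S -> X} -> R, is_cond_dist P &
      forall Q, is_cond_dist Q -> C <= gp_gain PS W P (fun t s => t s) Q &
    forall (U : finType) (mu : U -> S -> X -> R),
      (forall u s x, 0 <= mu u s x) ->
      (forall s, \sum_u \sum_x mu u s x = PS s) ->
      exists2 Q, is_cond_dist Q & gp_obj mu (chan Q) <= ln 2 * C].
Proof.
pose ev (t : {ffun S -> X}) s := t s.
pose D := [set Q : S -> J -> R | is_cond_dist Q]%classic.
have /choice[m Hm] (P : S -> {ffun S -> X} -> R) :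
    exists v, is_cond_dist P -> is_gp_min PS W P ev v.
  have [hP|nP] := pselect (is_cond_dist P); last by exists 0.
  by have [v Hv] := gp_min_exists ev hP; exists v.
have card_T : (0 < #|{ffun S -> X}|)%N by rewrite card_ffun expn_gt0 hX.
have mle Q P : is_cond_dist P -> D Q ->
    ln 2 * m P <= gp_obj (gp_mu P ev) (chan Q).
  move=> hP hQ; rewrite -gp_gainE// ler_pM2l ?ln2_gt0//.
  by have [_] := Hm P hP; apply; exists Q.
have meq P : is_cond_dist P ->
    exists2 Q, D Q & gp_obj (gp_mu P ev) (chan Q) = ln 2 * m P.
  move=> hP; have [[Q hQ mE] _] := Hm P hP; exists Q => //.
  by rewrite -gp_gainE// mE.
have [P hP Pmax] := kernel_max_inf (exists_cond_dist S card_T)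
  (fun Q => @continuous_gp_mu _ ev (chan Q)) mle meq.
have {}Pmax P' : is_cond_dist P' -> m P' <= m P.
  by move=> /Pmax; rewrite ler_pM2l ?ln2_gt0.
exists (m P); split.
- split; first by move=> U PU f _; exact: gp_min_exists.
  split; first by exists {ffun S -> X}, P, ev; rewrite card_ffun; split=> //;
    exact: Hm.
  move=> v [U [PU [f [_ hPU [_ vmin]]]]].
  have [P' hP' HP'] := strategy_reduction
    (fun u s x => gp_mu_ge0 f u s x hPU) (fun s => gp_mu_marg f s hPU).
  have [Q hQ QE] := meq _ hP'.
  apply: (le_trans _ (Pmax _ hP')).
  rewrite -(ler_pM2l (ln2_gt0 R)) -QE -gp_gainE//.
  apply: (le_trans _ (HP' _ hQ)); rewrite -gp_gainE// ler_pM2l ?ln2_gt0//.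
  by apply: vmin; exists Q.
- exists P => // Q hQ; have [_] := Hm P hP; apply; by exists Q.
- move=> U mu mu0 muS; have [P' hP' HP'] := strategy_reduction mu0 muS.
  have [Q hQ QE] := meq _ hP'; exists Q => //.
  apply: (le_trans (HP' _ hQ)); rewrite gp_gainE// QE.
  by rewrite ler_pM2l ?ln2_gt0// Pmax.
Qed.

End SingleLetterCapacity.

(** * Converse *)

Section VariationalMutualInfo.
Context (R : realType) (O : finType) (p : O -> R).
Hypothesis p_ge0 : forall w, 0 <= p w.
Hypothesis p1 : \sum_w p w = 1.

(* Donsker-Varadhan bound for the test function that is [ln th] on [E] and 0
   elsewhere. *)
Lemma mutual_info_ge_event (A B : finType) (f : O -> A) (g : O -> B)
    (E : A -> B -> bool) (th Z : R) : 0 < th -> 0 < Z ->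
  \sum_a \sum_b law p f a * law p g b * (if E a b then th else 1) <= Z ->
  ln th * (\sum_(w | E (f w) (g w)) p w) - ln Z <=
  negent p (fun w => (f w, g w)) - negent p f - negent p g.
Proof.
move=> th0 Z0 HZ; pose fg := fun w => (f w, g w).
pose e (x : A * B) := if E x.1 x.2 then th else 1.
have e0 x : 0 < e x by rewrite /e; case: ifP.
(* Gibbs' inequality is applied against the product of the marginals tilted by the test function;
   [HZ] says that division by [Z] leaves mass at most 1. *)
pose q (x : A * B) := law p f x.1 * law p g x.2 * e x / Z.
have q0 x : 0 <= q x.
  by rewrite /q !mulr_ge0 ?law_ge0// ?invr_ge0 ?ltW.
have sumq : \sum_x q x <= 1.
  rewrite /q -mulr_suml ler_pdivrMr// mul1r (le_trans _ HZ)//.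
  by rewrite pair_bigA.
have lnth : ln th * (\sum_(w | E (f w) (g w)) p w) =
    \sum_x law p fg x * ln (e x).
  rewrite -(sum_law_mul p fg (fun x => ln (e x))) mulr_sumr big_mkcond/=.
  apply: eq_bigr => w _; rewrite /e /fg/=; case: ifP => _;
    first by rewrite mulrC.
  by rewrite ln1 mulr0.
have lnZ : ln Z = \sum_x law p fg x * ln Z.
  by rewrite -mulr_suml sum_law p1 mul1r.
have hf : negent p f = \sum_x law p fg x * ln (law p f x.1).
  by rewrite -(sum_law_mul p fg (fun x => ln (law p f x.1))).
have hg : negent p g = \sum_x law p fg x * ln (law p g x.2).
  by rewrite -(sum_law_mul p fg (fun x => ln (law p g x.2))).
rewrite lnth lnZ hf hg negent_sum -subr_ge0 -!sumrB.
apply: (@le_trans _ _ (\sum_x (law p fg x - q x))).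
  by rewrite sumrB sum_law p1 subr_ge0.
apply: ler_sum => x _.
have [->|nz] := eqVneq (law p fg x) 0.
  by rewrite !mul0r !subr0 sub0r oppr_le0.
have fg0 : 0 < law p fg x by rewrite lt_neqAle law_ge0// eq_sym nz.
have l1 : 0 < law p f x.1.
  apply: (lt_le_trans fg0); apply: law_mono => // w.
  by case: x {nz fg0} => a b; rewrite xpair_eqE => /andP[].
have l2 : 0 < law p g x.2.
  apply: (lt_le_trans fg0); apply: law_mono => // w.
  by case: x {nz fg0 l1} => a b; rewrite xpair_eqE => /andP[].
have qpos : 0 < q x by rewrite /q !mulr_gt0// invr_gt0.
apply: le_trans (gibbs (ltW fg0) (q0 x) _) _.
  by move=> qx; move: qpos; rewrite qx ltxx.
rewrite /q ln_div ?posrE ?mulr_gt0// !lnM ?posrE ?mulr_gt0//; lra.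
Qed.

End VariationalMutualInfo.

(** * Product laws with hidden coordinates *)

Section MaskedProducts.
Context (R : realType) (n : nat) (A : finType).

(** Hiding coordinates behind [None] gives past and future blocks of all lengths one common type,
    and equality of masks means agreement on [D]. *)
Definition mask (D : pred 'I_n) (y : vec n A) : vec n (option A) :=
  [ffun i => if D i then Some (y i) else None].

Lemma sum_prod_mask (D : pred 'I_n) (k : 'I_n -> A -> R) z :
  (forall i, \sum_a k i a = 1) ->
  \sum_(y : vec n A | mask D y == z) \prod_i k i (y i) =
  \prod_i (if D i then \sum_(a | Some a == z i) k i a else (z i == None)%:R).
Proof.
move=> k1.
pose P i : pred A := fun a => (if D i then Some a else None) == z i.
transitivity (\prod_i \sum_(a | P i a) k i a).
  rewrite bigA_distr_big_dep; apply: eq_bigl => y.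
  apply/eqP/familyP => [H i|H].
    by rewrite unfold_in /P -H ffunE.
  by apply/ffunP => i; rewrite ffunE; apply/eqP; exact: H.
apply: eq_bigr => i _; rewrite /P; case: (D i) => //.
rewrite eq_sym; case: eqP => _; [exact: k1|by rewrite big_pred0].
Qed.

(** A hidden coordinate is independent of the visible ones, so it contributes its own factor. *)
Lemma sum_prod_mask_at (D : pred 'I_n) (k : 'I_n -> A -> R) z (i : 'I_n) b :
  (forall i, \sum_a k i a = 1) -> ~~ D i ->
  \sum_(y : vec n A | (mask D y == z) && (y i == b)) \prod_i k i (y i) =
  (\sum_(y : vec n A | mask D y == z) \prod_i k i (y i)) * k i b.
Proof.
move=> k1 Di; rewrite (sum_prod_mask D z k1).
pose P j : pred A := fun a =>
  ((if D j then Some a else None) == z j) && ((j == i) ==> (a == b)).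
transitivity (\prod_j \sum_(a | P j a) k j a).
  rewrite bigA_distr_big_dep; apply: eq_bigl => y.
  apply/andP/familyP => [[/eqP Hz /eqP Hb] j|H].
    rewrite unfold_in /P -Hz -Hb ffunE eqxx /=; apply/implyP => /eqP -> //.
  split; last by have := H i; rewrite unfold_in /P eqxx => /andP[].
  by apply/eqP/ffunP => j; rewrite ffunE; apply/eqP; case/andP: (H j).
rewrite (bigD1 i)//= [in RHS](bigD1 i)//= (negbTE Di) mulrAC.
congr (_ * _).
  rewrite /P (negbTE Di) eqxx/= eq_sym; case: eqP => _ /=.
    by rewrite big_pred1_eq mul1r.
  by rewrite big_pred0 ?mul0r.
apply: eq_bigr => j ji; rewrite /P (negbTE ji)/=.
case: (D j); first by apply: eq_bigl => a; rewrite andbT.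
rewrite eq_sym; case: eqP => _; last by rewrite big_pred0.
by rewrite /= k1.
Qed.

Lemma sum_prod_mask_self (D : pred 'I_n) (k : 'I_n -> A -> R) y0 :
  (forall i, \sum_a k i a = 1) ->
  \sum_(y : vec n A | mask D y == mask D y0) \prod_i k i (y i) =
  \prod_(i | D i) k i (y0 i).
Proof.
move=> k1; rewrite sum_prod_mask// [RHS]big_mkcond; apply: eq_bigr => i _.
rewrite ffunE; case: (D i) => //; by rewrite (big_pred1 (y0 i)).
Qed.

End MaskedProducts.

Section Converse.
Context (R : realType) (X Y S J : finType).
Variables (PS : S -> R) (W : X -> S -> J -> Y -> R).
Hypotheses (hPS : is_dist PS) (hW : forall x s j, is_dist (W x s j)).
Context (n : nat) (K : finType) (r : K -> R) (enc : K -> vec n S -> vec n X).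
Hypothesis r_dist : is_dist r.

Local Notation O := (K * vec n S * vec n Y)%type.

(** The joint law of (K, S^n, Y^n) under memoryless jamming with its own kernel at each stage; K
    will be the pair of code and message. The inputs are functions of K and the states and are left
    out. *)
Definition block_law (Q : 'I_n -> S -> J -> R) (w : O) : R :=
  r w.1.1 * (\prod_i PS (w.1.2 i)) *
  \prod_i chan W (Q i) (enc w.1.1 w.1.2 i) (w.1.2 i) (w.2 i).

Let y_past (k : nat) (w : O) := mask (fun i : 'I_n => (i < k)%N) w.2.
Let s_future (k : nat) (w : O) := mask (fun i : 'I_n => (k <= i)%N) w.1.2.
Let msg (w : O) := w.1.1.

(* The auxiliary variable U_k of the converse. *)
Definition aux (k : nat) (w : O) :=
  (w.1.1, mask (fun i : 'I_n => (i < k)%N) w.2,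
   mask (fun i : 'I_n => (k < i)%N) w.1.2).

Let s_at (k : 'I_n) (w : O) : S := w.1.2 k.
Let y_at (k : 'I_n) (w : O) : Y := w.2 k.
Let x_at (k : 'I_n) (w : O) : X := enc w.1.1 w.1.2 k.

Definition aux_mu (Q : 'I_n -> S -> J -> R) (k : 'I_n) u s x : R :=
  law (block_law Q) (fun w => (aux k w, w.1.2 k, enc w.1.1 w.1.2 k)) (u, s, x).

Lemma sum_triple (P : pred O) (F : O -> R) :
  \sum_(w | P w) F w = \sum_v \sum_s \sum_(y | P (v, s, y)) F (v, s, y).
Proof.
rewrite big_mkcond.
under [RHS]eq_bigr do under eq_bigr do rewrite big_mkcond.
rewrite pair_bigA pair_bigA/=; apply: eq_bigr => -[[v s] y] _ //.
Qed.

Section FixedJamming.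
Variable Q : 'I_n -> S -> J -> R.
Hypothesis hQ : forall i, is_cond_dist (Q i).
Let p := block_law Q.
Let V (i : 'I_n) := chan W (Q i).

Let V_dist i x s : is_dist (V i x s). Proof. exact: chan_dist. Qed.

Let sumV (v : K) (s : vec n S) i : \sum_b V i (enc v s i) (s i) b = 1.
Proof. by case: (V_dist i (enc v s i) (s i)). Qed.

Let sumPS (i : 'I_n) : \sum_a PS a = 1. Proof. by case: hPS. Qed.

Lemma block_law_ge0 w : 0 <= p w.
Proof.
rewrite /p /block_law !mulr_ge0//; first by case: r_dist.
- by apply: prodr_ge0 => i _; case: hPS.
- apply: prodr_ge0 => i _.
  by have [H _] := V_dist i (enc w.1.1 w.1.2 i) (w.1.2 i); exact: H.
Qed.

Let sum_s_only (P : K -> pred (vec n S)) :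
  \sum_(w : O | P w.1.1 w.1.2) p w =
  \sum_v r v * \sum_(s | P v s) \prod_i PS (s i).
Proof.
rewrite sum_triple; apply: eq_bigr => v _.
rewrite mulr_sumr [RHS]big_mkcond; apply: eq_bigr => s _ /=.
case: (P v s); last by rewrite big_pred0.
by rewrite /p /block_law/= -mulr_sumr (sum_prod_dist (sumV v s)) mulr1.
Qed.

Lemma sum_block_law : \sum_w p w = 1.
Proof.
rewrite (sum_s_only (fun _ => xpredT)).
under eq_bigr do rewrite (sum_prod_dist sumPS) mulr1.
by case: r_dist.
Qed.

Lemma law_msg v : law p msg v = r v.
Proof.
rewrite /law (sum_s_only (fun v' _ => v' == v)) (bigD1 v)//=.
rewrite [X in _ + X]big1 ?addr0 => [|v' /negbTE vv].
  under eq_bigl do rewrite eqxx.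
  by rewrite (sum_prod_dist sumPS) mulr1.
by rewrite big_pred0 ?mulr0// => s; rewrite vv.
Qed.

Lemma law_s_at k a : law p (s_at k) a = PS a.
Proof.
rewrite /law (sum_s_only (fun _ s => s k == a)) -mulr_suml.
case: r_dist => _ ->; rewrite mul1r.
have := sum_prod_dist_at (k := fun _ => PS) k (fun b => (b == a)%:R) sumPS.
under [RHS]eq_bigr do rewrite mulrC.
rewrite sum_eq_indic => <-; rewrite big_mkcond; apply: eq_bigr => s _.
by case: eqP; rewrite ?mulr1 ?mulr0.
Qed.

Let law_msg_future k w : law p (fun w => (msg w, s_future k w))
    (msg w, s_future k w) = r (msg w) * \prod_(i < n | (k <= i)%N) PS (w.1.2 i).
Proof.
rewrite /law (sum_s_only (fun v s => (v, mask (fun i : 'I_n => (k <= i)%N) s)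
  == (msg w, s_future k w))).
rewrite (bigD1 (msg w))//= [X in _ + X]big1 ?addr0 => [|v /negbTE vw].
  congr (_ * _); under eq_bigl do rewrite xpair_eqE eqxx /=.
  exact: (sum_prod_mask_self (fun i : 'I_n => (k <= i)%N) w.1.2 sumPS).
by rewrite big_pred0 ?mulr0// => s; rewrite xpair_eqE vw.
Qed.

(** Given code, message and states the outputs are independent, and U_k contains no output from
    stage k on; hence Y_k depends on U_k only through (X_k,S_k) and the channel of that stage. *)
Let markov (k : 'I_n) (u : K * vec n (option Y) * vec n (option S)) b :
  law p (fun w => (aux k w, y_at k w)) (u, b) =
  \sum_(w | aux k w == u) p w * V k (x_at k w) (s_at k w) b.
Proof.
rewrite /law !sum_triple; apply: eq_bigr => v _; apply: eq_bigr => s _.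
case: u => [[v' z] sg]; rewrite /aux /y_at/=.
under eq_bigl do rewrite !xpair_eqE.
under [RHS]eq_bigl do rewrite !xpair_eqE.
case: (v == v'); last by rewrite !big_pred0.
case: (_ == sg); last by rewrite !big_pred0// => y; rewrite !andbF.
under eq_bigl do rewrite andbT/=.
under [RHS]eq_bigl do rewrite andbT/=.
rewrite /x_at /s_at /p /block_law/=.
rewrite -mulr_suml -!mulr_sumr -[RHS]mulrA; congr (_ * _).
have Dk : ~~ (fun i : 'I_n => (i < k)%N) k by rewrite ltnn.
exact: (@sum_prod_mask_at R n Y (fun i : 'I_n => (i < k)%N)
  (fun i b => V i (enc v s i) (s i) b) z k b (sumV v s) Dk).
Qed.

Lemma aux_mu_ge0 k u s x : 0 <= aux_mu Q k u s x.
Proof. exact/law_ge0/block_law_ge0. Qed.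

Lemma aux_mu_marg k s : \sum_u \sum_x aux_mu Q k u s x = PS s.
Proof.
rewrite -(law_s_at k) (law_pairl _ _ (aux k)); apply: eq_bigr => u _.
rewrite (law_pairl _ _ (x_at k)); apply: eq_bigr => x _.
by apply: eq_bigl => w; rewrite !xpair_eqE [(s_at k w == s) && _]andbC.
Qed.

Lemma law_aux_y (k : 'I_n) u b :
  law p (fun w => (aux k w, y_at k w)) (u, b) =
  \sum_s \sum_x aux_mu Q k u s x * V k x s b.
Proof.
rewrite markov (partition_big (s_at k) predT)//=; apply: eq_bigr => s _.
rewrite (partition_big (x_at k) predT)//=; apply: eq_bigr => x _.
rewrite /aux_mu /law mulr_suml; apply: eq_big => [w|w].
  by rewrite !xpair_eqE.
by move=> /andP[/andP[_ /eqP <-] /eqP <-].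
Qed.

Lemma gp_obj_aux (k : 'I_n) : gp_obj (aux_mu Q k) (V k) =
  negent p (fun w => (aux k w, y_at k w)) - negent p (y_at k)
  - negent p (fun w => (aux k w, s_at k w)) + negent p (s_at k).
Proof.
have Ey b : \sum_u \sum_s \sum_x aux_mu Q k u s x * V k x s b = law p (y_at k)
  b.
  rewrite (law_pairl _ _ (aux k)); apply: eq_bigr => u _.
  by rewrite -law_aux_y; apply: eq_bigl => w; rewrite !xpair_eqE andbC.
have Es s : \sum_u \sum_x aux_mu Q k u s x = law p (s_at k) s.
  by rewrite aux_mu_marg law_s_at.
have Eus u s : \sum_x aux_mu Q k u s x = law p (fun w => (aux k w,
  s_at k w)) (u, s).
  rewrite (law_pairl _ _ (x_at k)); apply: eq_bigr => x _.
  by apply: eq_bigl => w.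
rewrite /gp_obj !negent_sum.
under eq_bigr do under eq_bigr do rewrite -law_aux_y.
under [X in _ - X - _ + _]eq_bigr do rewrite Ey.
under [X in _ - X + _]eq_bigr do under eq_bigr do rewrite Eus.
under [X in _ + X]eq_bigr do rewrite Es.
by rewrite !pair_bigA/=; congr (_ - _ - _ + _); apply: eq_bigr => -[].
Qed.

Let D k := negent p (fun w => (y_past k w, (msg w, s_future k w)))
  - negent p (y_past k) - negent p (fun w => (msg w, s_future k w)).

Let mask_lt_eq (A : finType) (k : 'I_n) (y y' : vec n A) :
  (mask (fun i : 'I_n => (i < k.+1)%N) y == mask (fun i : 'I_n => (i < k.+1)%N)
    y')
  = (mask (fun i : 'I_n => (i < k)%N) y == mask (fun i : 'I_n => (i < k)%N) y')
    && (y k == y' k).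
Proof.
apply/eqP/andP => [/ffunP H|[/eqP/ffunP H /eqP Hk]].
  split; last by have := H k; rewrite !ffunE ltnS leqnn => -[->].
  apply/eqP/ffunP => i; rewrite !ffunE; case: ltnP => // ik.
  by have := H i; rewrite !ffunE ltnS (ltnW ik).
apply/ffunP => i; rewrite !ffunE ltnS leq_eqVlt.
case: eqP => [/val_inj ->|_] /=; first by rewrite Hk.
by have := H i; rewrite !ffunE.
Qed.

Let mask_ge_eq (A : finType) (k : 'I_n) (y y' : vec n A) :
  (mask (fun i : 'I_n => (k <= i)%N) y == mask (fun i : 'I_n => (k <= i)%N) y')
  = (mask (fun i : 'I_n => (k < i)%N) y == mask (fun i : 'I_n => (k < i)%N) y')
    && (y k == y' k).
Proof.
apply/eqP/andP => [/ffunP H|[/eqP/ffunP H /eqP Hk]].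
  split; last by have := H k; rewrite !ffunE leqnn => -[->].
  apply/eqP/ffunP => i; rewrite !ffunE; case: ltnP => // ik.
  by have := H i; rewrite !ffunE (ltnW ik).
apply/ffunP => i; rewrite !ffunE leq_eqVlt.
case: eqP => [/val_inj <-|_] /=; first by rewrite Hk.
by have := H i; rewrite !ffunE.
Qed.

(* The chain-rule increment that replaces Csiszar's sum identity. *)
Let D_step (k : 'I_n) : D k.+1 - D k <= gp_obj (aux_mu Q k) (V k).
Proof.
rewrite gp_obj_aux /D.
(* Both joint blocks extend U_k: by Y_k in [D k.+1] and by S_k in [D k]. The difference thus
   contains the two joint terms of the objective. *)
have -> : negent p (fun w => (y_past k.+1 w, (msg w, s_future k.+1 w))) =
    negent p (fun w => (aux k w, y_at k w)).
  apply: eq_negent => w w'; rewrite !xpair_eqE /y_past mask_lt_eq /msg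
    /s_future /y_at.
  by do 4 case: (_ == _).
have -> : negent p (fun w => (y_past k w, (msg w, s_future k w))) =
    negent p (fun w => (aux k w, s_at k w)).
  apply: eq_negent => w w'; rewrite !xpair_eqE /s_future mask_ge_eq /msg
    /y_past /s_at.
  by do 4 case: (_ == _).
have Hy : negent p (y_past k) + negent p (y_at k) <= negent p (y_past k.+1).
  rewrite -(@eq_negent _ _ p _ _ (fun w => (y_past k w,
    y_at k w)) (y_past k.+1)); last first.
    by move=> w w'; rewrite !xpair_eqE /y_past mask_lt_eq.
  exact/negent_subadd/sum_block_law/block_law_ge0.
(* S_k is independent of (code, message, S_(>k)); the constant map turns this into an instance of
   [negent_diff]. *)
have Hs : negent p (fun w => (msg w, s_future k w)) - negent p (s_at k) =
    negent p (fun w => (msg w, s_future k.+1 w)) - negent p (fun=> tt).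
  apply: (negent_diff block_law_ge0
    (c := fun w => r (msg w) * \prod_(i < n | (k < i)%N) PS (w.1.2 i))) => w.
    rewrite law_msg_future law_s_at (bigD1 k)//= -mulrA; congr (_ * _).
    rewrite mulrC; congr (_ * _); apply: eq_bigl => i.
    by rewrite ltn_neqAle andbC eq_sym.
  rewrite law_msg_future /law; under [X in _ = _ * X]eq_bigl do rewrite eqxx.
  by rewrite sum_block_law mulr1.
have Ht : negent p (fun=> tt) = 0.
  rewrite /negent big1// => w _; rewrite /law.
  by under eq_bigl do rewrite eqxx; rewrite sum_block_law ln1 mulr0.
move: Hy Hs; rewrite Ht; lra.
Qed.

Lemma converse_sum :
  negent p (fun w => (w.1.1, w.2)) - negent p (fun w => w.1.1)
    - negent p (fun w => w.2) <=
  \sum_k gp_obj (aux_mu Q k) (V k).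
Proof.
have Dn : D n = negent p (fun w => (w.1.1, w.2)) - negent p (fun w => w.1.1)
    - negent p (fun w => w.2).
  rewrite /D addrAC.
  have yE w w' : (y_past n w == y_past n w') = (w.2 == w'.2).
    apply/eqP/eqP => [/ffunP H|H]; last by rewrite /y_past H.
    apply/ffunP => i.
    by have := H i; rewrite !ffunE ltn_ord => -[].
  have sE w w' : s_future n w == s_future n w'.
    by apply/eqP/ffunP => i; rewrite !ffunE leqNgt ltn_ord.
  congr (_ - _ - _); apply: eq_negent => w w'.
  - by rewrite !xpair_eqE yE sE andbT andbC.
  - by rewrite !xpair_eqE sE andbT.
  - exact: yE.
have D0 : D 0 = 0.
  have yE w w' : y_past 0 w == y_past 0 w'.
    by apply/eqP/ffunP => i; rewrite !ffunE.
  rewrite /D (@eq_negent _ _ p _ _ _ (fun w => (msg w,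
    s_future 0 w))) => [|w w'].
    rewrite addrAC subrr sub0r /negent big1 ?oppr0// => w _.
    rewrite /law; under eq_bigl do rewrite yE.
    by rewrite sum_block_law ln1 mulr0.
  by rewrite !xpair_eqE yE.
rewrite -Dn; have := telescope_sumr D (leq0n n).
rewrite D0 subr0 big_mkord => <-.
by apply: ler_sum => k _; exact: D_step.
Qed.

End FixedJamming.

Lemma eq_aux_mu Q Q' (k : 'I_n) :
  (forall i, is_cond_dist (Q i)) -> (forall i, is_cond_dist (Q' i)) ->
  (forall i : 'I_n, (i < k)%N -> Q i = Q' i) -> aux_mu Q k = aux_mu Q' k.
Proof.
move=> hQ hQ' QQ'; apply/funext => u; apply/funext => a; apply/funext => x.
case: u => -[v' z] sg; rewrite /aux_mu /law !sum_triple.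
apply: eq_bigr => v _; apply: eq_bigr => s _; rewrite /aux/=.
under eq_bigl do rewrite !xpair_eqE.
under [RHS]eq_bigl do rewrite !xpair_eqE.
case: (v == v'); last by rewrite !big_pred0.
case: (_ == sg); last by rewrite !big_pred0// => y; rewrite !andbF.
case: (_ == a); last by rewrite !big_pred0// => y; rewrite !andbF.
case: (_ == x); last by rewrite !big_pred0// => y; rewrite !andbF.
under eq_bigl do rewrite !andbT/=.
under [RHS]eq_bigl do rewrite !andbT/=.
rewrite /block_law/= -!mulr_sumr; congr (_ * _).
have C1 (Q0 : 'I_n -> S -> J -> R) : (forall i, is_cond_dist (Q0 i)) ->
    forall i, \sum_b chan W (Q0 i) (enc v s i) (s i) b = 1.
  by move=> hQ0 i; have [] := chan_dist hW (enc v s i) (s i) (hQ0 i).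
(* Summing out the outputs from stage k on leaves factors of the earlier stages only, where the two
   jammings agree. *)
rewrite (sum_prod_mask _ _ (C1 Q hQ)) (sum_prod_mask _ _ (C1 Q' hQ')).
apply: eq_bigr => i _; case: ltnP => // ik; apply: eq_bigr => b _.
by rewrite QQ'.
Qed.

Lemma bad_jamming (c : R) : (0 < #|J|)%N ->
  (forall (U : finType) (mu : U -> S -> X -> R),
      (forall u s x, 0 <= mu u s x) ->
      (forall s, \sum_u \sum_x mu u s x = PS s) ->
      exists2 Q, is_cond_dist Q & gp_obj mu (chan W Q) <= c) ->
  exists2 Q : 'I_n -> S -> J -> R, (forall i, is_cond_dist (Q i)) &
    forall k, gp_obj (aux_mu Q k) (chan W (Q k)) <= c.
Proof.
move=> hJ Hc.
suff H j : exists2 Q : 'I_n -> S -> J -> R, (forall i, is_cond_dist (Q i)) &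
    forall k : 'I_n, (k < j)%N -> gp_obj (aux_mu Q k) (chan W (Q k)) <= c.
  by have [Q hQ HQ] := H n; exists Q => // k; exact: HQ.
elim: j => [|j [Q hQ IH]].
  by have [Q hQ] := exists_cond_dist R S hJ; exists (fun=> Q).
have [jn|nj] := ltnP j n; last first.
  by exists Q => // k _; apply: IH; exact: leq_trans (ltn_ord k) nj.
pose k0 := Ordinal jn.
have [q hq Hq] := Hc _ (aux_mu Q k0) (aux_mu_ge0 hQ k0) (aux_mu_marg hQ k0).
(* [q] answers the law at stage [j], which ignores [Q] at that stage. The replacement leaves the
   laws of all stages up to [j] unchanged, so the earlier bounds survive. *)
pose Q' i := if i == k0 then q else Q i.
have hQ' i : is_cond_dist (Q' i) by rewrite /Q'; case: ifP.
have QQ' (k : 'I_n) : (k <= j)%N -> aux_mu Q' k = aux_mu Q k.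
  move=> kj; apply: eq_aux_mu => // i ik; rewrite /Q' ifF//.
  by apply/eqP => ie; move: ik; rewrite ie ltnNge kj.
exists Q' => // k; rewrite ltnS => kj; rewrite QQ'//.
rewrite /Q'; case: eqP => [->//|/eqP kk0]; apply: IH.
by rewrite ltn_neqAle kj andbT.
Qed.

End Converse.

(** * Comparison of the four error criteria *)

Section ErrorCriteria.
Context (R : realType) (X Y S J : finType).
Variables (PS : S -> R) (W : X -> S -> J -> Y -> R).
Hypotheses (hPS : is_dist PS) (hW : forall x s j, is_dist (W x s j)).
Hypothesis hJ : (0 < #|J|)%N.
Context (n N : nat) (Theta : det_code X Y S n N -> R).
Hypothesis hT : is_dist Theta.

(** This bound, with the existence of a jamming strategy, makes the real suprema in the criteria
    genuine least upper bounds. *)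
Lemma err_prob_le1 Q (m : 'I_N) : is_cond_dist Q ->
  err_prob PS W Theta Q m <= 1.
Proof.
move=> hQ; case: (hT) => T0 T1; case: (hPS) => PS0 PS1.
have <- : \sum_(c : det_code X Y S n N) Theta c *
    \sum_(s : vec n S) (\prod_i PS (s i)) * \sum_(j : vec n J) Q s j = 1.
  rewrite -[RHS]T1; apply: eq_bigr => c _; rewrite -[RHS]mulr1; congr (_ * _).
  rewrite -[RHS](sum_prod_dist (fun _ : 'I_n => PS1)).
  by apply: eq_bigr => s _; case: (hQ s) => _ ->; rewrite mulr1.
apply: ler_sum => c _; rewrite mulr_sumr; apply: ler_sum => s _.
rewrite mulrA mulr_sumr; apply: ler_sum => j _.
rewrite -mulr_sumr; apply: ler_piMr.
  have PS_ge0 : 0 <= \prod_i PS (s i) by apply: prodr_ge0 => i _; exact: PS0.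
  by have [Q0 _] := hQ s; rewrite mulr_ge0// mulr_ge0.
have W1 i : \sum_y W (c.1 (m, s) i) (s i) (j i) y = 1.
  by case: (hW (c.1 (m, s) i) (s i) (j i)).
rewrite -[leRHS](sum_prod_dist W1) [leLHS]big_mkcond; apply: ler_sum => y _.
case: ifP => // _; apply: prodr_ge0 => i _.
by case: (hW (c.1 (m, s) i) (s i) (j i)).
Qed.

Lemma avg_err_oblivious_ge Q : is_cond_dist Q ->
  N%:R^-1 * \sum_(m < N) err_prob PS W Theta Q m <= avg_err_oblivious PS W
    Theta.
Proof.
move=> hQ; apply: ub_le_sup; last by exists Q.
exists 1 => _ [Q' hQ' <-].
apply: (@le_trans _ _ (N%:R^-1 * \sum_(m < N) 1)).
  by rewrite ler_wpM2l ?invr_ge0 ?ler0n//; apply: ler_sum => m _;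
    exact: err_prob_le1.
rewrite sumr_const card_ord.
by have [->|N0] := posnP N; rewrite ?invr0 ?mul0r// mulVf// pnatr_eq0 -lt0n.
Qed.

Lemma worst_err_prob_ge Q m : is_cond_dist Q ->
  err_prob PS W Theta Q m <= worst_err_prob PS W Theta m.
Proof.
move=> hQ; apply: ub_le_sup; last by exists Q.
by exists 1 => _ [Q' hQ' <-]; exact: err_prob_le1.
Qed.

Let cond_nonempty : exists k : vec n S -> vec n J -> R, is_cond_dist k.
Proof. by apply: exists_cond_dist; rewrite card_ffun expn_gt0 hJ. Qed.

Lemma worst_err_prob_le m b :
  (forall Q, is_cond_dist Q -> err_prob PS W Theta Q m <= b) ->
  worst_err_prob PS W Theta m <= b.
Proof.
move=> H; apply: ge_sup => [|_ [Q hQ <-]]; last exact: H.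
by have [k hk] := cond_nonempty; exists (err_prob PS W Theta k m), k.
Qed.

Let mean_le (F : 'I_N -> R) b : 0 <= b -> (forall m, F m <= b) ->
  N%:R^-1 * \sum_(m < N) F m <= b.
Proof.
move=> b0 Fb; have [N0|N0] := posnP N.
  by move: F Fb; rewrite N0 => F _; rewrite big_ord0 mulr0.
rewrite ler_pdivrMl ?ltr0n// mulr_natl.
rewrite -[X in _ <= _ *+ X]card_ord -sumr_const; exact: ler_sum.
Qed.

Lemma max_err_ge m : worst_err_prob PS W Theta m <= max_err PS W Theta.
Proof. exact: le_bigmax. Qed.

Lemma max_err_ge0 : 0 <= max_err PS W Theta.
Proof. exact: bigmax_ge_id. Qed.

Lemma avg_err_le_max_err : avg_err PS W Theta <= max_err PS W Theta.
Proof. by apply: mean_le => [|m]; [exact: max_err_ge0|exact: max_err_ge]. Qed.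

Lemma max_err_oblivious_le_max_err :
  max_err_oblivious PS W Theta <= max_err PS W Theta.
Proof.
apply: ge_sup => [|_ [Q hQ <-]].
  by have [k hk] := cond_nonempty; eexists; exists k.
apply: bigmax_le => [|m _]; first exact: max_err_ge0.
exact: le_trans (worst_err_prob_ge m hQ) (max_err_ge m).
Qed.

Lemma avg_err_oblivious_le_avg_err :
  avg_err_oblivious PS W Theta <= avg_err PS W Theta.
Proof.
apply: ge_sup => [|_ [Q hQ <-]].
  by have [k hk] := cond_nonempty; eexists; exists k.
rewrite ler_wpM2l ?invr_ge0 ?ler0n//; apply: ler_sum => m _.
exact: worst_err_prob_ge.
Qed.

Lemma avg_err_oblivious_le_max_err_oblivious :
  avg_err_oblivious PS W Theta <= max_err_oblivious PS W Theta.
Proof.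
apply: ge_sup => [|_ [Q hQ <-]].
  by have [k hk] := cond_nonempty; eexists; exists k.
have H : \big[Num.max/0]_(m < N) err_prob PS W Theta Q m <=
    max_err_oblivious PS W Theta.
  apply: ub_le_sup; last by exists Q.
  exists 1 => _ [Q' hQ' <-]; apply: bigmax_le => // m _; exact: err_prob_le1.
apply: (le_trans _ H); apply: mean_le => [|m]; first exact: bigmax_ge_id.
exact: le_bigmax.
Qed.

End ErrorCriteria.

(** * From the information bound to a bound on rates *)

Section ConverseTheorem.
Context (R : realType) (X Y S J : finType).
Variables (PS : S -> R) (W : X -> S -> J -> Y -> R).
Hypotheses (hPS : is_dist PS) (hW : forall x s j, is_dist (W x s j)).
Hypothesis hJ : (0 < #|J|)%N.
Variable C : R.
Hypothesis HC : forall (U : finType) (mu : U -> S -> X -> R),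
  (forall u s x, 0 <= mu u s x) ->
  (forall s, \sum_u \sum_x mu u s x = PS s) ->
  exists2 Q, is_cond_dist Q & gp_obj mu (chan W Q) <= ln 2 * C.

Lemma product_cond_dist (n : nat) (A B : finType) (Q : 'I_n -> A -> B -> R) :
  (forall i, is_cond_dist (Q i)) ->
  is_cond_dist (fun (a : vec n A) (b : vec n B) => \prod_i Q i (a i) (b i)).
Proof.
move=> hQ a; split=> [b|]; first by apply: prodr_ge0 => i _; case: (hQ i (a i)).
by apply: (sum_prod_dist (k := fun i b => Q i (a i) b)) => i;
  case: (hQ i (a i)).
Qed.

(** Here [e] is the average error under the jamming of [bad_jamming]. The Donsker-Varadhan bound is
    applied to the event of correct decoding with threshold eta N. *)
Lemma finite_block_converse (n N : nat) (Theta : det_code X Y S n N ->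
  R) (eta : R) :
  (0 < N)%N -> is_dist Theta -> 1 <= eta ->
  exists2 e, 0 <= e <= avg_err_oblivious PS W Theta &
    ln (eta * N%:R) * (1 - e) - ln (1 + eta) <= n%:R * (ln 2 * C).
Proof.
move=> N0 hT eta1.
pose K := (det_code X Y S n N * 'I_N)%type.
pose r (v : K) := Theta v.1 * N%:R^-1.
pose enc (v : K) (s : vec n S) := v.1.1 (v.2, s).
have Npos : 0 < N%:R :> R by rewrite ltr0n.
have r_dist : is_dist r.
  case: hT => T0 T1; split=> [v|]; first by rewrite mulr_ge0 ?invr_ge0 ?ler0n.
  rewrite -(pair_bigA _ (fun c m => Theta c * N%:R^-1))/=.
  under eq_bigr do rewrite sumr_const card_ord -mulrnAr -mulr_natl divff
    ?gt_eqF// mulr1.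
  exact: T1.
have [Q hQ HQ] := bad_jamming hPS hW enc r_dist hJ HC.
pose p := block_law PS W r enc Q.
have p0 w : 0 <= p w by exact: block_law_ge0.
have p1 : \sum_w p w = 1 by exact: sum_block_law.
pose E (v : K) (y : vec n Y) := v.1.2 y == Some v.2.
pose Qn (s : vec n S) (j : vec n J) := \prod_i Q i (s i) (j i).
have hQn : is_cond_dist Qn by exact: product_cond_dist.
pose e := N%:R^-1 * \sum_(m < N) err_prob PS W Theta Qn m.
have eE : e = \sum_(w | ~~ E w.1.1 w.2) p w.
  rewrite sum_triple /= -(pair_bigA _ (fun c m => \sum_s \sum_(y | ~~ E (c,
    m) y)
    p ((c, m), s, y)))/= exchange_big/= /e mulr_sumr; apply: eq_bigr => m _.
  rewrite mulr_sumr; apply: eq_bigr => c _.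
  rewrite mulr_sumr; apply: eq_bigr => s _.
  rewrite exchange_big/= mulr_sumr; apply: eq_bigr => y _.
  rewrite /p /block_law/= /chan /r /enc/= bigA_distr_bigA/= !mulr_sumr.
  by apply: eq_bigr => j _; rewrite /Qn big_split/=; ring.
have pE : \sum_(w | E w.1.1 w.2) p w = 1 - e.
  by rewrite eE; move: p1; rewrite (bigID (fun w => E w.1.1 w.2))/=; lra.
exists e.
  apply/andP; split; first by rewrite eE; exact: sumr_ge0.
  exact: avg_err_oblivious_ge.
have th0 : 0 < eta * N%:R by rewrite mulr_gt0//; lra.
have Z0 : 0 < 1 + eta by lra.
(* Were the output independent of code and message, a decoder would be right with probability at
   most 1/N, since it declares at most one message; this gives the moment 1 + eta. *)
have HZ : \sum_v \sum_y law p (fun w => w.1.1) v * law p (fun w => w.2) y *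
    (if E v y then eta * N%:R else 1) <= 1 + eta.
  have l0 v y : 0 <= law p (fun w => w.1.1) v * law p (fun w => w.2) y.
    by rewrite mulr_ge0 ?law_ge0.
  apply: (@le_trans _ _ (\sum_v \sum_y law p (fun w => w.1.1) v *
    law p (fun w => w.2) y * (1 + eta * N%:R * (E v y)%:R))).
    apply: ler_sum => v _; apply: ler_sum => y _; rewrite ler_wpM2l//.
    case: (E v y); rewrite ?mulr1 ?mulr0 ?addr0//; lra.
  have -> : \sum_v \sum_y law p (fun w => w.1.1) v *
      law p (fun w => w.2) y * (1 + eta * N%:R * (E v y)%:R) =
    (\sum_v law p (fun w => w.1.1) v) * (\sum_y law p (fun w => w.2) y) +
    eta * \sum_y law p (fun w => w.2) y * \sum_v N%:R * r v * (E v y)%:R.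
    under eq_bigr do under eq_bigr do rewrite mulrDr mulr1.
    under eq_bigr do rewrite big_split/=.
    rewrite big_split/= big_distrlr/=; congr (_ + _).
    rewrite exchange_big/= mulr_sumr; apply: eq_bigr => y _.
    rewrite mulrA mulr_sumr; apply: eq_bigr => v _.
    by rewrite (law_msg hPS hW r enc hQ); ring.
  rewrite !sum_law p1 mulr1 lerD2l -[leRHS]mulr1 ler_wpM2l//; first lra.
  rewrite -[leRHS]p1 -[leRHS](sum_law p (fun w => w.2)); apply: ler_sum => y _.
  apply: ler_piMr; first exact: law_ge0.
  case: hT => T0 T1; rewrite -[leRHS]T1.
  rewrite -(pair_bigA _ (fun c m =>
    N%:R * (Theta c * N%:R^-1) * (c.2 y == Some m)%:R))/=.
  apply: ler_sum => c _.
  case Ey: (c.2 y) => [m0|].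
    rewrite (bigD1 m0)//= eqxx mulr1 big1 => [|m mm0].
      by rewrite addr0 mulrCA divff ?gt_eqF// mulr1.
    by rewrite eqE/= eq_sym (negbTE mm0) mulr0.
  by rewrite big1// => m _; rewrite mulr0.
have := mutual_info_ge_event p0 p1 th0 Z0 HZ; rewrite pE => H.
apply: (le_trans H); apply: (le_trans (converse_sum hPS hW enc r_dist hQ)).
rewrite mulr_natl -[X in _ *+ X]card_ord -sumr_const; exact: ler_sum.
Qed.

Lemma converse_rate rate :
  achievable (@avg_err_oblivious R X Y S J PS W) rate -> rate <= C.
Proof.
move=> ach; rewrite leNgt; apply/negP => Cr.
pose g := ln 2 * (rate - C); have g0 : 0 < g by rewrite mulr_gt0 ?ln2_gt0//
  subr_gt0.
(* Since ln(1 + eta) - ln eta <= 1/eta < g/4, the constant term costs less than g/4. As [d] bounds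
   the coefficient of [e] per channel use, an error below g/(4d) costs less than n g/4. For every n
   >= 1 the total is below n g, the excess to be refuted. *)
pose eta := 1 + 4 / g.
have eta1 : 1 <= eta by rewrite lerDl divr_ge0// ltW.
pose d := eta + `|rate| * ln 2.
have d0 : 0 < d by rewrite /d ltr_pwDl ?mulr_ge0 ?normr_ge0 ?(ltW (ln2_gt0
  R))//; lra.
have := ach (g / 4 / d) (divr_gt0 (divr_gt0 g0 (ltr0Sn _ 3)) d0).
move=> -[n] [N] [Th] [n0 NE hT Herr].
have N0 : (0 < N)%N by rewrite -(ltr0n R) NE powR_gt0.
have [e /andP[e0 eerr] He] := finite_block_converse N0 hT eta1.
have {}eerr : e * d < g / 4 by rewrite -ltr_pdivlMr//;
  exact: le_lt_trans eerr Herr.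
have n1 : 1 <= n%:R :> R by rewrite ler1n.
have eta0 : 0 < eta by lra.
have lnN : ln (N%:R : R) = n%:R * rate * ln 2 by rewrite NE ln_powR.
move: He; rewrite lnM ?posrE ?ltr0n// lnN => He.
have H1 : ln (1 + eta) <= ln eta + eta^-1.
  have -> : 1 + eta = eta * (1 + eta^-1) by field; rewrite gt_eqF.
  rewrite lnM ?posrE//; last by rewrite addr_gt0 ?invr_gt0.
  by rewrite lerD2l le_ln1Dx//; apply: (lt_trans (y := 0));
    rewrite ?invr_gt0//; lra.
have H2 : ln eta <= eta by exact/ltW/ln_sublinear.
have H3 : eta^-1 < g / 4.
  rewrite -[g / 4]invf_div ltf_pV2 ?posrE ?divr_gt0//; rewrite /eta; lra.
have H4 : e * (ln eta + n%:R * rate * ln 2) <= n%:R * (e * d).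
  rewrite mulrCA ler_wpM2l// /d mulrDr.
  have : ln eta <= n%:R * eta.
    by apply: (le_trans H2); rewrite ler_peMl// ltW.
  have : n%:R * rate * ln 2 <= n%:R * (`|rate| * ln 2).
    by rewrite -mulrA ler_wpM2l// ler_wpM2r ?ler_norm// ltW// ln2_gt0.
  lra.
have H5 : n%:R * (e * d) <= n%:R * (g / 4) by rewrite ler_wpM2l// ltW.
have H6 : g / 4 <= n%:R * (g / 4) by rewrite ler_peMl//; lra.
have H7 : n%:R * g = n%:R * rate * ln 2 - n%:R * (ln 2 * C) by rewrite /g; ring.
have H8 : 0 < n%:R * g by rewrite mulr_gt0// ltr0n.
lra.
Qed.

End ConverseTheorem.

(** * Random coding *)

Section RandomCodebook.
Context (R : realType) (K U : finType) (pi : U -> R).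
Hypothesis hpi : is_dist pi.

Let pi1 (i : K) : \sum_u pi u = 1. Proof. by case: hpi. Qed.
Let pi0 u : 0 <= pi u. Proof. by case: hpi. Qed.

Definition codebook_law (cb : {ffun K -> U}) : R := \prod_i pi (cb i).

Lemma codebook_law_dist : is_dist codebook_law.
Proof.
split=> [cb|]; first by apply: prodr_ge0.
exact: (sum_prod_dist pi1).
Qed.

Lemma codebook_at k (F : U -> R) :
  \sum_cb codebook_law cb * F (cb k) = \sum_u pi u * F u.
Proof. exact: (sum_prod_dist_at k F pi1). Qed.

Lemma codebook_pair k k' (F G : U -> R) : k != k' ->
  \sum_cb codebook_law cb * (F (cb k) * G (cb k')) =
  (\sum_u pi u * F u) * (\sum_u pi u * G u).
Proof.
move=> kk'.
pose c i u := pi u * ((if i == k then F u else 1) * (if i == k' then G u else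
  1)).
transitivity (\sum_(cb : {ffun K -> U}) \prod_i c i (cb i)).
  apply: eq_bigr => cb _; rewrite !big_split/=; congr (_ * (_ * _)).
    by rewrite (bigD1 k)//= eqxx big1 ?mulr1// => i /negbTE ->.
  by rewrite (bigD1 k')//= eqxx big1 ?mulr1// => i /negbTE ->.
rewrite -bigA_distr_bigA (bigD1 k)//= (bigD1 k')/=; last by rewrite eq_sym.
rewrite [X in _ * (_ * X)]big1 ?mulr1 => [|i /andP[/negbTE ik /negbTE ik']].
  congr (_ * _); apply: eq_bigr => u _; rewrite /c eqxx.
    by rewrite (negbTE kk') mulr1.
  by rewrite eq_sym (negbTE kk') mul1r.
by rewrite -[RHS](pi1 i); apply: eq_bigr => u _; rewrite /c ik ik' !mulr1.
Qed.

(** The term i = i0 reproduces F G at a single codeword; every other one is independent of codeword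
    i0 and has G-mean at most 1. *)
Lemma codebook_sum_le (I : finType) (key : I -> K) i0 (F G : U -> R) :
  injective key -> (forall u, 0 <= F u) -> (forall u, 0 <= G u) ->
  \sum_u pi u * G u <= 1 ->
  \sum_cb codebook_law cb * (F (cb (key i0)) * \sum_i G (cb (key i))) <=
  \sum_u pi u * (F u * (G u + #|I|%:R)).
Proof.
move=> ikey F0 G0 G1.
under eq_bigr do rewrite !mulr_sumr.
rewrite exchange_big/= (bigD1 i0)//= (codebook_at (key i0) (fun u => F u * G
  u)).
have -> : \sum_u pi u * (F u * (G u + #|I|%:R)) = \sum_u pi u * (F u * G u) +
    #|I|%:R * \sum_u pi u * F u.
  by rewrite mulr_sumr -big_split/=; apply: eq_bigr => u _; ring.
have F1 : 0 <= \sum_u pi u * F u by apply: sumr_ge0 => u _; rewrite mulr_ge0.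
rewrite lerD2l mulr_natl -sumr_const big_mkcond/=.
apply: ler_sum => i _; case: ifPn => // ii0.
rewrite codebook_pair ?ler_piMr// inj_eq// eq_sym//.
Qed.

(** In the variables al = A/x0 and be = B/y0 the function 1/(al be) lies above its tangent plane 3 -
    al - be at (1,1). *)
Lemma tangent_bound (a b A B x0 y0 : R) : 0 <= a <= A -> 0 <= b <= B ->
  0 < x0 -> 0 < y0 ->
  a * b / (x0 * y0) * (3 - A / x0 - B / y0) <= a / A * (b / B).
Proof.
move=> /andP[a0 aA] /andP[b0 bB] x00 y00.
have [->|an0] := eqVneq a 0; first by rewrite !mul0r.
have [->|bn0] := eqVneq b 0; first by rewrite mulr0 !mul0r mulr0.
have ap : 0 < a by rewrite lt_neqAle eq_sym an0.
have bp : 0 < b by rewrite lt_neqAle eq_sym bn0.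
have Ap := lt_le_trans ap aA; have Bp := lt_le_trans bp bB.
pose al := A / x0; pose be := B / y0.
have alp : 0 < al by rewrite divr_gt0.
have bep : 0 < be by rewrite divr_gt0.
have amgm : al * be * (3 - al - be) <= 1.
  have [s3|s3] := leP (3 - al - be) 0.
    have : al * be * (3 - al - be) <= 0 by rewrite mulr_ge0_le0// mulr_ge0 ?ltW.
    lra.
  have H1 : al * be <= (al + be) ^+ 2 / 4.
    have := sqr_ge0 (al - be); rewrite !expr2; lra.
  apply: (le_trans (ler_wpM2r (ltW s3) H1)).
  (* With s = al + be, the inequality s^2 (3 - s) <= 4 is (s - 2)^2 (s + 1) >= 0. *)
  have : 0 <= (al + be - 2) ^+ 2 * (al + be + 1).
    by rewrite mulr_ge0 ?sqr_ge0//; lra.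
  rewrite !expr2; lra.
have -> : a / A * (b / B) = a * b / (x0 * y0) * (al * be)^-1.
  by rewrite /al /be; field; rewrite !gt_eqF.
rewrite -/al -/be ler_wpM2l//.
  by rewrite divr_ge0 ?mulr_ge0 ?ltW.
have abp : 0 < al * be by exact: mulr_gt0.
have := ler_wpM2l (ltW (_ : 0 < (al * be)^-1)) amgm.
by rewrite mulr1 mulKf ?gt_eqF//; apply; rewrite invr_gt0.
Qed.

Lemma normalize_ge (A : finType) (x0 : A) (a : A -> R) x : (forall x,
  0 <= a x) ->
  a x / (\sum_x' a x') <= normalize x0 a x.
Proof.
move=> a0; rewrite /normalize; case: ifPn => // /eqP ->.
by rewrite invr0 mulr0 ler0n.
Qed.

(* Jensen's inequality for the jointly convex map (x, y) |-> 1 / (x y), in the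
   form of its tangent plane at the mean of the two normalizing sums. *)
Lemma codebook_jensen (I : finType) (key : I -> K) (i0 i1 : I) (k0 : K)
    (h a b : U -> R) : injective key ->
  (forall u, 0 <= h u) -> (forall u, 0 <= a u) -> (forall u, 0 <= b u) ->
  \sum_u pi u * a u <= 1 -> \sum_u pi u * b u <= 1 ->
  \sum_u pi u * (h u * (a u * b u / ((a u + #|I|%:R) * (b u + #|K|%:R)))) <=
  \sum_cb codebook_law cb * (h (cb (key i0)) *
    (normalize i1 (fun i => a (cb (key i))) i0 *
     normalize k0 (fun k => b (cb k)) (key i0))).
Proof.
move=> ikey h0 a0 b0 a1 b1.
have I0 : 0 < #|I|%:R :> R by rewrite ltr0n; apply/card_gt0P; exists i0.
have K0 : 0 < #|K|%:R :> R by rewrite ltr0n; apply/card_gt0P; exists k0.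
(* [x0] and [y0] bound the conditional means of the two sums given the codeword of [i0]. Each
   subtracted term of the tangent plane then averages to at most the mean of [H], and 3 - 1 - 1 = 1
   copy remains. *)
pose x0 u := a u + #|I|%:R; pose y0 u := b u + #|K|%:R.
have x00 u : 0 < x0 u by rewrite ltr_wpDl.
have y00 u : 0 < y0 u by rewrite ltr_wpDl.
pose H u := h u * (a u * b u / (x0 u * y0 u)).
have H0 u : 0 <= H u by rewrite !mulr_ge0// invr_ge0 mulr_ge0// ltW.
apply: (@le_trans _ _ (\sum_cb codebook_law cb * (H (cb (key i0)) *
  (3 - (\sum_i a (cb (key i))) / x0 (cb (key i0))
     - (\sum_k b (cb k)) / y0 (cb (key i0)))))); last first.
  apply: ler_sum => cb _; apply: ler_wpM2l; first by apply: prodr_ge0.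
  rewrite /H -mulrA; apply: ler_wpM2l => //.
  set A := \sum_i _; set B := \sum_k _.
  have aA : 0 <= a (cb (key i0)) <= A.
    by rewrite a0/= /A (bigD1 i0)//= lerDl sumr_ge0.
  have bB : 0 <= b (cb (key i0)) <= B.
    by rewrite b0/= /B (bigD1 (key i0))//= lerDl sumr_ge0.
  apply: (le_trans (tangent_bound aA bB (x00 _) (y00 _))).
  have na := normalize_ge i1 i0 (fun i => a0 (cb (key i))).
  have nb := normalize_ge k0 (key i0) (fun k => b0 (cb k)).
  have A0 : 0 <= A by rewrite sumr_ge0.
  have B0 : 0 <= B by rewrite sumr_ge0.
  by apply: ler_pM => //; rewrite divr_ge0.
have S3 : \sum_cb codebook_law cb * (H (cb (key i0)) * 3) = 3 * \sum_u pi u * H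
  u.
  rewrite (codebook_at _ (fun u => H u * 3)) mulr_sumr.
  by apply: eq_bigr => u _; ring.
have Sa := codebook_sum_le (F := fun u => H u / x0 u) i0 ikey
  (fun u => divr_ge0 (H0 u) (ltW (x00 u))) a0 a1.
have Sb := codebook_sum_le (F := fun u => H u / y0 u) (key := id) (key i0)
  (@inj_id K) (fun u => divr_ge0 (H0 u) (ltW (y00 u))) b0 b1.
have Ea : \sum_u pi u * (H u / x0 u * (a u + #|I|%:R)) = \sum_u pi u * H u.
  by apply: eq_bigr => u _; rewrite divfK// gt_eqF// x00.
have Eb : \sum_u pi u * (H u / y0 u * (b u + #|K|%:R)) = \sum_u pi u * H u.
  by apply: eq_bigr => u _; rewrite divfK// gt_eqF// y00.
rewrite Ea in Sa; rewrite Eb in Sb.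
have -> : \sum_cb codebook_law cb * (H (cb (key i0)) *
  (3 - (\sum_i a (cb (key i))) / x0 (cb (key i0))
     - (\sum_k b (cb k)) / y0 (cb (key i0)))) =
  \sum_cb codebook_law cb * (H (cb (key i0)) * 3)
  - \sum_cb codebook_law cb * (H (cb (key i0)) / x0 (cb (key i0)) * \sum_i a
    (cb (key i)))
  - \sum_cb codebook_law cb * (H (cb (key i0)) / y0 (cb (key i0)) * \sum_k b
    (cb k)).
  by rewrite -!sumrB; apply: eq_bigr => cb _; ring.
rewrite S3 -/(H _); have : \sum_u pi u * H u = \sum_u pi u * (h u *
  (a u * b u / ((a u + #|I|%:R) * (b u + #|K|%:R)))) by [].
lra.
Qed.

End RandomCodebook.

(** * One-shot coding with random choices of codewords *)

Section OneShot.
Context (R : realType) (U S X Y : finType) (N L : nat).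
Hypotheses (N0 : (0 < N)%N) (L0 : (0 < L)%N).
Variables (g : U -> S -> X) (pi : U -> R) (w : U -> S -> R) (v : U -> Y -> R).
Variable noise : Y -> Y -> R.
Hypotheses (hpi : is_dist pi) (w0 : forall u s, 0 <= w u s)
  (v0 : forall u y, 0 <= v u y)
  (w1 : forall s, \sum_u pi u * w u s <= 1)
  (v1 : forall y, \sum_u pi u * v u y <= 1) (hnoise : is_cond_dist noise).

Local Notation code := ({ffun 'I_N * S -> X} * {ffun Y -> option 'I_N})%type.
(** Each message owns [L] codewords, as in Gel'fand-Pinsker coding: the encoder picks one that suits
    the state, the decoder searches among all N L. *)
Let K := ('I_N * 'I_L)%type.
Let l0 := Ordinal L0.
Let k0 : K := (Ordinal N0, l0).

Let enc (cb : {ffun K -> U}) (ms : 'I_N * S) : 'I_L -> R :=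
  normalize l0 (fun l => w (cb (ms.1, l)) ms.2).
Let dec (cb : {ffun K -> U}) (z : Y) : K -> R :=
  normalize k0 (fun k => v (cb k) z).

Let enc_map cb (ms : 'I_N * S) (x : X) : R :=
  \sum_l enc cb ms l * (g (cb (ms.1, l)) ms.2 == x)%:R.
Let dec_map cb (y : Y) (o : option 'I_N) : R :=
  \sum_z noise y z * \sum_k dec cb z k * (Some k.1 == o)%:R.

Let enc_dist cb ms : is_dist (enc cb ms). Proof. exact: normalize_dist. Qed.
Let dec_dist cb z : is_dist (dec cb z). Proof. exact: normalize_dist. Qed.

Let sum_indic (A : finType) (a : A) : \sum_x (a == x)%:R = 1 :> R.
Proof.
rewrite (bigD1 a)//= eqxx big1 => [|x]; first by rewrite addr0.
by rewrite eq_sym => /negbTE ->.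
Qed.

Let enc_map_dist cb ms : is_dist (enc_map cb ms).
Proof.
have [e0 e1] := enc_dist cb ms; split=> [x|].
  by apply: sumr_ge0 => l _; rewrite mulr_ge0 ?ler0n.
rewrite exchange_big/= -[RHS]e1; apply: eq_bigr => l _.
by rewrite -mulr_sumr sum_indic mulr1.
Qed.

Let dec_map_dist cb y : is_dist (dec_map cb y).
Proof.
have [n0 n1] := hnoise y; split=> [ox|].
  apply: sumr_ge0 => z _; rewrite mulr_ge0//; apply: sumr_ge0 => k _.
  by have [d0 _] := dec_dist cb z; rewrite mulr_ge0 ?ler0n.
rewrite exchange_big/= -[RHS]n1; apply: eq_bigr => z _.
rewrite -mulr_sumr -[RHS]mulr1; congr (_ * _).
have [_ d1] := dec_dist cb z.
rewrite exchange_big/= -[RHS]d1; apply: eq_bigr => k _.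
by rewrite -mulr_sumr sum_indic mulr1.
Qed.

(* Given the codebook, the encoder and decoder choose their codewords with
   probabilities proportional to the weights [w] and [v], independently for all
   their arguments; this makes a law on deterministic codes. *)
Let random_code (c : code) : R := \sum_cb codebook_law pi cb *
  ((\prod_ms enc_map cb ms (c.1 ms)) * (\prod_y dec_map cb y (c.2 y))).

Let random_code_dist : is_dist random_code.
Proof.
have [p0 p1] := codebook_law_dist K hpi; split=> [c|].
  apply: sumr_ge0 => cb _; rewrite !mulr_ge0//; apply: prodr_ge0 => i _.
    by case: (enc_map_dist cb i).
  by case: (dec_map_dist cb i).
rewrite exchange_big/= -[RHS]p1; apply: eq_bigr => cb _.
rewrite -mulr_sumr -[RHS]mulr1; congr (_ * _).
rewrite -(pair_bigA _ (fun (f : {ffun 'I_N * S -> X})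
  (h : {ffun Y -> option 'I_N}) => (\prod_ms enc_map cb ms (f ms)) *
  (\prod_y dec_map cb y (h y))))/=.
rewrite -big_distrlr/= (sum_prod_dist (k := enc_map cb)) => [|ms]; last first.
  by case: (enc_map_dist cb ms).
rewrite mul1r (sum_prod_dist (k := dec_map cb))// => y.
by case: (dec_map_dist cb y).
Qed.

(** [Theta] is chosen before [m], [s] and [V], so [V] may be the channel seen under a jamming that
    depends on message and state. The bound counts only the event that the decoder picks the very
    codeword sent; the leading factor [L] is the number of codewords the encoder may send. *)
Lemma one_shot : exists2 Theta : code -> R, is_dist Theta &
  forall m s (V : X -> Y -> R), (forall x y, 0 <= V x y) ->
  \sum_u pi u * \sum_y V (g u s) y * \sum_z noise y z *
    (L%:R * (w u s * v u z / ((w u s + L%:R) * (v u z + (N * L)%:R)))) <=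
  \sum_(c : code) \sum_(y | c.2 y == Some m) Theta c * V (c.1 (m, s)) y.
Proof.
exists random_code => // m s V V0.
have -> : \sum_(c : code) \sum_(y | c.2 y == Some m) random_code c * V (c.1 (m,
  s)) y =
  \sum_cb codebook_law pi cb * \sum_y
    (\sum_x enc_map cb (m, s) x * V x y) * dec_map cb y (Some m).
  transitivity (\sum_cb codebook_law pi cb * \sum_y \sum_(c : code)
    ((\prod_ms enc_map cb ms (c.1 ms)) * V (c.1 (m, s)) y) *
    ((\prod_y dec_map cb y (c.2 y)) * (c.2 y == Some m)%:R)).
    under eq_bigr do rewrite big_mkcond/=.
    rewrite exchange_big/=.
    under [RHS]eq_bigr do rewrite mulr_sumr.
    rewrite [RHS]exchange_big/=; apply: eq_bigr => y _.
    under [RHS]eq_bigr do rewrite mulr_sumr.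
    rewrite [RHS]exchange_big/=; apply: eq_bigr => c _.
    rewrite /random_code mulr_suml; case: ifP => _.
      by apply: eq_bigr => cb _; rewrite mulr1; ring.
    by rewrite big1// => cb _; rewrite !mulr0.
  apply: eq_bigr => cb _; congr (_ * _); apply: eq_bigr => y _.
  rewrite -(pair_bigA _ (fun (f : {ffun 'I_N * S -> X})
    (h : {ffun Y -> option 'I_N}) => ((\prod_ms enc_map cb ms (f ms)) * V (f
      (m, s)) y) *
    ((\prod_y dec_map cb y (h y)) * (h y == Some m)%:R)))/=.
  rewrite -big_distrlr/=.
  rewrite (sum_prod_dist_at (k := enc_map cb) (m,
    s) (fun x => V x y)) => [|ms]; last first.
    by case: (enc_map_dist cb ms).
  rewrite (sum_prod_dist_at (k := dec_map cb) y (fun o => (o == Some m)%:R)) =>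
    [|y']; last first.
    by case: (dec_map_dist cb y').
  congr (_ * _); rewrite (bigD1 (Some m))//= eqxx mulr1 big1 ?addr0// => o
    /negbTE ->.
  by rewrite mulr0.
pose T (cb : {ffun K -> U}) y l z := noise y z *
  (V (g (cb (m, l)) s) y * (enc cb (m, s) l * dec cb z (m, l))).
apply: (@le_trans _ _ (\sum_cb codebook_law pi cb * \sum_y \sum_l \sum_z T cb y
  l z)).
  have -> : \sum_cb codebook_law pi cb * \sum_y \sum_l \sum_z T cb y l z =
    \sum_y \sum_z noise y z * \sum_l \sum_cb codebook_law pi cb *
      (V (g (cb (m, l)) s) y * (enc cb (m, s) l * dec cb z (m, l))).
    under eq_bigr do rewrite mulr_sumr.
    rewrite exchange_big/=; apply: eq_bigr => y _.
    under eq_bigr do rewrite exchange_big mulr_sumr/=.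
    rewrite exchange_big/=; apply: eq_bigr => z _.
    rewrite mulr_sumr.
    under eq_bigr do rewrite mulr_sumr.
    under [RHS]eq_bigr do rewrite mulr_sumr.
    rewrite [RHS]exchange_big/=; apply: eq_bigr => cb _.
    by apply: eq_bigr => l _; rewrite /T; ring.
  under eq_bigr do rewrite mulr_sumr.
  rewrite exchange_big/=; apply: ler_sum => y _.
  under eq_bigr do rewrite mulr_sumr mulr_sumr.
  rewrite exchange_big/=; apply: ler_sum => z _.
  have [n0 _] := hnoise y.
  have J l := @codebook_jensen R K U pi hpi 'I_L (fun l => (m, l)) l l0 k0
    (fun u => V (g u s) y) (fun u => w u s) (fun u => v u z) _
    (fun u => V0 _ _) (fun u => w0 u s) (fun u => v0 u z) (w1 s) (v1 z).
  have minj : injective (fun l : 'I_L => (m, l)) by move=> l1 l2 [].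
  have -> : \sum_u pi u * (V (g u s) y * (noise y z * (L%:R * (w u s * v u z /
      ((w u s + L%:R) * (v u z + (N * L)%:R)))))) =
    noise y z * \sum_(l < L) \sum_u pi u * (V (g u s) y *
      (w u s * v u z / ((w u s + #|'I_L|%:R) * (v u z + #|{: 'I_N *
        'I_L}|%:R)))).
    rewrite exchange_big/= mulr_sumr; apply: eq_bigr => u _.
    rewrite sumr_const !card_ord card_prod !card_ord -[X in _ = _ * X]mulr_natl.
    by ring.
  rewrite ler_wpM2l//; apply: ler_sum => l _; exact: J.
have [cb0 _] := codebook_law_dist K hpi.
apply: ler_sum => cb _; rewrite ler_wpM2l//; apply: ler_sum => y _.
have -> : \sum_x enc_map cb (m, s) x * V x y =
    \sum_l enc cb (m, s) l * V (g (cb (m, l)) s) y.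
  under eq_bigr do rewrite mulr_suml.
  rewrite exchange_big/=; apply: eq_bigr => l _.
  under eq_bigr do rewrite -mulrA.
  rewrite -mulr_sumr; congr (_ * _).
  rewrite (bigD1 (g (cb (m, l)) s))//= eqxx mul1r big1 ?addr0// => x.
  by rewrite eq_sym => /negbTE ->; rewrite mul0r.
rewrite mulr_suml; apply: ler_sum => l _.
have [e0 _] := enc_dist cb (m, s); have [n0 _] := hnoise y.
rewrite /dec_map mulr_sumr; apply: ler_sum => z _.
have [d0 _] := dec_dist cb z.
have -> : T cb y l z = enc cb (m, s) l * V (g (cb (m, l)) s) y *
    (noise y z * dec cb z (m, l)) by rewrite /T; ring.
(* Only the codeword actually sent is kept; other codewords of the same message would also decode
   correctly. *)
rewrite ler_wpM2l ?mulr_ge0// ler_wpM2l// (bigD1 (m, l))//= eqxx mulr1.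
by rewrite lerDl sumr_ge0// => k _; rewrite mulr_ge0 ?ler0n.
Qed.

End OneShot.

(** * First-order optimality *)

Section Convexity.
Context (R : realType).
Implicit Types x y c d m : R.

Lemma xlnx_tangent x m : 0 <= x -> 0 < m ->
  xlnx m + (1 + ln m) * (x - m) <= xlnx x.
Proof.
move=> x0 m0; have := gibbs x0 (ltW m0); rewrite /xlnx => H.
have {}H : x - m <= x * (ln x - ln m) by apply: H => m1; move: m0;
  rewrite m1 ltxx.
lra.
Qed.

Lemma xlnx_convex x y d : 0 <= x -> 0 <= y -> 0 <= d <= 1 ->
  xlnx ((1 - d) * x + d * y) <= (1 - d) * xlnx x + d * xlnx y.
Proof.
move=> x0 y0 /andP[d0 d1]; set m := (1 - d) * x + d * y.
have d1' : 0 <= 1 - d by lra.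
have : 0 <= m by rewrite addr_ge0 ?mulr_ge0.
rewrite le_eqVlt => /predU1P[m0|m0].
  have /eqP : m = 0 by [].
  rewrite paddr_eq0 ?mulr_ge0// => /andP[/eqP h1 /eqP h2].
  by rewrite -m0 /xlnx !mulrA h1 h2 !mul0r addr0.
have H1 := ler_wpM2l d1' (xlnx_tangent x0 m0).
have H2 := ler_wpM2l d0 (xlnx_tangent y0 m0).
have := lerD H1 H2; apply: le_trans.
rewrite le_eqVlt; apply/orP; left; apply/eqP.
transitivity (xlnx m + (1 + ln m) * (((1 - d) * x + d * y) - m)); last by ring.
by rewrite -/m subrr mulr0 addr0.
Qed.

Lemma xlnx_superadd x y : 0 <= x -> 0 <= y -> xlnx x + xlnx y <= xlnx (x + y).
Proof.
have aux x' y' : 0 <= x' -> 0 <= y' -> xlnx x' <= x' * ln (x' + y').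
  rewrite le_eqVlt => /predU1P[<- _|x0 y0]; first by rewrite /xlnx !mul0r.
  apply: ler_wpM2l; first exact: ltW.
  by rewrite ler_ln ?posrE ?ltr_pwDl// lerDl.
move=> x0 y0; have := lerD (aux _ _ x0 y0) (aux _ _ y0 x0).
by rewrite [y + x]addrC -mulrDl.
Qed.

Lemma xlnxM c x : 0 <= c -> 0 <= x -> xlnx (c * x) = c * xlnx x + x * xlnx c.
Proof.
rewrite le_eqVlt => /predU1P[<- _|c0].
  by rewrite /xlnx !mul0r mulr0 addr0.
rewrite le_eqVlt => /predU1P[<-|x0]; first by rewrite /xlnx !(mul0r,
  mulr0) addr0.
by rewrite /xlnx lnM ?posrE//; ring.
Qed.

(** Because exp(-x) >= 1 - x and (1 + x + 2 x^2)(1 - x) = 1 + x^2 (1 - 2 x) >= 1. *)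
Lemma expR_le_quad x : x <= 1 / 2 -> expR x <= 1 + x + 2 * x ^+ 2.
Proof.
move=> x1; have H : 1 - x <= expR (- x) by exact: expR_ge1Dx.
have p : 0 < 1 - x by lra.
have q : 0 <= 1 + x + 2 * x ^+ 2 by nra.
have H2 : 1 <= (1 + x + 2 * x ^+ 2) * (1 - x).
  have : 0 <= x ^+ 2 * (1 - 2 * x) by rewrite mulr_ge0 ?sqr_ge0//; lra.
  rewrite !expr2; lra.
have H3 := ler_wpM2l q H.
have H4 : 1 <= (1 + x + 2 * x ^+ 2) * expR (- x) by exact: le_trans H3.
have := ler_wpM2l (expR_ge0 x) H4.
by rewrite mulr1 mulrCA -expRD subrr expR0 mulr1.
Qed.

Lemma powR_prod (I : finType) (a : I -> R) t : (forall i, 0 <= a i) ->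
  (\prod_i a i) `^ t = \prod_i (a i `^ t).
Proof.
move=> a0.
suff [] : 0 <= \prod_i a i /\ (\prod_i a i) `^ t = \prod_i (a i `^ t) by [].
elim/big_rec2: _ => [|i x y _ [y0 <-]]; first by rewrite powR1.
by rewrite mulr_ge0 ?powRM.
Qed.

(** For small [t] the exponent of a t-th moment is [t] times the mean of the logarithm, up to a
    second-order term; this turns moment bounds into information quantities. *)
Lemma mgf_bound (I : finType) (mu a : I -> R) (B t : R) : is_dist mu ->
  (forall i, 0 < mu i -> 0 < a i) -> (forall i, `|ln (a i)| <= B) ->
  0 < t -> t * B <= 1 / 2 ->
  \sum_i mu i * a i `^ t <= expR (t * (\sum_i mu i * ln (a i)) + 2 * (t * B) ^+
    2).
Proof.
move=> [mu0 mu1] apos aB t0 tB.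
apply: (le_trans _ (expR_ge1Dx _)).
have -> : 1 + (t * (\sum_i mu i * ln (a i)) + 2 * (t * B) ^+ 2) =
    \sum_i mu i * (1 + t * ln (a i) + 2 * (t * B) ^+ 2).
  rewrite -[X in X + _ = _]mu1 -[2 * (t * B) ^+ 2]mulr1 -{2}mu1.
  rewrite !mulr_sumr -!big_split/=; apply: eq_bigr => i _; ring.
apply: ler_sum => i _.
have [->|nz] := eqVneq (mu i) 0; first by rewrite !mul0r.
have mi : 0 < mu i by rewrite lt_neqAle eq_sym nz mu0.
rewrite ler_wpM2l// -[a i](lnK (apos _ mi)) -expRM expRK mulrC.
have := aB i; rewrite ler_norml => /andP[l1 l2].
have tl : `|t * ln (a i)| <= t * B.
  by rewrite normrM (gtr0_norm t0) ler_wpM2l// ltW.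
have tl2 : (t * ln (a i)) ^+ 2 <= (t * B) ^+ 2.
  by rewrite -[leLHS]real_normK ?num_real// ler_sqr ?nnegrE// (le_trans _ tl).
apply: (le_trans (expR_le_quad _)).
  by rewrite (le_trans (ler_norm _))// (le_trans tl).
by rewrite lerD2l ler_wpM2l.
Qed.

End Convexity.

Section FirstOrder.
Context (R : realType) (A B : finType).

Definition minfo (J : A -> B -> R) : R :=
  \sum_a \sum_b xlnx (J a b) - \sum_a xlnx (\sum_b J a b)
  - \sum_b xlnx (\sum_a J a b).

Definition idens (J : A -> B -> R) (a : A) (b : B) : R :=
  ln (J a b) - ln (\sum_b' J a b') - ln (\sum_a' J a' b).

Lemma minfo_idens J : minfo J = \sum_a \sum_b J a b * idens J a b.
Proof.
rewrite /minfo /idens.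
have -> : \sum_b xlnx (\sum_a J a b) = \sum_a \sum_b J a b * ln (\sum_a' J a'
  b).
  by rewrite exchange_big/=; apply: eq_bigr => b _; rewrite /xlnx mulr_suml.
rewrite -!sumrB; apply: eq_bigr => a _.
rewrite {2}/xlnx mulr_suml -!sumrB; apply: eq_bigr => b _.
by rewrite /xlnx; ring.
Qed.

(* Up to an additive constant, [idens J0] is the gradient of the convex
   functional [minfo] at its minimizer [J0] on the segment. *)
Lemma minfo_first_order (J0 J1 : A -> B -> R) :
  (forall a b, 0 <= J0 a b) -> (forall a b, 0 <= J1 a b) ->
  (forall a, \sum_b J0 a b = \sum_b J1 a b) ->
  (forall a b, J0 a b = 0 -> J1 a b = 0) ->
  (forall t, 0 <= t <= 1 ->
    minfo J0 <= minfo (fun a b => (1 - t) * J0 a b + t * J1 a b)) ->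
  minfo J0 <= \sum_a \sum_b J1 a b * idens J0 a b.
Proof.
move=> J00 J10 margA supp Hmin.
set D := \sum_a \sum_b J1 a b * idens J0 a b.
(* The chi-square divergence of [J1] from [J0], which controls the second-order term along the
   segment. *)
pose K := \sum_a \sum_b (J1 a b - J0 a b) ^+ 2 / J0 a b.
have K0 : 0 <= K.
  by apply: sumr_ge0 => a _; apply: sumr_ge0 => b _; rewrite divr_ge0 ?sqr_ge0.
have step t : 0 < t <= 1 -> minfo J0 - D <= t * K.
  move=> /andP[t0 t1].
  pose Jt a b := (1 - t) * J0 a b + t * J1 a b.
  have t1' : 0 <= 1 - t by lra.
  have Jt0 a b : 0 <= Jt a b by rewrite addr_ge0 ?mulr_ge0// ltW.
  have suppt a b : J0 a b = 0 -> Jt a b = 0.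
    by move=> e; rewrite /Jt (supp _ _ e) e !mulr0 addr0.
  have lin : \sum_a \sum_b Jt a b * idens J0 a b = (1 - t) * minfo J0 + t * D.
    rewrite minfo_idens /D !mulr_sumr -big_split/=; apply: eq_bigr => a _.
    by rewrite !mulr_sumr -big_split/=; apply: eq_bigr => b _; rewrite /Jt;
      ring.
  have margt a : \sum_b Jt a b = \sum_b J0 a b.
    by rewrite /Jt big_split/= -!mulr_sumr -margA; ring.
  have Y0 b : 0 <= \sum_a J0 a b by exact: sumr_ge0.
  have Yt0 b : 0 <= \sum_a Jt a b by exact: sumr_ge0.
  have KLY : 0 <= \sum_b (\sum_a Jt a b) *
      (ln (\sum_a Jt a b) - ln (\sum_a J0 a b)).
    apply: (@le_trans _ _ (\sum_b (\sum_a Jt a b - \sum_a J0 a b))).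
      rewrite sumrB exchange_big/= [X in _ - X]exchange_big/=.
      by under eq_bigr do rewrite margt; rewrite subrr.
    apply: ler_sum => b _; apply: gibbs => // H.
    rewrite big1// => a _; apply: suppt; apply/eqP.
    by move/eqP: H; rewrite psumr_eq0// => /allP/(_ a);
      rewrite mem_index_enum; apply.
  have KLJ : \sum_a \sum_b Jt a b * (ln (Jt a b) - ln (J0 a b)) <= t ^+ 2 * K.
    apply: (@le_trans _ _ (\sum_a \sum_b (t ^+ 2 * ((J1 a b - J0 a b) ^+ 2 / J0
      a b)
      + t * (J1 a b - J0 a b)))).
      apply: ler_sum => a _; apply: ler_sum => b _.
      have [e|nz] := eqVneq (J0 a b) 0.
        by rewrite (suppt _ _ e) (supp _ _ e) e !(mul0r, subrr, expr2, mulr0,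
          addr0).
      have J0p : 0 < J0 a b by rewrite lt_neqAle eq_sym nz J00.
      have -> : t ^+ 2 * ((J1 a b - J0 a b) ^+ 2 / J0 a b) + t * (J1 a b - J0 a
        b)
          = Jt a b * (Jt a b / J0 a b - 1) by rewrite /Jt; field.
      have [->|nzt] := eqVneq (Jt a b) 0; first by rewrite !mul0r.
      have Jtp : 0 < Jt a b by rewrite lt_neqAle eq_sym nzt Jt0.
      by rewrite ler_wpM2l// -ln_div ?posrE// ln_le_subr1// divr_gt0.
    under eq_bigr do rewrite big_split/= -!mulr_sumr sumrB -margA subrr mulr0
      addr0.
    by rewrite -mulr_sumr.
  have H := Hmin t; rewrite (ltW t0) t1 in H; have {}H := H isT.
  (* The information at [Jt] is a linear part, plus the divergence of [Jt] from [J0], minus that of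
     their output marginals. The last is nonnegative and dropped, the middle one is at most t^2
     [K]. *)
  have mE : minfo Jt = \sum_a \sum_b Jt a b * idens J0 a b
      + \sum_a \sum_b Jt a b * (ln (Jt a b) - ln (J0 a b))
      - \sum_b (\sum_a Jt a b) * (ln (\sum_a Jt a b) - ln (\sum_a J0 a b)).
    have -> : \sum_b (\sum_a Jt a b) * (ln (\sum_a Jt a b) - ln (\sum_a J0 a
      b)) =
      \sum_a \sum_b Jt a b * (ln (\sum_a Jt a b) - ln (\sum_a J0 a b)).
      by rewrite exchange_big/=; apply: eq_bigr => b _; rewrite mulr_suml.
    rewrite minfo_idens -big_split -sumrB/=; apply: eq_bigr => a _.
    rewrite -big_split -sumrB/=; apply: eq_bigr => b _.
    by rewrite /idens margt; ring.
  have : t * (minfo J0 - D) <= t * (t * K).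
    rewrite expr2 in KLJ; rewrite -/Jt mE lin in H; lra.
  by rewrite ler_pM2l.
rewrite -subr_le0 leNgt; apply/negP => pos.
have p1 : 0 < minfo J0 - D + K by rewrite ltr_pwDl.
(* This [t] makes t [K] smaller than the supposed positive gap. *)
have := step ((minfo J0 - D) / (2 * (minfo J0 - D + K))).
have -> : 0 < (minfo J0 - D) / (2 * (minfo J0 - D + K)) <= 1.
  rewrite divr_gt0 ?mulr_gt0//= ler_pdivrMr ?mulr_gt0//; lra.
move=> /(_ isT); rewrite mulrAC ler_pdivlMr ?mulr_gt0// ler_pM2l//; lra.
Qed.

End FirstOrder.

(** * Noisy outputs *)

Section NoisyChannel.
Context (R : realType) (X Y S J : finType).
Variables (PS : S -> R) (W : X -> S -> J -> Y -> R).
Hypotheses (hJ : (0 < #|J|)%N) (hPS : is_dist PS) (hPS_pos : forall s,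
  0 < PS s).
Hypothesis hW : forall x s j, is_dist (W x s j).

Definition unif_mix (d : R) (y z : Y) : R :=
  (1 - d) * (y == z)%:R + d / #|Y|%:R.

Definition noisy (d : R) (x : X) (s : S) (j : J) (z : Y) : R :=
  (1 - d) * W x s j z + d / #|Y|%:R.

Context (d : R) (hd : 0 < d < 1) (y0 : Y).

Let Y0 : 0 < #|Y|%:R :> R. Proof. by rewrite ltr0n; apply/card_gt0P;
  exists y0. Qed.
Let d0 : 0 < d. Proof. by case/andP: hd. Qed.
Let d1 : 0 < 1 - d. Proof. by rewrite subr_gt0; case/andP: hd. Qed.

Let dY0 : 0 < d / #|Y|%:R. Proof. exact: divr_gt0. Qed.

Let sum_unif (c : R) : \sum_(z : Y) c / #|Y|%:R = c.
Proof. by rewrite sumr_const -[LHS]mulr_natr divfK// gt_eqF. Qed.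

Lemma unif_mix_dist : is_cond_dist (unif_mix d).
Proof.
move=> y; split=> [z|].
  by apply: addr_ge0; last exact: ltW; rewrite mulr_ge0 ?ler0n// ltW.
rewrite big_split/= sum_unif -mulr_sumr (bigD1 y)//= eqxx big1 => [|z].
  by rewrite addr0 mulr1 subrK.
by rewrite eq_sym => /negbTE ->.
Qed.

Lemma sum_unif_mix x s j z : \sum_y W x s j y * unif_mix d y z = noisy d x s j
  z.
Proof.
rewrite /unif_mix /noisy; under eq_bigr do rewrite mulrDr.
rewrite big_split/= -mulr_suml; case: (hW x s j) => _ ->; rewrite mul1r.
congr (_ + _); rewrite (bigD1 z)//= eqxx mulr1 mulrC big1 ?addr0// => y /negbTE
  ->.
by rewrite !mulr0.
Qed.

Lemma noisy_dist x s j : is_dist (noisy d x s j).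
Proof.
case: (hW x s j) => W0 W1; split=> [z|].
  by apply: addr_ge0; last exact: ltW; rewrite mulr_ge0// ltW.
by rewrite big_split/= sum_unif -mulr_sumr W1 mulr1 subrK.
Qed.

Lemma noisy_gt0 x s j z : 0 < noisy d x s j z.
Proof.
case: (hW x s j) => W0 W1.
by apply: ltr_wpDl => //; rewrite mulr_ge0// ltW.
Qed.

Lemma chan_noisyE Q x s z : is_cond_dist Q ->
  chan (noisy d) Q x s z = (1 - d) * chan W Q x s z + d / #|Y|%:R.
Proof.
move=> hQ; rewrite /chan /noisy; under eq_bigr do rewrite mulrDr.
rewrite big_split/= -mulr_suml; case: (hQ s) => _ ->; rewrite mul1r.
by congr (_ + _); rewrite mulr_sumr; apply: eq_bigr => j _; rewrite mulrCA.
Qed.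

Context (U : finType) (PU : S -> U -> R) (f : U -> S -> X).
Hypothesis hPU : is_cond_dist PU.

Definition margU (u : U) : R := \sum_s PS s * PU s u.

Definition lawUY (V : X -> S -> Y -> R) (u : U) (y : Y) : R :=
  \sum_s PS s * PU s u * V (f u s) s y.

Definition infoUS : R :=
  \sum_s \sum_u PS s * PU s u * ln (PU s u / margU u).

Lemma PU_ge0 s u : 0 <= PU s u. Proof. by case: (hPU s). Qed.
Lemma PS_ge0 s : 0 <= PS s. Proof. by case: hPS. Qed.

Lemma margU_ge0 u : 0 <= margU u.
Proof. by apply: sumr_ge0 => s _; rewrite mulr_ge0 ?PS_ge0 ?PU_ge0. Qed.

Lemma PU_gt0_margU s u : 0 < PU s u -> 0 < margU u.
Proof.
move=> h; rewrite /margU (bigD1 s)//= ltr_pwDl ?mulr_gt0//.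
by apply: sumr_ge0 => s' _; rewrite mulr_ge0 ?PS_ge0 ?PU_ge0.
Qed.

Lemma margU0 s u : margU u = 0 -> PU s u = 0.
Proof.
move=> m0; apply/eqP; rewrite eq_le PU_ge0 andbT leNgt; apply/negP.
by move=> /PU_gt0_margU; rewrite m0 ltxx.
Qed.

Lemma sum_margU : \sum_u margU u = 1.
Proof.
rewrite exchange_big/=; case: (hPS) => _ <-; apply: eq_bigr => s _.
by rewrite -mulr_sumr; case: (hPU s) => _ ->; rewrite mulr1.
Qed.

Lemma sum_lawUY_y V u : (forall x s, is_dist (V x s)) ->
  \sum_y lawUY V u y = margU u.
Proof.
move=> hV; rewrite exchange_big/=; apply: eq_bigr => s _.
by rewrite -mulr_sumr; case: (hV (f u s) s) => _ ->; rewrite mulr1.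
Qed.

Lemma lawUY_ge0 V u y : (forall x s, is_dist (V x s)) -> 0 <= lawUY V u y.
Proof.
move=> hV; apply: sumr_ge0 => s _; rewrite !mulr_ge0 ?PS_ge0 ?PU_ge0//.
by case: (hV (f u s) s).
Qed.

Lemma infoUS_ge0 : 0 <= infoUS.
Proof.
apply: (@le_trans _ _ (\sum_s \sum_u (PS s * PU s u - PS s * margU u))).
  rewrite big1// => s _; rewrite sumrB -!mulr_sumr sum_margU.
  by case: (hPU s) => _ ->; rewrite subrr.
apply: ler_sum => s _; apply: ler_sum => u _.
rewrite -mulrBr -[leRHS]mulrA; apply: ler_wpM2l; first exact: PS_ge0.
have [->|nz] := eqVneq (PU s u) 0.
  by rewrite mul0r sub0r oppr_le0 margU_ge0.
have p : 0 < PU s u by rewrite lt_neqAle eq_sym nz PU_ge0.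
have q := PU_gt0_margU p.
rewrite ln_div ?posrE//; apply: gibbs; rewrite ?ltW// => e.
by move: q; rewrite e ltxx.
Qed.

Lemma gp_obj_minfo V : (forall x s, is_dist (V x s)) ->
  gp_obj (gp_mu PS PU f) V = minfo (lawUY V) - infoUS.
Proof.
move=> hV.
have UYE u y : \sum_s \sum_x gp_mu PS PU f u s x * V x s y = lawUY V u y.
  apply: eq_bigr => s _; rewrite /gp_mu; under eq_bigr do rewrite -mulrA.
  by rewrite -mulr_sumr sum_eq_indic.
rewrite /gp_obj /minfo.
under eq_bigr do under eq_bigr do rewrite UYE.
under [X in _ - X - _ + _]eq_bigr do under eq_bigr do rewrite UYE.
under [X in _ - X + _]eq_bigr do under eq_bigr do rewrite sum_gp_mu.
under [X in _ + X = _]eq_bigr do rewrite gp_mu_marg//.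
under [X in _ = _ - X - _ - _]eq_bigr do rewrite sum_lawUY_y//.
have -> : infoUS = \sum_u \sum_s xlnx (PS s * PU s u) - \sum_s xlnx (PS s)
    - \sum_u xlnx (margU u).
  have -> : \sum_u xlnx (margU u) = \sum_s \sum_u PS s * PU s u * ln (margU u).
    by rewrite exchange_big/=; apply: eq_bigr => u _; rewrite /xlnx mulr_suml.
  rewrite exchange_big/= -!sumrB; apply: eq_bigr => s _.
  have -> : xlnx (PS s) = \sum_u PS s * PU s u * ln (PS s).
    rewrite -mulr_suml -mulr_sumr; case: (hPU s) => _ ->.
    by rewrite mulr1.
  rewrite -!sumrB; apply: eq_bigr => u _.
  have [e|nz] := eqVneq (PU s u) 0;
    first by rewrite /xlnx e mulr0 !mul0r !subr0.
  have p : 0 < PU s u by rewrite lt_neqAle eq_sym nz PU_ge0.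
  have q := PU_gt0_margU p.
  by rewrite /xlnx ln_div ?posrE// lnM ?posrE//; ring.
by ring.
Qed.

Lemma lawUY_noisyE Q u y : is_cond_dist Q ->
  lawUY (chan (noisy d) Q) u y =
  (1 - d) * lawUY (chan W Q) u y + d * (#|Y|%:R^-1 * margU u).
Proof.
move=> hQ; rewrite /lawUY /margU !mulr_sumr -big_split/=.
by apply: eq_bigr => s _; rewrite chan_noisyE//; ring.
Qed.

(** If a flag told whether the output had been replaced by a uniform symbol, the information would
    be (1 - d) I(U;Y); hiding the flag costs at most its entropy. In formulas, superadditivity of x
    ln x bounds the joint term and convexity the output term. *)
Lemma minfo_noisy_ge Q : is_cond_dist Q ->
  (1 - d) * minfo (lawUY (chan W Q)) + xlnx d + xlnx (1 - d) <=
  minfo (lawUY (chan (noisy d) Q)).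
Proof.
move=> hQ.
have hV x s := chan_dist hW x s hQ.
have hVd x s := chan_dist noisy_dist x s hQ.
set T0 := lawUY (chan W Q); set T1 := lawUY (chan (noisy d) Q).
have T00 u y : 0 <= T0 u y by exact: lawUY_ge0.
have b0 u : 0 <= #|Y|%:R^-1 * margU u by rewrite mulr_ge0 ?invr_ge0
  ?margU_ge0// ltW.
have mJ u : \sum_y T0 u y = margU u by exact: sum_lawUY_y.
have mJd u : \sum_y T1 u y = margU u by exact: sum_lawUY_y.
have sumJ : \sum_u \sum_y T0 u y = 1 by under eq_bigr do rewrite mJ;
  exact: sum_margU.
have dd : 0 <= d <= 1 by move: hd; lra.
pose lY := ln (#|Y|%:R : R).
have yE : xlnx (#|Y|%:R^-1 : R) = - (#|Y|%:R^-1 * lY).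
  by rewrite /xlnx lnV ?posrE// mulrN.
have UYb : (1 - d) * (\sum_u \sum_y xlnx (T0 u y)) + xlnx (1 - d) +
    d * (\sum_u xlnx (margU u) - lY) + xlnx d <= \sum_u \sum_y xlnx (T1 u y).
  apply: (@le_trans _ _ (\sum_u \sum_y (xlnx ((1 - d) * T0 u y) +
      xlnx (d * (#|Y|%:R^-1 * margU u))))); last first.
    apply: ler_sum => u _; apply: ler_sum => y _; rewrite /T1 lawUY_noisyE//.
    by apply: xlnx_superadd; rewrite mulr_ge0// ltW.
  have expand (m : U -> R) : (forall u, 0 <= m u) ->
      \sum_u \sum_y (xlnx ((1 - d) * T0 u y) + xlnx (d * (#|Y|%:R^-1 * m u)))
    = (1 - d) * (\sum_u \sum_y xlnx (T0 u y)) + xlnx (1 - d) * (\sum_u \sum_y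
      T0 u y)
      + (d * (\sum_u xlnx (m u)) - d * lY * (\sum_u m u)
      + xlnx d * (\sum_u m u)).
    move=> m0; rewrite !mulr_sumr -sumrB -!big_split/=; apply: eq_bigr => u _.
    rewrite [LHS]big_split/= !mulr_sumr -[X in _ = X + _]big_split/=;
      congr (_ + _).
      by apply: eq_bigr => y _; rewrite xlnxM// ?(ltW d1)//; ring.
    rewrite sumr_const -[X in X = _]mulr_natr xlnxM// ?(ltW d0)//; last first.
      by rewrite mulr_ge0 ?invr_ge0// ltW.
    rewrite xlnxM// ?invr_ge0 ?(ltW Y0)// yE.
    by field; rewrite gt_eqF.
  rewrite (expand _ margU_ge0).
  by rewrite sumJ sum_margU; lra.
have Yb : \sum_y xlnx (\sum_u T1 u y) <=
    (1 - d) * (\sum_y xlnx (\sum_u T0 u y)) - d * lY.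
  apply: (@le_trans _ _ (\sum_y ((1 - d) * xlnx (\sum_u T0 u y) +
      d * xlnx (#|Y|%:R^-1)))).
    apply: ler_sum => y _.
    have -> : \sum_u T1 u y = (1 - d) * (\sum_u T0 u y) + d * #|Y|%:R^-1.
      transitivity (\sum_u ((1 - d) * T0 u y + d * (#|Y|%:R^-1 * margU u))).
        by apply: eq_bigr => u _; exact: lawUY_noisyE.
      by rewrite big_split/= -!mulr_sumr sum_margU mulr1.
    by apply: xlnx_convex => //; rewrite ?invr_ge0 ?sumr_ge0.
  rewrite big_split/= -mulr_sumr lerD2l sumr_const -[leLHS]mulr_natr yE.
  rewrite le_eqVlt; apply/orP; left; apply/eqP; field; by rewrite gt_eqF.
rewrite /minfo.
have -> : \sum_u xlnx (\sum_y T0 u y) = \sum_u xlnx (margU u).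
  by under eq_bigr do rewrite mJ.
have -> : \sum_u xlnx (\sum_y T1 u y) = \sum_u xlnx (margU u).
  by under eq_bigr do rewrite mJd.
lra.
Qed.

Lemma lawUY_noisy_gt0 Q u y : is_cond_dist Q -> 0 < margU u ->
  0 < lawUY (chan (noisy d) Q) u y.
Proof.
move=> hQ; rewrite lawUY_noisyE// => m0.
rewrite ltr_wpDl ?mulr_gt0 ?invr_gt0// mulr_ge0 ?(ltW d1)//.
by apply: lawUY_ge0 => x s; exact: chan_dist.
Qed.

(* The decoding metric is the information density of the worst single-letter
   jamming, whose mean cannot be lowered by any other jamming. *)
Lemma worst_density : exists2 Qs : S -> J -> R, is_cond_dist Qs &
  forall Q, is_cond_dist Q -> minfo (lawUY (chan (noisy d) Qs)) <=
    \sum_u \sum_y lawUY (chan (noisy d) Q) u y * idens (lawUY (chan (noisy d)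
      Qs)) u y.
Proof.
have [Qs hQs Qmin] := kernel_min
  (@continuous_chan _ _ _ _ _ (noisy d) _ (gp_mu PS PU f)) (exists_cond_dist R
    S hJ).
have hV Q x s (hQ : is_cond_dist Q) := chan_dist noisy_dist x s hQ.
exists Qs => // Q hQ; apply: minfo_first_order.
- by move=> u y; apply: lawUY_ge0 => x s; exact: hV.
- by move=> u y; apply: lawUY_ge0 => x s; exact: hV.
- by move=> u; rewrite !sum_lawUY_y// => x s; exact: hV.
(* The support condition: the noise makes the joint law positive wherever the marginal of U is. *)
- move=> u y; have [m0|m0] := eqVneq (margU u) 0.
    by move=> _; apply: big1 => s _; rewrite (margU0 s m0) mulr0 mul0r.
  have mp : 0 < margU u by rewrite lt_neqAle eq_sym m0 margU_ge0.
  by have := lawUY_noisy_gt0 y hQs mp => /lt0r_neq0/eqP.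
- move=> t /andP[t0 t1].
  pose Qt s j := (1 - t) * Qs s j + t * Q s j.
  have hQt : is_cond_dist Qt.
    move=> s; have [q0 q1] := hQ s; have [p0 p1] := hQs s; split=> [j|].
      by rewrite addr_ge0 ?mulr_ge0//; lra.
    by rewrite big_split/= -!mulr_sumr q1 p1; ring.
  have -> : (fun u y => (1 - t) * lawUY (chan (noisy d) Qs) u y +
      t * lawUY (chan (noisy d) Q) u y) = lawUY (chan (noisy d) Qt).
    apply/funext => u; apply/funext => y;
      rewrite /lawUY !mulr_sumr -big_split/=.
    apply: eq_bigr => s _; rewrite /chan !mulr_sumr -big_split/=.
    by apply: eq_bigr => j _; rewrite /Qt; ring.
  have := Qmin _ hQt; rewrite !gp_obj_minfo ?lerD2r//.
    by move=> x s; exact: hV.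
  by move=> x s; exact: hV.
Qed.

End NoisyChannel.

(** * Achievability *)

Section LikelihoodBound.
Context (R : realType).
Implicit Types a t w v L M : R.

(** For a >= 1 the left side is nonpositive; for a < 1, a <= a^t and (1 - a)(1 + a) <= 1. *)
Lemma inv1D_ge a t : 0 < a -> 0 < t <= 1 -> 1 - a `^ t <= (1 + a)^-1.
Proof.
move=> a0 /andP[t0 t1]; have p : 0 < 1 + a by lra.
have [a1|a1] := leP 1 a.
  have h : 1 <= a `^ t.
    have := @ge0_ler_powR R t (ltW t0) 1 a.
    by rewrite !nnegrE powR1 ler01 (ltW a0) => /(_ isT isT a1).
  by apply: (@le_trans _ _ 0); rewrite ?subr_le0// invr_ge0 ltW.
have h : a <= a `^ t.
  rewrite /powR gt_eqF// -[leLHS](lnK a0) ler_expR.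
  have := ln_le0 (ltW a1); nra.
apply: (@le_trans _ _ (1 - a)); first lra.
rewrite -[leRHS]mul1r ler_pdivlMr//; nra.
Qed.

(** The right side is [w] times 1/(1 + w/L) times 1/(1 + M/v), and x y >= x + y - 1 for x, y <= 1.
    Reciprocals are traded for powers because powers factor over the letters of a block. *)
Lemma likelihood_bound w v L M t : 0 < w -> 0 < v -> 0 < L -> 0 < M ->
  0 < t <= 1 ->
  w * (1 - (w / L) `^ t - (M / v) `^ t) <= L * (w * v / ((w + L) * (v + M))).
Proof.
move=> w0 v0 L0 M0 ht.
have a0 : 0 < w / L by exact: divr_gt0.
have b0 : 0 < M / v by exact: divr_gt0.
have Ha := inv1D_ge a0 ht; have Hb := inv1D_ge b0 ht.
have wL := addr_gt0 w0 L0; have vM := addr_gt0 v0 M0.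
have -> : L * (w * v / ((w + L) * (v + M))) =
    w * ((1 + w / L)^-1 * (1 + M / v)^-1).
  have -> : 1 + w / L = (w + L) / L by field; rewrite gt_eqF.
  have -> : 1 + M / v = (v + M) / v by field; rewrite gt_eqF.
  by rewrite !invf_div; field; rewrite !gt_eqF.
rewrite ler_wpM2l ?(ltW w0)//.
have p1 : (1 + w / L)^-1 <= 1 by rewrite invf_le1; lra.
have r1 : (1 + M / v)^-1 <= 1 by rewrite invf_le1; lra.
nra.
Qed.

End LikelihoodBound.

Section BlockCoding.
Context (R : realType) (X Y S J U : finType).
Variables (PS : S -> R) (W : X -> S -> J -> Y -> R).
Hypotheses (hPS : is_dist PS) (hPS_pos : forall s, 0 < PS s).
Hypothesis hW : forall x s j, is_dist (W x s j).
Context (d : R) (hd : 0 < d < 1) (y0 : Y).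
Context (PU : S -> U -> R) (f : U -> S -> X).
Hypothesis hPU : is_cond_dist PU.
Variables (v1 : U -> Y -> R) (t : R).
Hypothesis v1_ge0 : forall u y, 0 <= v1 u y.
Hypothesis v1_gt0 : forall s u y, 0 < PU s u -> 0 < v1 u y.
Hypothesis v1_sum : forall y, \sum_u margU PS PU u * v1 u y <= 1.
Hypothesis ht : 0 < t <= 1.

Let w1 u s := PU s u / margU PS PU u.
Let bfun s j := \sum_u PU s u * \sum_z noisy W d (f u s) s j z * (v1 u z)^-1 `^
  t.

Let margU_w1 u s : margU PS PU u * w1 u s = PU s u.
Proof.
rewrite /w1; have [m0|m0] := eqVneq (margU PS PU u) 0.
  by rewrite m0 mul0r (margU0 hPS hPS_pos hPU s m0).
by rewrite mulrC divfK.
Qed.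

Let w1_ge0 u s : 0 <= w1 u s.
Proof. by rewrite divr_ge0 ?(PU_ge0 hPU)// (margU_ge0 hPS hPU). Qed.

(** The first term measures the failure to find a codeword suiting the state, the second the
    confusion among all N L codewords; only the second involves the jamming. Both are t-th moments
    of product likelihoods, hence n-th powers. *)
Lemma block_coding (n N L : nat) (jm : S -> J) : (0 < N)%N -> (0 < L)%N ->
  (forall s j, bfun s j <= bfun s (jm s)) ->
  exists2 Theta : det_code X Y S n N -> R, is_dist Theta &
  forall Q m, is_cond_dist Q -> err_prob PS W Theta Q m <=
    L%:R^-1 `^ t * (\sum_s PS s * \sum_u PU s u * (PU s u / margU PS PU u) `^
      t) ^+ n
    + (N * L)%:R `^ t * (\sum_s PS s * bfun s (jm s)) ^+ n.
Proof.
move=> N0 L0 hjm.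
pose pi (u : vec n U) := \prod_i margU PS PU (u i).
pose w (u : vec n U) (s : vec n S) := \prod_i w1 (u i) (s i).
pose v (u : vec n U) (y : vec n Y) := \prod_i v1 (u i) (y i).
pose noise (y z : vec n Y) := \prod_i unif_mix d (y i) (z i).
pose g (u : vec n U) (s : vec n S) : vec n X := [ffun i => f (u i) (s i)].
have L0' : 0 < L%:R :> R by rewrite ltr0n.
have NL0 : 0 < (N * L)%:R :> R by rewrite ltr0n muln_gt0 N0.
have hpi : is_dist pi.
  split=> [u|]; first by apply: prodr_ge0 => i _; exact: margU_ge0.
  by apply: (sum_prod_dist (k := fun _ => margU PS PU)) => i; exact: sum_margU.
have w0 u s : 0 <= w u s by apply: prodr_ge0.
have v0 u y : 0 <= v u y by apply: prodr_ge0.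
pose q (s : vec n S) (u : vec n U) := \prod_i PU (s i) (u i).
(* The encoder's weight changes the codeword law from the marginal of U to the conditional law given
   the states. *)
have piw s u : pi u * w u s = q s u.
  by rewrite -big_split/=; apply: eq_bigr => i _.
have sumq s : \sum_u q s u = 1.
  apply: (sum_prod_dist (k := fun i => PU (s i))) => i.
  by case: (hPU (s i)).
have w_sum s : \sum_u pi u * w u s <= 1.
  by under eq_bigr do rewrite piw; rewrite sumq.
have v_sum y : \sum_u pi u * v u y <= 1.
  have -> : \sum_u pi u * v u y = \prod_i \sum_u margU PS PU u * v1 u (y i).
    rewrite bigA_distr_bigA; apply: eq_bigr => u _.
    by rewrite -big_split.
  apply: prodr_ile1 => i _; rewrite v1_sum andbT sumr_ge0// => u _.
  by rewrite mulr_ge0// margU_ge0.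
have hnoise : is_cond_dist noise.
  apply: (product_cond_dist (Q := fun _ => unif_mix d)) => i.
  exact: unif_mix_dist.
have := one_shot N0 L0 g hpi w0 v0 w_sum v_sum hnoise.
move=> [Th hT good]; exists Th => // Q m hQ.
pose V (s : vec n S) (j : vec n J) (x : vec n X) (y : vec n Y) :=
  \prod_i W (x i) (s i) (j i) (y i).
have V_dist s j x : is_dist (V s j x).
  split=> [y|]; first by apply: prodr_ge0 => i _; case: (hW (x i) (s i) (j i)).
  apply: (sum_prod_dist (k := fun i => W (x i) (s i) (j i))) => i.
  by case: (hW (x i) (s i) (j i)).
pose E s j := \sum_(c : det_code X Y S n N) \sum_(y : vec n Y | c.2 y != Some m)
  Th c * V s j (c.1 (m, s)) y.
have errE : err_prob PS W Th Q m =
    \sum_(s : vec n S) (\prod_i PS (s i)) * \sum_j Q s j * E s j.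
  rewrite /err_prob exchange_big/=; apply: eq_bigr => s _.
  rewrite exchange_big/= mulr_sumr; apply: eq_bigr => j _.
  rewrite /E !mulr_sumr; apply: eq_bigr => c _.
  by rewrite !mulr_sumr; apply: eq_bigr => y _; rewrite /V; ring.
pose a_ (s : vec n S) := \prod_i \sum_u PU (s i) u * w1 u (s i) `^ t.
pose b_ (s : vec n S) (j : vec n J) := \prod_i bfun (s i) (j i).
have EE s j : E s j <= L%:R^-1 `^ t * a_ s + (N * L)%:R `^ t * b_ s j.
  have tot : E s j + \sum_(c : det_code X Y S n N) \sum_(y | c.2 y == Some m)
      Th c * V s j (c.1 (m, s)) y = 1.
    rewrite /E -big_split/=; case: hT => T0 T1; rewrite -[RHS]T1.
    apply: eq_bigr => c _; rewrite addrC.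
    rewrite -(bigID (fun y => c.2 y == Some m) xpredT)/= -mulr_sumr.
    by case: (V_dist s j (c.1 (m, s))) => _ ->; rewrite mulr1.
  have V0 x y : 0 <= V s j x y by case: (V_dist s j x).
  have := good m s (V s j) V0.
  suff : 1 - (L%:R^-1 `^ t * a_ s + (N * L)%:R `^ t * b_ s j) <=
    \sum_u pi u * \sum_y V s j (g u s) y * \sum_z noise y z *
    (L%:R * (w u s * v u z / ((w u s + L%:R) * (v u z + (N * L)%:R)))) by lra.
  have -> : 1 - (L%:R^-1 `^ t * a_ s + (N * L)%:R `^ t * b_ s j) =
      \sum_u \sum_y V s j (g u s) y * \sum_z noise y z *
        (q s u * (1 - (w u s / L%:R) `^ t - ((N * L)%:R / v u z) `^ t)).
    have T3 : (N * L)%:R `^ t * b_ s j = \sum_u \sum_y V s j (g u s) y *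
        \sum_z noise y z * (q s u * ((N * L)%:R / v u z) `^ t).
      have -> : b_ s j = \sum_(u : vec n U) \prod_i (PU (s i) (u i) *
          \sum_z noisy W d (f (u i) (s i)) (s i) (j i) z * (v1 (u i) z)^-1 `^
            t).
        by rewrite /b_ bigA_distr_bigA.
      rewrite mulr_sumr; apply: eq_bigr => u _.
      rewrite big_split/= bigA_distr_bigA/= -/(q s u) mulrCA !mulr_sumr.
      under [RHS]eq_bigr do rewrite mulr_sumr.
      rewrite [RHS]exchange_big/=; apply: eq_bigr => z _.
      rewrite powRM ?invr_ge0// ?ler0n//.
      have -> : (v u z)^-1 `^ t = \prod_i (v1 (u i) (z i))^-1 `^ t.
        by rewrite -powR_prod ?prodfV// => i; rewrite invr_ge0.
      rewrite big_split/=.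
      have -> : \prod_i noisy W d (f (u i) (s i)) (s i) (j i) (z i) =
          \sum_y V s j (g u s) y * noise y z.
        transitivity (\prod_i \sum_y W (f (u i) (s i)) (s i) (j i) y * unif_mix
          d y (z i)).
          by apply: eq_bigr => i _; rewrite sum_unif_mix.
        rewrite bigA_distr_bigA; apply: eq_bigr => y _.
        rewrite -big_split/=; apply: eq_bigr => i _; by rewrite ffunE.
      by rewrite mulr_suml !mulr_sumr; apply: eq_bigr => y _; ring.
    have T2 : L%:R^-1 `^ t * a_ s = \sum_u \sum_y V s j (g u s) y *
        \sum_z noise y z * (q s u * (w u s / L%:R) `^ t).
      rewrite /a_ bigA_distr_bigA mulr_sumr; apply: eq_bigr => u _.
      under eq_bigr do [].
      under [RHS]eq_bigr do rewrite -mulr_suml (proj2 (hnoise _)) mul1r.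
      rewrite -mulr_suml (proj2 (V_dist _ _ _)) mul1r big_split/=.
      rewrite powRM ?invr_ge0 ?ler0n// powR_prod//.
      by rewrite /q; ring.
    have T1 : 1 = \sum_u \sum_y V s j (g u s) y * \sum_z noise y z * q s u.
      rewrite -[LHS](sumq s); apply: eq_bigr => u _.
      under [RHS]eq_bigr do rewrite -mulr_suml (proj2 (hnoise _)) mul1r.
      by rewrite -mulr_suml (proj2 (V_dist _ _ _)) mul1r.
    rewrite T3 T2 {1}T1 opprD addrA -!sumrB; apply: eq_bigr => u _.
    rewrite -!sumrB; apply: eq_bigr => y _.
    rewrite -!mulrBr -!sumrB; congr (_ * _); apply: eq_bigr => z _.
    by ring.
  apply: ler_sum => u _; rewrite mulr_sumr; apply: ler_sum => y _.
  rewrite mulrCA; apply: ler_wpM2l; first exact: V0.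
  rewrite mulr_sumr; apply: ler_sum => z _.
  rewrite [leRHS]mulrCA; apply: ler_wpM2l; first by case: (hnoise y).
  rewrite -piw -mulrA; apply: ler_wpM2l; first by case: hpi.
  have [->|nz] := eqVneq (w u s) 0; first by rewrite !mul0r mulr0.
  have wp : 0 < w u s by rewrite lt_neqAle eq_sym nz w0.
  apply: likelihood_bound => //; apply: prodr_gt0 => i _.
  apply: (v1_gt0 (s := s i)); rewrite lt_neqAle (PU_ge0 hPU) andbT eq_sym.
  apply: contra_neq nz => PU0; rewrite /w (bigD1 i)//= /w1 PU0 !mul0r //.
have b0 s j : 0 <= bfun s j.
  apply: sumr_ge0 => u _; rewrite mulr_ge0 ?(PU_ge0 hPU)// sumr_ge0// => z _.
  by rewrite mulr_ge0 ?powR_ge0// ltW// noisy_gt0.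
rewrite errE.
(* For given states the bound is an average over jamming sequences of a product of letters, each of
   which is largest at [jm]. *)
apply: (@le_trans _ _ (\sum_(s : vec n S) (\prod_i PS (s i)) *
  (L%:R^-1 `^ t * a_ s + (N * L)%:R `^ t * \prod_i bfun (s i) (jm (s i))))).
  apply: ler_sum => s _; apply: ler_wpM2l; first by apply: prodr_ge0 => i _;
    exact: ltW.
  have [Q0 Q1] := hQ s; rewrite -[leRHS]mul1r -[X in _ <= X * _]Q1 mulr_suml.
  apply: ler_sum => j _; apply: ler_wpM2l => //.
  apply: (le_trans (EE s j)); rewrite lerD2l ler_wpM2l ?powR_ge0//.
  by apply: ler_prod => i _; rewrite b0 hjm.
have prodE (F : S -> R) : \sum_(s : vec n S) (\prod_i PS (s i)) * (\prod_i F (s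
  i)) =
    (\sum_s PS s * F s) ^+ n.
  transitivity (\prod_(i < n) \sum_s PS s * F s);
    last by rewrite prodr_const card_ord.
  by rewrite bigA_distr_bigA; apply: eq_bigr => s _; rewrite big_split.
under eq_bigr do rewrite mulrDr.
rewrite big_split/=.
under eq_bigr do rewrite mulrCA.
under [X in _ + X <= _]eq_bigr do rewrite mulrCA.
rewrite -!mulr_sumr /a_ (prodE (fun s => \sum_u PU s u * w1 u s `^ t)).
by rewrite (prodE (fun s => bfun s (jm s))).
Qed.

End BlockCoding.

Section Achievability.
Context (R : realType) (X Y S J U : finType).
Variables (PS : S -> R) (W : X -> S -> J -> Y -> R).
Hypotheses (hX : (0 < #|X|)%N) (hJ : (0 < #|J|)%N).
Hypotheses (hPS : is_dist PS) (hPS_pos : forall s, 0 < PS s).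
Hypothesis hW : forall x s j, is_dist (W x s j).
Context (PU : S -> U -> R) (f : U -> S -> X).
Hypothesis hPU : is_cond_dist PU.

Lemma dist_inhabited (A : finType) (p : A -> R) : is_dist p -> exists a : A,
  True.
Proof.
move=> [_ p1]; have [a _|A0] := pickP (@predT A); first by exists a.
by move: p1; rewrite big_pred0// => /eqP; rewrite eq_sym oner_eq0.
Qed.

Let y0_exists : exists y : Y, True.
Proof.
have [s _] := dist_inhabited hPS.
have /card_gt0P[x _] := hX; have /card_gt0P[j _] := hJ.
exact: dist_inhabited (hW x s j).
Qed.

(** As x ln x is continuous with value 0 at 0 and at 1, the right side tends to [c] when the noise
    level [d] tends to 0. *)
Lemma small_noise (c I m : R) : m < c ->
  exists2 d, 0 < d < 1 & m < (1 - d) * (c + I) + xlnx d + xlnx (1 - d) - I.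
Proof.
move=> mc.
pose F (d : R) := (1 - d) * (c + I) + xlnx d + xlnx (1 - d) - I.
have cF : continuous F.
  have c1 : continuous (fun d : R => 1 - d).
    move=> d; apply: cvgB; [exact: cvg_cst|exact: cvg_id].
  move=> d; apply: cvgB; last exact: cvg_cst.
  apply: cvgD; first apply: cvgD; first apply: cvgM.
  - exact: c1.
  - exact: cvg_cst.
  - exact: continuous_xlnx.
  - apply: (@continuous_comp _ _ _ (fun d : R => 1 - d) (@xlnx R));
    first exact: c1.
    exact: continuous_xlnx.
have F0 : F 0 = c by rewrite /F /xlnx subr0 ln1 mul0r; lra.
have e0 : 0 < c - m by lra.
have /cvgrPdist_lt/(_ _ e0) := cF 0.
rewrite F0 => /nbhs_ballP[r /= r0 Hr].
pose d := Num.min (r / 2) (1 / 2).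
have d0 : 0 < d by rewrite lt_min !divr_gt0.
have dr : d <= r / 2 by rewrite ge_min lexx.
have d12 : d <= 1 / 2 by rewrite ge_min lexx orbT.
exists d; first by rewrite d0/=; lra.
have := Hr d; rewrite /ball/= sub0r normrN gtr0_norm//.
have -> : d < r by lra.
move=> /(_ isT); rewrite ltr_norml => /andP[_]; rewrite -/(F d); lra.
Qed.

(** For a rational rate the blocklength can run over multiples of [b], where the number of messages
    is an integer; such rates suffice for the supremum. *)
Lemma achievable_rate (C : R) (a b : nat) :
  (forall Q, is_cond_dist Q -> C <= gp_gain PS W PU f Q) ->
  (0 < b)%N -> a%:R / b%:R < C ->
  achievable (@max_err R X Y S J PS W) (a%:R / b%:R).
Proof.
move=> HC b0 rC eps eps0.
have [y0 _] := y0_exists.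
pose r : R := ln 2 * (a%:R / b%:R).
pose c : R := ln 2 * C.
have rc : r < c by rewrite ltr_pM2l ?ln2_gt0.
pose IS := infoUS PS PU.
have IS0 : 0 <= IS by exact: infoUS_ge0.
pose mid := (r + c) / 2.
have [d hd dmid] : exists2 d, 0 < d < 1 &
    mid < (1 - d) * (c + IS) + xlnx d + xlnx (1 - d) - IS.
  by apply: small_noise; rewrite /mid; lra.
have [Qs hQs Qopt] := worst_density hJ hPS hPS_pos hW hd y0 f hPU.
have Ndist := noisy_dist hW hd y0.
set LQ := lawUY PS PU f (chan (noisy W d) Qs) in Qopt.
pose Is := minfo LQ.
have Ismid : mid <= Is - IS.
  have H1 := minfo_noisy_ge hPS hW hd y0 f hPU hQs.
  have H2 : c + IS <= minfo (lawUY PS PU f (chan W Qs)).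
    have hV x s := chan_dist hW x s hQs.
    have := HC _ hQs; rewrite -(ler_pM2l (ln2_gt0 R)) gp_gainE// gp_obj_minfo//.
    by rewrite -/c -/IS; lra.
  have d1' : 0 <= 1 - d by move: hd; lra.
  have H3 := ler_wpM2l d1' H2.
  rewrite -/LQ -/Is in H1; lra.
(* The noise may consume half of the gap c - r; the other half is 3 [ga]. It pays one [ga] for the
   bin size and [ga]/2 for the second-order term of the moments. *)
pose ga := (c - r) / 6.
have ga0 : 0 < ga by rewrite /ga; lra.
have gap : r + IS - Is <= - 3 * ga by move: Ismid; rewrite /mid /ga; lra.
have hVs x s := chan_dist Ndist x s hQs.
have LQ0 u y : 0 <= LQ u y by exact: lawUY_ge0.
have LQm u : \sum_y LQ u y = margU PS PU u by exact: sum_lawUY_y.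
have LQpos u y : 0 < margU PS PU u -> 0 < LQ u y by exact: lawUY_noisy_gt0.
pose Yq y := \sum_u LQ u y.
pose v1 u y := LQ u y / (margU PS PU u * Yq y).
have mU0 := margU_ge0 hPS hPU.
have Yq0 y : 0 <= Yq y by exact: sumr_ge0.
have v1_ge0 u y : 0 <= v1 u y by rewrite divr_ge0 ?mulr_ge0.
have Yqpos u y : 0 < margU PS PU u -> 0 < Yq y.
  by move=> m0; rewrite /Yq (bigD1 u)//= ltr_pwDl ?LQpos ?sumr_ge0.
have v1_pos u y : 0 < margU PS PU u -> 0 < v1 u y.
  by move=> m0; rewrite divr_gt0 ?LQpos// mulr_gt0// (Yqpos u).
have v1_gt0 s u y : 0 < PU s u -> 0 < v1 u y.
  by move=> /(PU_gt0_margU hPS hPS_pos hPU); exact: v1_pos.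
have v1_ln u y : 0 < margU PS PU u -> ln (v1 u y)^-1 = - idens LQ u y.
  move=> m0; have l0 := LQpos _ y m0; have q0 := Yqpos _ y m0.
  rewrite lnV ?posrE ?v1_pos// /idens LQm -/(Yq y) /v1.
  by rewrite ln_div ?posrE ?mulr_gt0// lnM ?posrE//; ring.
have v1_sum y : \sum_u margU PS PU u * v1 u y <= 1.
  have [Y0|Y0] := eqVneq (Yq y) 0.
    by rewrite big1// => u _; rewrite /v1 Y0 mulr0 invr0 !mulr0.
  apply: (@le_trans _ _ (\sum_u LQ u y / Yq y));
    last by rewrite -mulr_suml divff.
  apply: ler_sum => u _; have [m0|m0] := eqVneq (margU PS PU u) 0.
    by rewrite m0 mul0r divr_ge0.
  rewrite le_eqVlt; apply/orP; left; apply/eqP.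
  by rewrite /v1; field; rewrite Y0.
pose w1 u s := PU s u / margU PS PU u.
(* A common bound for all logarithms that occur; the summand 1 forces t <= 1 below. *)
pose B := 1 + \sum_s \sum_u `|ln (w1 u s)| + \sum_u \sum_y `|ln (v1 u y)^-1|.
have sumw0 : 0 <= \sum_s \sum_u `|ln (w1 u s)|.
  by apply: sumr_ge0 => s _; apply: sumr_ge0.
have sumv0 : 0 <= \sum_u \sum_y `|ln (v1 u y)^-1|.
  by apply: sumr_ge0 => s _; apply: sumr_ge0.
have B1 : 1 <= B by rewrite /B; lra.
have Bw u s : `|ln (w1 u s)| <= B.
  apply: (@le_trans _ _ (\sum_s \sum_u `|ln (w1 u s)|)); last by rewrite /B;
    lra.
  rewrite (bigD1 s)//= (bigD1 u)//= -addrA lerDl addr_ge0 ?sumr_ge0// => s' _.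
  exact: sumr_ge0.
have Bv u y : `|ln (v1 u y)^-1| <= B.
  apply: (@le_trans _ _ (\sum_u \sum_y `|ln (v1 u y)^-1|));
    last by rewrite /B; lra.
  rewrite (bigD1 u)//= (bigD1 y)//= -addrA lerDl addr_ge0 ?sumr_ge0// => s' _.
  exact: sumr_ge0.
have B0 : 0 < B by lra.
(* The first bound meets the requirement t B <= 1/2 of [mgf_bound], the second makes its quadratic
   term at most t [ga]/2. *)
pose t := Num.min (1 / (2 * B)) (ga / (4 * B ^+ 2)).
have t0 : 0 < t.
  rewrite lt_min; apply/andP; split; apply: divr_gt0 => //.
    exact: mulr_gt0.
  by rewrite mulr_gt0// exprn_gt0.
have tB : t * B <= 1 / 2.
  have : t <= 1 / (2 * B) by rewrite ge_min lexx.
  move=> /(ler_wpM2r (ltW B0)) /le_trans; apply.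
  by rewrite le_eqVlt; apply/orP; left; apply/eqP; field; rewrite gt_eqF.
have t1 : t <= 1 by have := ler_wpM2l (ltW t0) B1; lra.
have ht : 0 < t <= 1 by rewrite t0.
have tB2 : 2 * (t * B) ^+ 2 <= t * (ga / 2).
  have : t <= ga / (4 * B ^+ 2) by rewrite ge_min lexx orbT.
  rewrite ler_pdivlMr ?mulr_gt0 ?exprn_gt0// => H.
  have := ler_wpM2l (ltW t0) H; rewrite exprMn !expr2; lra.
pose bfun s j := \sum_u PU s u * \sum_z noisy W d (f u s) s j z * (v1 u z)^-1
  `^ t.
have /card_gt0P[j0 _] := hJ.
pose jm s := [arg max_(j > j0) bfun s j]%O.
have hjm s j : bfun s j <= bfun s (jm s).
  by rewrite /jm; case: arg_maxP => // j' _; apply.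
pose A := \sum_s PS s * \sum_u PU s u * w1 u s `^ t.
pose Bt := \sum_s PS s * bfun s (jm s).
have PUge := PU_ge0 hPU; have PSge := PS_ge0 hPS.
have Abound : A <= expR (t * IS + t * (ga / 2)).
  have := @mgf_bound R (S * U)%type (fun x => PS x.1 * PU x.1 x.2)
    (fun x => w1 x.2 x.1) B t _ _ _ t0 tB.
  rewrite -(pair_bigA _ (fun s u => PS s * PU s u * w1 u s `^ t))/=.
  rewrite -(pair_bigA _ (fun s u => PS s * PU s u * ln (w1 u s)))/=.
  have -> : \sum_s \sum_u PS s * PU s u * w1 u s `^ t = A.
    by apply: eq_bigr => s _; rewrite mulr_sumr; apply: eq_bigr => u _;
      rewrite mulrA.
  move=> H; apply: (le_trans (H _ _ _)); last by rewrite ler_expR lerD2l.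
  - split=> [x|]; first by rewrite mulr_ge0.
    rewrite -(pair_bigA _ (fun s u => PS s * PU s u))/=.
    case: hPS => _ <-; apply: eq_bigr => s _; rewrite -mulr_sumr.
    by case: (hPU s) => _ ->; rewrite mulr1.
  - move=> [s u] /=; rewrite pmulr_rgt0// => p.
    by rewrite divr_gt0//; exact: PU_gt0_margU p.
  - by move=> x; exact: Bw.
have Bbound : Bt <= expR (- (t * Is) + t * (ga / 2)).
  pose mu (x : S * U * Y) := PS x.1.1 * PU x.1.1 x.1.2 *
    noisy W d (f x.1.2 x.1.1) x.1.1 (jm x.1.1) x.2.
  have musum (F : S -> U -> Y -> R) : \sum_x mu x * F x.1.1 x.1.2 x.2 =
      \sum_s \sum_u \sum_z PS s * PU s u * noisy W d (f u s) s (jm s) z * F s u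
        z.
    by rewrite pair_bigA pair_bigA.
  have mu_dist : is_dist mu.
    split=> [x|].
      rewrite !mulr_ge0//; by case: (Ndist (f x.1.2 x.1.1) x.1.1 (jm x.1.1)).
    transitivity (\sum_x mu x * 1); first by apply: eq_bigr => x _;
      rewrite mulr1.
    rewrite (musum (fun _ _ _ => 1)); case: (hPS) => _ PS1;
      rewrite -[RHS]PS1; apply: eq_bigr => s _.
    transitivity (\sum_u PS s * PU s u); last first.
      by rewrite -mulr_sumr; case: (hPU s) => _ ->; rewrite mulr1.
    apply: eq_bigr => u _; rewrite -mulr_suml mulr1 -mulr_sumr.
    by case: (Ndist (f u s) s (jm s)) => _ ->; rewrite mulr1.
  have mupos x : 0 < mu x -> 0 < margU PS PU x.1.2.
    move=> p; apply: (PU_gt0_margU hPS hPS_pos hPU (s := x.1.1)).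
    rewrite lt_neqAle PUge andbT eq_sym; apply/eqP => e.
    by move: p; rewrite /mu e mulr0 mul0r ltxx.
  have := @mgf_bound R (S * U * Y)%type mu (fun x => (v1 x.1.2 x.2)^-1) B t
    mu_dist _ _ t0 tB.
  rewrite (musum (fun _ u z => (v1 u z)^-1 `^ t)).
  have -> : \sum_s \sum_u \sum_z PS s * PU s u * noisy W d (f u s) s (jm s) z *
      (v1 u z)^-1 `^ t = Bt.
    apply: eq_bigr => s _; rewrite /bfun mulr_sumr; apply: eq_bigr => u _.
    by rewrite mulrA mulr_sumr; apply: eq_bigr => z _; rewrite mulrA.
  move=> H; apply: (le_trans (H _ _)).
  - by move=> x /mupos m0; rewrite invr_gt0 v1_pos.
  - by move=> x; exact: Bv.
  rewrite ler_expR lerD// -mulrN ler_wpM2l ?(ltW t0)//.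
  (* [jm] viewed as a deterministic jamming kernel: by the optimality of [Qs], the mean of the
     density under it is at least [Is]. *)
  pose Qj s j : R := (j == jm s)%:R.
  have hQj : is_cond_dist Qj.
    move=> s; split=> [j|]; first by rewrite ler0n.
    rewrite /Qj (bigD1 (jm s))//= eqxx big1 ?addr0// => j /negbTE ->//.
  have := Qopt _ hQj; rewrite -/Is => HI.
  suff -> : \sum_x mu x * ln (v1 x.1.2 x.2)^-1 =
      - \sum_u \sum_y lawUY PS PU f (chan (noisy W d) Qj) u y * idens LQ u y by
        lra.
  transitivity (\sum_x mu x * - idens LQ x.1.2 x.2).
    apply: eq_bigr => x _; have [->|nz] := eqVneq (mu x) 0;
      first by rewrite !mul0r.
    rewrite v1_ln//; apply: mupos; rewrite lt_neqAle eq_sym nz/=.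
    by case: mu_dist.
  rewrite (musum (fun _ u z => - idens LQ u z)) exchange_big/= -sumrN.
  apply: eq_bigr => u _; rewrite exchange_big/= -sumrN; apply: eq_bigr => y _.
  rewrite /lawUY mulr_suml -sumrN; apply: eq_bigr => s _.
  by rewrite /chan /Qj sum_eq_indic mulrN.
pose ka := t * (ga / 2).
have ka0 : 0 < ka by rewrite mulr_gt0// divr_gt0.
(* The error will be at most 3 exp(-n ka), which is below 3/(n ka), and n >= k. *)
have [k Hk] : exists k : nat, 3 / (eps * ka) < k%:R.
  exists (Num.truncn (3 / (eps * ka))).+1.
  by have /andP[] := truncn_itv (ltW (divr_gt0 (ltr0Sn R 2) (mulr_gt0 eps0
    ka0))).
pose n := (b * k.+1)%N; pose N := (2 ^ (a * k.+1))%N.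
(* Slightly more than I(U;S) nats of codewords per letter for each message; rounding up costs a
   factor of at most 2, carried by [term2]. *)
pose L := (Num.truncn (expR (n%:R * (IS + ga)))).+1.
have n0 : (0 < n)%N by rewrite muln_gt0 b0.
have N0 : (0 < N)%N by rewrite expn_gt0.
have nr : n%:R * (a%:R / b%:R) = (a * k.+1)%:R :> R.
  by rewrite /n !natrM; field; rewrite pnatr_eq0 -lt0n.
have NE : N%:R = expR (n%:R * r).
  by rewrite /r mulrCA nr mulrC expRM_natl lnK ?posrE// -natrX.
have := @block_coding R X Y S J U PS W hPS hPS_pos hW d hd y0 PU f hPU v1 t
  v1_ge0 v1_gt0 v1_sum ht n N L jm N0 (ltn0Sn _) hjm.
move=> [Th hTh Herr].
exists n, N, Th; split=> //.
  by rewrite nr powR_mulrn// natrX.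
have eL : expR (n%:R * (IS + ga)) < L%:R.
  by have /andP[] := truncn_itv (expR_ge0 (n%:R * (IS + ga))).
have Le : L%:R <= 2 * expR (n%:R * (IS + ga)).
  have h1 : 1 <= expR (n%:R * (IS + ga)).
    by rewrite -expR0 ler_expR mulr_ge0// addr_ge0// ltW.
  rewrite /L -natr1.
  have /andP[] := truncn_itv (expR_ge0 (n%:R * (IS + ga))); lra.
have L0 : 0 < L%:R :> R by rewrite ltr0n.
have A0 : 0 <= A.
  apply: sumr_ge0 => s _; rewrite mulr_ge0// sumr_ge0// => u _.
  by rewrite mulr_ge0 ?powR_ge0.
have Bt0 : 0 <= Bt.
  apply: sumr_ge0 => s _; rewrite mulr_ge0// sumr_ge0// => u _.
  rewrite mulr_ge0// sumr_ge0// => z _; rewrite mulr_ge0 ?powR_ge0//.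
  by case: (Ndist (f u s) s (jm s)).
have powE (x : R) : expR x `^ t = expR (t * x) by rewrite -expRM mulrC.
have term1 : L%:R^-1 `^ t * A ^+ n <= expR (- (n%:R * ka)).
  have h1 : L%:R^-1 `^ t <= expR (- (t * (n%:R * (IS + ga)))).
    rewrite -mulrN -powE ge0_ler_powR ?nnegrE ?(ltW t0) ?invr_ge0 ?expR_ge0//.
    by rewrite expRN lef_pV2 ?posrE ?expR_gt0// ltW.
  have h2 : A ^+ n <= expR (n%:R * (t * IS + t * (ga / 2))).
    by rewrite expRM_natl lerXn2r ?nnegrE ?expR_ge0.
  apply: (le_trans (ler_pM (powR_ge0 _ _) (exprn_ge0 n A0) h1 h2)).
  by rewrite -expRD ler_expR /ka; lra.
have term2 : (N * L)%:R `^ t * Bt ^+ n <= 2 * expR (- (n%:R * ka)).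
  have h0 : (N * L)%:R <= 2 * expR (n%:R * (r + IS + ga)).
    rewrite natrM NE (_ : n%:R * (r + IS + ga) = n%:R * r + n%:R * (IS + ga));
      last by ring.
    by rewrite expRD [leRHS]mulrCA ler_wpM2l ?expR_ge0.
  have h1 : (N * L)%:R `^ t <= 2 * expR (t * (n%:R * (r + IS + ga))).
    apply: (@le_trans _ _ ((2 * expR (n%:R * (r + IS + ga))) `^ t)).
      by rewrite ge0_ler_powR ?nnegrE ?(ltW t0) ?ler0n ?mulr_ge0 ?expR_ge0.
    rewrite powRM ?expR_ge0// powE ler_wpM2r ?expR_ge0//.
    by rewrite -[leRHS](powRr1 (ler0n R 2)) ler_powR// ler1n.
  have h2 : Bt ^+ n <= expR (n%:R * (- (t * Is) + t * (ga / 2))).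
    by rewrite expRM_natl lerXn2r ?nnegrE ?expR_ge0.
  apply: (le_trans (ler_pM (powR_ge0 _ _) (exprn_ge0 n Bt0) h1 h2)).
  rewrite -[leLHS]mulrA ler_wpM2l// -expRD ler_expR.
  have hg : t * n%:R * (r + IS - Is) <= t * n%:R * (- 3 * ga).
    by rewrite ler_wpM2l// mulr_ge0 ?ler0n// ltW.
  have hg2 : 0 <= t * n%:R * ga.
    by apply: mulr_ge0; [apply: mulr_ge0; [exact: ltW|exact: ler0n]|exact: ltW].
  rewrite /ka; lra.
have small : 3 * expR (- (n%:R * ka)) < eps.
  have kn : k%:R <= n%:R :> R.
    by rewrite ler_nat /n (leq_trans (leqnSn k))// leq_pmull.
  have h1 : 3 < eps * (n%:R * ka).
    move: Hk; rewrite ltr_pdivrMr; last exact: mulr_gt0.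
    move=> Hk.
    apply: (lt_le_trans Hk); rewrite [leLHS]mulrCA; apply: ler_wpM2l;
      first exact: ltW.
    by apply: ler_wpM2r => //; exact: ltW.
  have h2 : n%:R * ka < expR (n%:R * ka).
    by apply: lt_le_trans (expR_ge1Dx _); lra.
  rewrite expRN -[_ * _^-1]/(3 / _) ltr_pdivrMr ?expR_gt0//.
  by apply: (lt_trans h1); rewrite ltr_pM2l.
apply: le_lt_trans small.
apply: bigmax_le => [|m _]; first by rewrite mulr_ge0 ?expR_ge0.
apply: worst_err_prob_le => // Q hQ.
apply: (le_trans (Herr Q m hQ)); rewrite -/(A) -/(Bt).
have := lerD term1 term2; lra.
Qed.

(** A single message, always declared, is never decoded wrongly. Rate 0 serves the thresholds c < 0,
    so that the coding argument is only called at positive rationals. *)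
Lemma achievable_zero : achievable (@max_err R X Y S J PS W) 0.
Proof.
move=> eps eps0.
have /card_gt0P[x0 _] := hX.
pose c0 : det_code X Y S 1 1 := ([ffun _ => [ffun _ => x0]],
  [ffun _ => Some ord0]).
pose Th (c : det_code X Y S 1 1) : R := (c == c0)%:R.
exists 1%N, 1%N, Th; split=> //; first by rewrite mulr0 powRr0.
  split=> [c|]; first by rewrite ler0n.
  by rewrite (bigD1 c0)//= /Th eqxx big1 ?addr0// => c /negbTE ->.
apply: le_lt_trans eps0; apply: bigmax_le => // m _.
apply: worst_err_prob_le => // Q hQ.
rewrite /err_prob big1// => c _; rewrite /Th.
have [->|_] := eqVneq c c0; last first.
  by apply: big1 => s _; apply: big1 => j _; apply: big1 => y _; rewrite !mul0r.
apply: big1 => s _; apply: big1 => j _; apply: big_pred0 => y.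
by apply/negbTE; rewrite negbK /= ffunE [m]ord1.
Qed.

End Achievability.

(** * Equality of the capacities *)

(** Achievability passes from a larger criterion to a smaller one. A converse for [err] and a direct
    part for [err'] therefore settle every criterion between the two. *)
Lemma capacity_eq (R : realType) (X Y S : finType)
    (err err' : forall n N : nat, (det_code X Y S n N -> R) -> R) (C : R) :
  (forall r, achievable err r -> r <= C) ->
  (forall c, c < C -> exists2 r, c < r & achievable err' r) ->
  forall e : forall n N : nat, (det_code X Y S n N -> R) -> R,
  (forall n N Th, is_dist Th -> err n N Th <= e n N Th) ->
  (forall n N Th, is_dist Th -> e n N Th <= err' n N Th) ->
  capacity e = C%:E.
Proof.
move=> conv ach e err_e e_err'.
have achW (e1 e2 : forall n N : nat, (det_code X Y S n N -> R) -> R) r :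
    (forall n N Th, is_dist Th -> e1 n N Th <= e2 n N Th) ->
    achievable e2 r -> achievable e1 r.
  move=> e12 H eps eps0; have [n [N [Th [n0 NE hTh He]]]] := H eps eps0.
  by exists n, N, Th; split=> //; apply: le_lt_trans He; exact: e12.
apply/eqP; rewrite eq_le; apply/andP; split.
  apply: ge_ereal_sup => _ [r /= Hr <-]; rewrite lee_fin.
  by apply: conv; exact: achW Hr.
apply/lee_subgt0Pr => x x0.
have [|r cr Hr] := ach (C - x); first by rewrite ltrBlDr ltrDl.
apply: (@le_trans _ _ r%:E).
  by rewrite -EFinB lee_fin ltW.
by apply: ereal_sup_ubound; exists r => //=; exact: achW Hr.
Qed.

Theorem mainTheorem2 (R : realType) (X Y S J : finType)
    (hX : (0 < #|X|)%N) (hJ : (0 < #|J|)%N)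
    (PS : S -> R) (hPS : is_dist PS) (hPS_pos : forall s, 0 < PS s)
    (W : X -> S -> J -> Y -> R) (hW : forall x s j, is_dist (W x s j)) :
  exists C : R,
    [/\ is_gp_maxmin PS W C,
        capacity (@avg_err R X Y S J PS W) = C%:E,
        capacity (@max_err R X Y S J PS W) = C%:E,
        capacity (@avg_err_oblivious R X Y S J PS W) = C%:E
      & capacity (@max_err_oblivious R X Y S J PS W) = C%:E].
Proof.
have [C [Cmaxmin [P hP HP] Hconv]] := gp_maxmin_exists hX hJ hPS_pos hW.
exists C.
have conv r : achievable (@avg_err_oblivious R X Y S J PS W) r -> r <= C.
  exact: converse_rate.
have ach c : c < C -> exists2 r, c < r & achievable (@max_err R X Y S J PS W) r.
  move=> cC; have [c0|c0] := ltP c 0.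
    by exists 0 => //; exact: achievable_zero.
  have [q /andP[cq qC]] : exists q : rat, c < ratr q < C.
    by have [q] := rat_in_itvoo cC; rewrite in_itv/= => H; exists q.
  have q0 : 0 < q by rewrite -(ltr0q R) (le_lt_trans c0).
  have qE : ratr q = `|numq q|%N%:R / `|denq q|%N%:R :> R.
    by rewrite !natr_absz !ger0_norm ?numq_ge0 ?ltW ?denq_gt0.
  exists (ratr q) => //; rewrite qE;
    apply: (achievable_rate hX hJ hPS hPS_pos hW hP HP).
    by rewrite absz_gt0 denq_neq0.
  by rewrite -qE.
split=> //; apply: (capacity_eq conv ach) => n N Th hTh //.
- exact: avg_err_oblivious_le_avg_err.
- exact: avg_err_le_max_err.
- apply: (le_trans (avg_err_oblivious_le_avg_err hPS hW hJ hTh)).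
  exact: avg_err_le_max_err.
- apply: (le_trans (avg_err_oblivious_le_avg_err hPS hW hJ hTh)).
  exact: avg_err_le_max_err.
- exact: avg_err_oblivious_le_max_err_oblivious.
- exact: max_err_oblivious_le_max_err.
Qed.
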